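(* Let $(\Gamma,n)$ be a connected decorated Laman graph for $\mathbb C^d\times\mathbb R^{d'}$ without self-loops, and let $\Phi\in\Omega^\bullet_c\big((\mathbb R^{d'}\times\mathbb C^d)^{|\Gamma_0|}\big)$. If $d'\ge1$ and the first Betti number $h_1(\Gamma)=\dim H_1(\Gamma)$ is odd, then $$O_{(\Gamma,n)}(\Phi)=0 .$$
   Context: Graphs: a directed graph $\Gamma$ has finite ordered sets of vertices $\Gamma_0$ and edges $\Gamma_1$ and maps $t,h:\Gamma_1\to\Gamma_0$ (tail, head); no self-loops means $t(e)\ne h(e)$ for all $e$. A decoration is a map $n:\Gamma_1\to(\mathbb Z_{\ge0})^d$, $e\mapsto(n_{1,e},\dots,n_{d,e})$. Laman graph for $\mathbb C^d\times\mathbb R^{d'}$: a connected directed graph without self-loops such that $(d+d')|\Gamma'_0|\ge(d+d'-1)|\Gamma'_1|+d+d'+1$ for every subgraph $\Gamma'$ with $|\Gamma'_0|\ge2$, with equality for $\Gamma'=\Gamma$. Propagator in Schwinger space: for $t>0$ let $H(t,z,\bar z,x)=\frac{1}{2^{d+d'}(\pi t)^{d+d'/2}}e^{-(2\sum z_i\bar z_i+\sum x_j^2)/4t}\,d^d\bar z\,d^{d'}x$, $\bar\partial^*_z=-2\sum_i\partial_{z_i}\iota_{\partial_{\bar z_i}}$, $d^*_x=-\sum_j\partial_{x_j}\iota_{\partial_{x_j}}$, and $P_t=-dt\wedge(\bar\partial_z^*+d^*_x)H+H$, evaluated at differences of points (pullback by the difference map). Set $$\tilde W((\Gamma,n),\Phi)=\prod_{e\in\Gamma_1}\Big(\prod_{i=1}^d\partial_{z_i^{h(e)}}^{n_{i,e}}\Big)P_{t_e}\big(z^{h(e)}-z^{t(e)},\bar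 z^{h(e)}-\bar z^{t(e)},x^{h(e)}-x^{t(e)}\big)\wedge\Phi,$$ a form on $(\mathbb R^{d'}\times\mathbb C^d)^{|\Gamma_0|}\times(0,\infty)^{|\Gamma_1|}$, where $(z^i,x^i)$ is the coordinate at vertex $i$ and $t_e$ the coordinate at edge $e$. Let $t_{square}:(t_e)\mapsto(t_e^2)$ on $(0,\infty)^{|\Gamma_1|}$. Anomaly integral: let $C_{\Gamma_1}=\{(\rho,(\xi_e)_{e\in\Gamma_1})\in[0,\infty)\times(0,\infty)^{|\Gamma_1|}:\sum_e\xi_e^2=1\}$ with the map $t_e=\rho\xi_e$, whose part $\rho>0$ is identified with $(0,\infty)^{|\Gamma_1|}$, and let $\partial C_{\Gamma_1}=\{\rho=0\}$. The form $t_{square}^*\int_{(\mathbb R^{d'}\times\mathbb C^d)^{|\Gamma_0|}}\tilde W((\Gamma,n),\Phi)$ (integration along the fibres) extends smoothly to $C_{\Gamma_1}$, and $$O_{(\Gamma,n)}(\Phi)=\int_{\partial C_{\Gamma_1}}t_{square}^*\int_{(\mathbb R^{d'}\times\mathbb C^d)^{|\Gamma_0|}}\tilde W((\Gamma,n),\Phi).$$ *)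

(* Defs.v *)
From HB Require Import structures.
From mathcomp Require Import all_boot all_order all_algebra.
From mathcomp Require Import all_classical all_reals all_analysis.
From mathcomp Require Import complex.
Set Implicit Arguments. Unset Strict Implicit. Unset Printing Implicit Defensive.
Import Order.TTheory GRing.Theory Num.Theory.
Import numFieldNormedType.Exports.
Local Open Scope classical_set_scope.
Local Open Scope ring_scope.

(** ** Complex exterior algebra of [R^n] *)

(* [a A] is the coefficient of [e_{i1} /\ ... /\ e_{ik}], A = {i1 < ... < ik}. *)
Definition ext (R : realType) (n : nat) := {ffun {set 'I_n} -> R[i]}.

Definition ext1 {R : realType} {n : nat} : ext R n := [ffun A => (A == finset.set0)%:R].

Definition ext_scale {R : realType} {n : nat} (c : R[i]) (a : ext R n) : ext R n :=
  [ffun A => c * a A].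

Definition inversions {n : nat} (A B : {set 'I_n}) : nat :=
  #|[set p : 'I_n * 'I_n | [&& p.1 \in A, p.2 \in B & (p.2 < p.1)%N]]|.

Definition wedge {R : realType} {n : nat} (a b : ext R n) : ext R n :=
  [ffun C : {set 'I_n} => \sum_(A : {set 'I_n} | A \subset C)
     (-1) ^+ inversions A (C :\: A) * a A * b (C :\: A)].

Definition covector {R : realType} {n : nat} (v : 'rV[R[i]]_n) : ext R n :=
  [ffun A : {set 'I_n} => \sum_(i | A == [set i]%SET) v 0 i].

(* Antiderivation of degree -1 with [contract v (covector u) = (\sum_i v_i u_i) 1]. *)
Definition contract {R : realType} {n : nat} (v : 'rV[R[i]]_n) (a : ext R n) :
    ext R n :=
  [ffun A : {set 'I_n} => \sum_(i | i \notin A)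
     (-1) ^+ #|[set j in A | (j < i)%N]| * v 0 i * a (i |: A)%SET].

(** ** Differential forms with complex coefficients *)

Definition dform (R : realType) (n : nat) := 'rV[R]_n -> ext R n.

Definition form_wedge {R : realType} {n : nat} (a b : dform R n) : dform R n :=
  fun x => wedge (a x) (b x).

Definition form1 {R : realType} {n : nat} : dform R n := fun=> ext1.

Definition pullback {R : realType} {m n : nat} (f : 'rV[R]_m -> 'rV[R]_n)
    (w : dform R n) : dform R m := fun x =>
  \sum_(A : {set 'I_n}) ext_scale (w (f x) A)
    (\big[wedge/ext1]_(j <- enum A) covector (\row_i (jacobian f x i j)%:C%C)).

Definition cderive {R : realType} {n : nat} (i : 'I_n) (f : 'rV[R]_n -> R[i])
    (x : 'rV[R]_n) : R[i] :=
  ('D_('e_i) (fun y => complex.Re (f y)) x +i* 'D_('e_i) (fun y => complex.Im (f y)) x)%C.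

(* The operator [(d/da - i d/db) / 2] on coefficients: d/dz for z = a + i b. *)
Definition wirtinger {R : realType} {n : nat} (a b : 'I_n) (w : dform R n) :
    dform R n := fun x =>
  [ffun A : {set 'I_n} =>
     (cderive a (w^~ A) x - 'i%C * cderive b (w^~ A) x) / 2].

Definition smooth_on {R : realType} {n : nat} (U : set 'rV[R]_n)
    (f : 'rV[R]_n -> R) : Prop :=
  forall s : seq 'I_n,
    let g := foldr (fun i h => 'D_('e_i) h) f s in
    forall x, U x -> {for x, continuous g} /\ forall i, derivable g x 'e_i.

Definition smooth_form {R : realType} {n : nat} (U : set 'rV[R]_n)
    (w : dform R n) : Prop :=
  forall A, smooth_on U (fun x => complex.Re (w x A)) /\ smooth_on U (fun x => complex.Im (w x A)).

Definition compactly_supported {R : realType} {n : nat} (w : dform R n) : Prop :=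
  exists2 K : set 'rV[R]_n, compact K & forall x, ~ K x -> w x = 0.

(** ** Integration *)

(* Lebesgue integral over [R^n], computed as an iterated integral (Fubini). *)
Fixpoint integral_rV {R : realType} (n : nat) : ('rV[R]_n -> R) -> R :=
  match n return ('rV[R]_n -> R) -> R with
  | 0 => fun f => f 0
  | m.+1 => fun f => Rintegral lebesgue_measure setT
      (fun s : R => integral_rV (fun v : 'rV[R]_m => f (row_mx (s%:M : 'rV[R]_1) v)))
  end.

Definition cintegral_rV {R : realType} {n : nat} (f : 'rV[R]_n -> R[i]) : R[i] :=
  (integral_rV (fun x => complex.Re (f x)) +i* integral_rV (fun x => complex.Im (f x)))%C.

(* Integration along the fibres of [R^m * R^n -> R^n]; the sign is fixed by
   [fiber_integral (f dx_1 ... dx_m /\ b) = (\int f) b] for [b] a form in the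
   base coordinates. *)
Definition fiber_integral {R : realType} {m n : nat} (w : dform R (m + n)) :
    dform R n := fun t =>
  [ffun B : {set 'I_n} => cintegral_rV (fun x : 'rV[R]_m =>
     w (row_mx x t)
       ([set lshift n i | i in 'I_m] :|: [set rshift m e | e in B])%SET)].

(** ** Graphs *)

Record digraph := Digraph {
  nV : nat;
  nE : nat;
  tail : 'I_nE -> 'I_nV;
  head : 'I_nE -> 'I_nV }.

Definition no_self_loops (G : digraph) : Prop :=
  forall e : 'I_(nE G), tail e <> head e.

Definition adjacent (G : digraph) : rel 'I_(nV G) := fun v w =>
  [exists e : 'I_(nE G), ((tail e == v) && (head e == w)) ||
                         ((tail e == w) && (head e == v))].

Definition connected_graph (G : digraph) : Prop :=
  (0 < nV G)%N /\ forall v w : 'I_(nV G), connect (@adjacent G) v w.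

Definition subgraph (G : digraph) (S : {set 'I_(nV G)}) (T : {set 'I_(nE G)}) :
    Prop :=
  forall e, e \in T -> tail e \in S /\ head e \in S.

Definition laman (d d' : nat) (G : digraph) : Prop :=
  [/\ connected_graph G, no_self_loops G,
      forall (S : {set 'I_(nV G)}) (T : {set 'I_(nE G)}),
        subgraph S T -> (2 <= #|S|)%N ->
        ((d + d')%:Z - 1) * #|T|%:Z + (d + d')%:Z + 1 <= (d + d')%:Z * #|S|%:Z
    & (d + d')%:Z * (nV G)%:Z = ((d + d')%:Z - 1) * (nE G)%:Z + (d + d')%:Z + 1].

(* The simplicial boundary map, acting on row vectors. *)
Definition boundary_map (G : digraph) : 'M[rat]_(nE G, nV G) :=
  \matrix_(e, v) ((head e == v)%:R - (tail e == v)%:R).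

(* dim H_1: there are no 2-cells, so H_1 is the kernel of the boundary map. *)
Definition betti1 (G : digraph) : nat := \rank (kermx (boundary_map G)).

(* [n e i] is n_{i,e}. *)
Definition decoration (d : nat) (G : digraph) := 'I_(nE G) -> 'I_d -> nat.

(** ** Propagator in Schwinger space *)

(* Real dimension of [R^d' * C^d], with coordinates x_1 .. x_d',
   Re z_1, Im z_1, .. , Re z_d, Im z_d in this order. *)
Definition pdim (d d' : nat) : nat := (d' + d * 2)%N.

Definition ix {d d' : nat} (j : 'I_d') : 'I_(pdim d d') := lshift (d * 2) j.
Definition ire {d d' : nat} (i : 'I_d) : 'I_(pdim d d') :=
  rshift d' (mxvec_index i (ord0 : 'I_2)).
Definition iim {d d' : nat} (i : 'I_d) : 'I_(pdim d d') :=
  rshift d' (mxvec_index i (ord_max : 'I_2)).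

(* Coordinates on [(R^d' * C^d) * (0, +oo)]. *)
Definition px {d d' : nat} (j : 'I_d') : 'I_(pdim d d' + 1) := lshift 1 (ix j).
Definition pre {d d' : nat} (i : 'I_d) : 'I_(pdim d d' + 1) := lshift 1 (ire i).
Definition pim {d d' : nat} (i : 'I_d) : 'I_(pdim d d' + 1) := lshift 1 (iim i).
Definition pt {d d' : nat} : 'I_(pdim d d' + 1) := rshift (pdim d d') ord0.

Definition heat_coef {R : realType} (d d' : nat) (p : 'rV[R]_(pdim d d' + 1)) : R :=
  (2 ^+ (d + d') * (pi * p 0 pt) `^ (d%:R + d'%:R / 2))^-1 *
  expR (- (2 * (\sum_(i < d) (p 0 (pre i) ^+ 2 + p 0 (pim i) ^+ 2)) +
           \sum_(j < d') p 0 (px j) ^+ 2) / (4 * p 0 pt)).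

Definition dzbar {R : realType} (d d' : nat) (i : 'I_d) : ext R (pdim d d' + 1) :=
  covector ('e_(pre i) - 'i%C *: 'e_(pim i)).

Definition heat_form {R : realType} (d d' : nat) : dform R (pdim d d' + 1) := fun p =>
  ext_scale (heat_coef p)%:C%C
    (wedge (\big[wedge/ext1]_(i < d) dzbar d' i)
           (\big[wedge/ext1]_(j < d') covector 'e_(px j))).

(* The vector field d/d zbar_i. *)
Definition vzbar {R : realType} (d d' : nat) (i : 'I_d) :
    'rV[R[i]]_(pdim d d' + 1) :=
  2^-1 *: ('e_(pre i) + 'i%C *: 'e_(pim i)).

Definition dbar_adj {R : realType} (d d' : nat) (w : dform R (pdim d d' + 1)) :
    dform R (pdim d d' + 1) := fun p =>
  ext_scale (- 2) (\sum_(i < d)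
    wirtinger (pre i) (pim i) (fun q => contract (vzbar d' i) (w q)) p).

Definition d_adj {R : realType} (d d' : nat) (w : dform R (pdim d d' + 1)) :
    dform R (pdim d d' + 1) := fun p =>
  - \sum_(j < d') [ffun A : {set 'I_(pdim d d' + 1)} =>
      cderive (px j) (fun q => contract 'e_(px j) (w q) A) p].

Definition propagator {R : realType} (d d' : nat) : dform R (pdim d d' + 1) := fun p =>
  - wedge (covector 'e_pt)
      (dbar_adj (@heat_form R d d') p + d_adj (@heat_form R d d') p)
  + heat_form p.

(** ** The integrand [W~] and the anomaly integral *)

(* [(R^d' * C^d)^|V|]: row [v] of [vec_mx y] holds the coordinates at vertex [v]. *)
Definition cdim (d d' : nat) (G : digraph) : nat := (nV G * pdim d d')%N.

Definition edge_map {R : realType} (d d' : nat) (G : digraph) (e : 'I_(nE G))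
    (q : 'rV[R]_(cdim d d' G + nE G)) : 'rV[R]_(pdim d d' + 1) :=
  let y : 'M[R]_(nV G, pdim d d') := vec_mx (lsubmx q) in
  row_mx (row (head e) y - row (tail e) y) (rsubmx q 0 e)%:M.

(* d/dz_i at vertex [v], acting on forms on configurations * Schwinger space. *)
Definition dz_vertex {R : realType} (d d' : nat) (G : digraph) (v : 'I_(nV G))
    (i : 'I_d) (w : dform R (cdim d d' G + nE G)) : dform R (cdim d d' G + nE G) :=
  wirtinger (lshift (nE G) (mxvec_index v (ire i)))
            (lshift (nE G) (mxvec_index v (iim i))) w.

Definition edge_form {R : realType} (d d' : nat) (G : digraph)
    (n : decoration d G) (e : 'I_(nE G)) : dform R (cdim d d' G + nE G) :=
  foldr (fun i w => iter (n e i) (@dz_vertex R d d' G (head e) i) w)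
    (pullback (@edge_map R d d' G e) (@propagator R d d')) (enum 'I_d).

Definition Wtilde {R : realType} (d d' : nat) (G : digraph) (n : decoration d G)
    (Phi : dform R (cdim d d' G)) : dform R (cdim d d' G + nE G) :=
  form_wedge (\big[form_wedge/form1]_(e < nE G) @edge_form R d d' G n e)
             (pullback lsubmx Phi).

Definition t_square {R : realType} {n : nat} (t : 'rV[R]_n) : 'rV[R]_n :=
  \row_e (t 0 e) ^+ 2.

Definition schwinger_form {R : realType} (d d' : nat) (G : digraph)
    (n : decoration d G) (Phi : dform R (cdim d d' G)) : dform R (nE G) :=
  pullback t_square (fiber_integral (Wtilde n Phi)).

(* Points (rho, xi) with rho >= 0, xi_e > 0, |xi| = 1: polar coordinates on
   [(0, +oo)^n], with the boundary rho = 0 added. *)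
Definition corner {R : realType} {n : nat} : set 'rV[R]_(1 + n) :=
  [set p : 'rV[R]_(1 + n) |
    [/\ 0 <= p 0 (lshift n ord0), forall e : 'I_n, 0 < p 0 (rshift 1 e)
      & \sum_(e < n) p 0 (rshift 1 e) ^+ 2 = 1]].

(* Inverse of [(rho, xi) |-> rho xi] on [(0, +oo)^n]. *)
Definition polar {R : realType} (n : nat) (s : 'rV[R]_n) : 'rV[R]_(1 + n) :=
  let rho := Num.sqrt (\sum_(e < n) s 0 e ^+ 2) in row_mx rho%:M (rho^-1 *: s).

(* Smooth forms on [corner n] are given as (restrictions of) smooth forms on an
   open neighbourhood in [R^(1 + n)]. *)
Definition smooth_extension {R : realType} (n : nat) (a : dform R n)
    (w : dform R (1 + n)) : Prop :=
  (exists U : set 'rV[R]_(1 + n),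
     [/\ open U, @corner R n `<=` U & smooth_form U w]) /\
  (forall s : 'rV[R]_n, (forall e, 0 < s 0 e) -> pullback (@polar R n) w s = a s).

Definition octant_ball {R : realType} {m : nat} : set 'rV[R]_m :=
  [set u : 'rV[R]_m | (forall i, 0 < u 0 i) /\ \sum_(i < m) u 0 i ^+ 2 < 1].

(* Global chart of the boundary [rho = 0] of [corner m.+1], omitting xi_1; it is
   positively oriented for the orientation of the unit sphere. *)
Definition boundary_chart {R : realType} (m : nat) (u : 'rV[R]_m) :
    'rV[R]_(1 + m.+1) :=
  row_mx (0 : 'rV[R]_1)
    (row_mx ((Num.sqrt (1 - \sum_(i < m) u 0 i ^+ 2))%:M : 'rV[R]_1) u
       : 'rV[R]_m.+1).

(* [corner 0] is empty. *)
Definition boundary_integral {R : realType} (n : nat) : dform R (1 + n) -> R[i] :=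
  match n return dform R (1 + n) -> R[i] with
  | 0 => fun=> 0
  | m.+1 => fun w => cintegral_rV (fun u : 'rV[R]_m =>
      if u \in octant_ball
      then pullback (@boundary_chart R m) w u [set: 'I_m]%SET else 0)
  end.

(* Main.v *)
(* The propagator of an edge is a Gaussian times the product of the one-forms
   [dzbar_i - zbar_i dt / t] and [dx_j - x_j dt / (2 t)], so the integrand is a sum over the
   sets [S] of slots (edge, factor) that contribute their [dt] part.  A term survives only if
   the remaining [dzbar], [dx] are linearly independent; for one factor these are rows of the
   incidence matrix, of rank at most [|V| - 1], so [S] has at least [h_1] slots for each of the
   [d + d'] factors.  Only forms of degree [|E| - 1] reach the boundary, and the Laman equality
   reads [|E| - 1 = (d + d') h_1]: there are exactly [h_1] slots for each factor, and the
   integrand is a Gaussian times [h_1] differences [x_j] for each [j] and some [zbar].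
   Integration by parts turns each [zbar] into [- rho^2] times a derivative of [Phi]; rescaling
   the positions relative to a vertex by [rho] then absorbs exactly the remaining powers of
   [rho], and the limit [rho -> 0] is a Gaussian moment of odd degree [h_1] in [x_1], which
   vanishes. *)

From HB Require Import structures.
From mathcomp Require Import all_boot all_order all_algebra.
From mathcomp Require Import all_classical all_reals all_analysis.
From mathcomp Require Import complex measurable_realfun ring lra zify.
Require Import Defs.
Set Implicit Arguments. Unset Strict Implicit. Unset Printing Implicit Defensive.
Import Order.TTheory GRing.Theory Num.Theory.
Import numFieldNormedType.Exports.
Local Open Scope classical_set_scope.
Local Open Scope ring_scope.

(** * Exterior algebra *)

Section ExteriorAlgebra.
Context {R : realType}.
Local Notation C := R[i].

(** Since [omega] is given only as some smooth extension, nothing is computed on the face rho = 0.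
    Its coefficient there is the limit of its values at (rho_k, xi) with rho_k -> 0 and xi fixed, so
    every scaling estimate is made at t_e = rho_k^2 xi_e^2. Rescaling alone would gain one power of
    rho from a zbar, where the balance needs two; integration by parts supplies both. It is possible
    because the derivatives d/dz of the Gaussian exponent are the weighted graph Laplacian applied
    to zbar, and for positive weights this determines every difference zbar_e. Moreover the fields
    d/dz kill all zbar and all x, so that the derivative meets only the Gaussian and Phi. As the
    integral is an iterated one, changes of variables are proved for triangular maps. Translations,
    reflections of coordinates and dilations about the vertex of index 0 are of this kind. *)

Definition ext_basis {n : nat} (A : {set 'I_n}) : ext R n := [ffun B => (B == A)%:R].

(* The comprehension in [inversions] is elaborated as a classical set; this restates it
   with a finite set. *)
Lemma inversionsE n (A B : {set 'I_n}) : inversions A B =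
  #|[set p : 'I_n * 'I_n | [&& p.1 \in A, p.2 \in B & (p.2 < p.1)%N]]%SET|.
Proof.
by apply: eq_card => p; rewrite [RHS]inE; apply/idP/idP => [/set_mem //|?]; exact/mem_set.
Qed.

Lemma inversionsUl n (A B E : {set 'I_n}) : [disjoint A & B]%B ->
  inversions (A :|: B) E = (inversions A E + inversions B E)%N.
Proof.
move=> dAB; rewrite !inversionsE -cardsUI.
have -> : ([set p : 'I_n * 'I_n | [&& p.1 \in A, p.2 \in E & (p.2 < p.1)%N]]
   :&: [set p : 'I_n * 'I_n | [&& p.1 \in B, p.2 \in E & (p.2 < p.1)%N]])%SET = finset.set0.
  apply/setP => p; rewrite !inE; have := disjointFr dAB (x := p.1).
  by case: (p.1 \in A) => [->|_] //=; rewrite andbF.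
rewrite cards0 addn0; apply: eq_card => p; rewrite !inE.
by case: (p.1 \in A); case: (p.1 \in B) => //=; rewrite ?orbb ?orbF.
Qed.

Lemma inversionsUr n (E A B : {set 'I_n}) : [disjoint A & B]%B ->
  inversions E (A :|: B) = (inversions E A + inversions E B)%N.
Proof.
move=> dAB; rewrite !inversionsE -cardsUI.
have -> : ([set p : 'I_n * 'I_n | [&& p.1 \in E, p.2 \in A & (p.2 < p.1)%N]]
   :&: [set p : 'I_n * 'I_n | [&& p.1 \in E, p.2 \in B & (p.2 < p.1)%N]])%SET = finset.set0.
  apply/setP => p; rewrite !inE; have := disjointFr dAB (x := p.2).
  by case: (p.2 \in A) => [->|_] //=; rewrite ?andbF.
rewrite cards0 addn0; apply: eq_card => p; rewrite !inE.
by case: (p.1 \in E); case: (p.2 \in A); case: (p.2 \in B) => //=; rewrite ?orbb ?orbF.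
Qed.

Lemma inversions0l n (E : {set 'I_n}) : inversions finset.set0 E = 0%N.
Proof. by rewrite inversionsE; apply: eq_card0 => p; rewrite !inE. Qed.

Lemma inversions0r n (E : {set 'I_n}) : inversions E finset.set0 = 0%N.
Proof. by rewrite inversionsE; apply: eq_card0 => p; rewrite !inE andbF. Qed.

Lemma ext_scaleE n c (a : ext R n) A : ext_scale c a A = c * a A.
Proof. by rewrite ffunE. Qed.

Lemma ext_scale1 n (a : ext R n) : ext_scale 1 a = a.
Proof. by apply/ffunP => A; rewrite ext_scaleE mul1r. Qed.

Lemma ext_scale0 n (a : ext R n) : ext_scale 0 a = 0.
Proof. by apply/ffunP => A; rewrite ext_scaleE mul0r ffunE. Qed.

Lemma ext_scalex0 n c : ext_scale c (0 : ext R n) = 0.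
Proof. by apply/ffunP => A; rewrite ext_scaleE ffunE mulr0. Qed.

Lemma ext_scaleA n c d (a : ext R n) : ext_scale c (ext_scale d a) = ext_scale (c * d) a.
Proof. by apply/ffunP => A; rewrite !ext_scaleE mulrA. Qed.

Lemma ext_scaleDr n c (a b : ext R n) : ext_scale c (a + b) = ext_scale c a + ext_scale c b.
Proof. by apply/ffunP => A; rewrite ext_scaleE !ffunE mulrDr. Qed.

Lemma ext_scaleDl n c d (a : ext R n) : ext_scale (c + d) a = ext_scale c a + ext_scale d a.
Proof. by apply/ffunP => A; rewrite ext_scaleE !ffunE mulrDl. Qed.

Lemma ext_scaleN1 n (a : ext R n) : ext_scale (-1) a = - a.
Proof. by apply/ffunP => A; rewrite ext_scaleE !ffunE mulN1r. Qed.

Lemma ext_scale_sum n c (I : Type) (r : seq I) (P : pred I) (F : I -> ext R n) :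
  ext_scale c (\sum_(i <- r | P i) F i) = \sum_(i <- r | P i) ext_scale c (F i).
Proof.
by elim/big_rec2: _ => [|i x y _ <-]; rewrite ?ext_scalex0 // ext_scaleDr.
Qed.

Lemma wedgeE n (a b : ext R n) D : wedge a b D =
  \sum_(A : {set 'I_n} | A \subset D) (-1) ^+ inversions A (D :\: A) * a A * b (D :\: A).
Proof. by rewrite ffunE. Qed.

Lemma wedgeDl n (a b c : ext R n) : wedge (a + b) c = wedge a c + wedge b c.
Proof.
apply/ffunP => D; rewrite [RHS]ffunE !wedgeE -big_split; apply: eq_bigr => A _ /=.
by rewrite ffunE mulrDr mulrDl.
Qed.

Lemma wedgeDr n (a b c : ext R n) : wedge a (b + c) = wedge a b + wedge a c.
Proof.
apply/ffunP => D; rewrite [RHS]ffunE !wedgeE -big_split; apply: eq_bigr => A _ /=.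
by rewrite ffunE mulrDr.
Qed.

Lemma wedge0l n (a : ext R n) : wedge 0 a = 0.
Proof.
by apply/ffunP => D; rewrite wedgeE ffunE big1 // => A _; rewrite ffunE mulr0 mul0r.
Qed.

Lemma wedge0r n (a : ext R n) : wedge a 0 = 0.
Proof. by apply/ffunP => D; rewrite wedgeE ffunE big1 // => A _; rewrite ffunE mulr0. Qed.

Lemma wedgeZl n c (a b : ext R n) : wedge (ext_scale c a) b = ext_scale c (wedge a b).
Proof.
apply/ffunP => D; rewrite ext_scaleE !wedgeE mulr_sumr; apply: eq_bigr => A _.
by rewrite ext_scaleE; ring.
Qed.

Lemma wedgeZr n c (a b : ext R n) : wedge a (ext_scale c b) = ext_scale c (wedge a b).
Proof.
apply/ffunP => D; rewrite ext_scaleE !wedgeE mulr_sumr; apply: eq_bigr => A _.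
by rewrite ext_scaleE; ring.
Qed.

Lemma wedgeNl n (a b : ext R n) : wedge (- a) b = - wedge a b.
Proof. by rewrite -!ext_scaleN1 wedgeZl. Qed.

Lemma wedgeNr n (a b : ext R n) : wedge a (- b) = - wedge a b.
Proof. by rewrite -!ext_scaleN1 wedgeZr. Qed.

Lemma wedge_suml n (I : Type) (r : seq I) (P : pred I) (F : I -> ext R n) b :
  wedge (\sum_(i <- r | P i) F i) b = \sum_(i <- r | P i) wedge (F i) b.
Proof. by elim/big_rec2: _ => [|i x y _ <-]; rewrite ?wedge0l // wedgeDl. Qed.

Lemma wedge_sumr n (I : Type) (r : seq I) (P : pred I) (F : I -> ext R n) b :
  wedge b (\sum_(i <- r | P i) F i) = \sum_(i <- r | P i) wedge b (F i).
Proof. by elim/big_rec2: _ => [|i x y _ <-]; rewrite ?wedge0r // wedgeDr. Qed.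

Lemma wedge1l n (a : ext R n) : wedge ext1 a = a.
Proof.
apply/ffunP => D; rewrite wedgeE (bigD1 finset.set0) ?finset.sub0set //=.
rewrite ffunE eqxx finset.setD0 inversions0l expr0 !mul1r big1 ?addr0 // => A /andP[_ nA].
by rewrite ffunE (negPf nA) mulr0 mul0r.
Qed.

Lemma wedge1r n (a : ext R n) : wedge a ext1 = a.
Proof.
apply/ffunP => D; rewrite wedgeE (bigD1 D) //= finset.setDv.
rewrite ffunE eqxx inversions0r expr0 mul1r mulr1 big1 ?addr0 // => A /andP[AD nA].
rewrite ffunE; case: eqP => [/eqP|_]; last by rewrite mulr0.
rewrite finset.setD_eq0 => DA; case/negP: nA; by rewrite finset.eqEsubset AD.
Qed.

Lemma setU_D_sub (T : finType) (A E : {set T}) : A \subset E -> A :|: (E :\: A) = E.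
Proof. by move=> AE; rewrite -[RHS](finset.setID E A) (finset.setIidPr AE). Qed.

(** Both bracketings become the sum over ordered splittings of [D] into three blocks, with a sign
    that counts the inversions between each of the three pairs of blocks. *)
Lemma wedgeA n : associative (@wedge R n).
Proof.
move=> a b c; apply/ffunP => D; rewrite !wedgeE.
transitivity (\sum_(A : {set 'I_n} | A \subset D) \sum_(B : {set 'I_n} | B \subset D :\: A)
   (-1) ^+ (inversions A B + inversions A (D :\: A :\: B) + inversions B (D :\: A :\: B))
     * a A * b B * c (D :\: A :\: B)).
  apply: eq_bigr => A AD; rewrite wedgeE mulr_sumr; apply: eq_bigr => B BD.
  have {1}-> : D :\: A = B :|: (D :\: A :\: B) by rewrite setU_D_sub.
  rewrite inversionsUr; last first.
    by rewrite -finset.setI_eq0 finset.setIDA finset.setIC -finset.setIDA finset.setDv finset.setI0.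
  by rewrite !exprD; ring.
transitivity (\sum_(E : {set 'I_n} | E \subset D) \sum_(A : {set 'I_n} | A \subset E)
   (-1) ^+ (inversions A (E :\: A) + inversions A (D :\: E) + inversions (E :\: A) (D :\: E))
     * a A * b (E :\: A) * c (D :\: E)); last first.
  apply: eq_bigr => E ED; rewrite wedgeE mulr_sumr mulr_suml; apply: eq_bigr => A AE.
  have -> : inversions E (D :\: E) = (inversions A (D :\: E) + inversions (E :\: A) (D :\: E))%N.
    rewrite -inversionsUl; last first.
      by rewrite -finset.setI_eq0 finset.setIDA finset.setIC -finset.setIDA finset.setDv finset.setI0.
    by rewrite setU_D_sub.
  by rewrite !exprD; ring.
rewrite [RHS](exchange_big_dep (fun A : {set 'I_n} => A \subset D)) /=; last first.
  by move=> E A ED AE; apply: fintype.subset_trans ED.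
apply: eq_bigr => A AD; rewrite [RHS](reindex_onto (fun B => A :|: B) (fun E => E :\: A)) /=; last first.
  by move=> E /andP[_ AE]; rewrite setU_D_sub.
apply: eq_big => [B|B BD].
  rewrite finset.subUset AD finset.subsetUl /= andbT finset.setDUl finset.setDv finset.set0U.
  by rewrite finset.subsetD; congr andb; exact/finset.setDidPl/eqP.
rewrite finset.subsetD in BD; case/andP: BD => BD dB.
have -> : (A :|: B) :\: A = B.
  by rewrite finset.setDUl finset.setDv finset.set0U; apply/finset.setDidPl.
by rewrite finset.setDDl.
Qed.

(** Products of forms are big operators over this monoid. It is not commutative, so the order of the
    index sequence matters throughout. *)
HB.instance Definition _ n :=
  Monoid.isLaw.Build (ext R n) ext1 (@wedge R n) (@wedgeA n) (@wedge1l n) (@wedge1r n).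
HB.instance Definition _ n := Monoid.isMulLaw.Build (ext R n) 0 (@wedge R n) (@wedge0l n) (@wedge0r n).
(* A copy of the addition, which already carries another additive-law structure. *)
Definition ext_add {n : nat} (a b : ext R n) : ext R n := a + b.

HB.instance Definition _ n := Monoid.isComLaw.Build (ext R n) 0 (@ext_add n)
  (@addrA (ext R n)) (@addrC (ext R n)) (@add0r (ext R n)).
HB.instance Definition _ n := Monoid.isAddLaw.Build (ext R n) (@wedge R n) (@ext_add n)
  (fun b c a => @wedgeDl n b c a) (@wedgeDr n).

(** Distributivity with the factors kept in place. It later expands the product of propagators over
    the sets of slots that contribute [dt]. *)
Lemma wedge_distr n (I : finType) (u v : I -> ext R n) :
  \big[wedge/ext1]_i (u i + v i) = \sum_(S : {set I}) \big[wedge/ext1]_i (if i \in S then u i else v i).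
Proof. exact: (@bigA_distr _ _ ext1 (@wedge R n) (@ext_add n)). Qed.

Lemma ext_sum_basis n (a : ext R n) : a = \sum_A ext_scale (a A) (ext_basis A).
Proof.
apply/ffunP => B; rewrite sum_ffunE (bigD1 B) //= !ffunE eqxx mulr1 big1 ?addr0 // => A nA.
by rewrite !ffunE eq_sym (negPf nA) mulr0.
Qed.

Lemma wedge_basis n (A B : {set 'I_n}) : wedge (ext_basis A) (ext_basis B) =
  if [disjoint A & B]%B then ext_scale ((-1) ^+ inversions A B) (ext_basis (A :|: B)) else 0.
Proof.
apply/ffunP => D; rewrite wedgeE.
case: (boolP (A \subset D)) => AD; last first.
  rewrite big1 => [|E ED]; last first.
    rewrite [ext_basis A _]ffunE; case: eqP => [E_A|_]; last by rewrite mulr0 mul0r.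
    by rewrite E_A (negPf AD) in ED.
  case: ifP => _; rewrite !ffunE //=.
  by case: eqP => [DE|_]; rewrite ?mulr0 //; case/negP: AD; rewrite DE finset.subsetUl.
rewrite (bigD1 A) //= big1 ?addr0 => [|E /andP[_ nE]]; last first.
  by rewrite [ext_basis A _]ffunE (negPf nE) mulr0 mul0r.
rewrite !ffunE eqxx mulr1; case: eqP => [DA|DA].
  have dAB : [disjoint A & B]%B.
    by rewrite -DA -finset.setI_eq0 finset.setIDA finset.setIC -finset.setIDA finset.setDv finset.setI0.
  rewrite dAB !ffunE -DA mulr1.
  by rewrite setU_D_sub // eqxx mulr1.
rewrite mulr0; case: ifP => dAB; rewrite !ffunE //=; case: eqP => [DE|_]; rewrite ?mulr0 //.
case: DA; rewrite DE finset.setDUl finset.setDv finset.set0U; apply/finset.setDidPl.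
by rewrite disjoint_sym.
Qed.

Lemma covectorD n (u v : 'rV[C]_n) : covector (u + v) = covector u + covector v.
Proof.
by apply/ffunP => A; rewrite [RHS]ffunE !ffunE -big_split; apply: eq_bigr => i _; rewrite mxE.
Qed.

Lemma covectorZ n c (u : 'rV[C]_n) : covector (c *: u) = ext_scale c (covector u).
Proof.
by apply/ffunP => A; rewrite [RHS]ffunE !ffunE mulr_sumr; apply: eq_bigr => i _; rewrite mxE.
Qed.

Lemma covector0 n : covector (0 : 'rV[C]_n) = 0.
Proof. by rewrite -(scale0r (0 : 'rV[C]_n)) covectorZ ext_scale0. Qed.

Lemma covectorN n (u : 'rV[C]_n) : covector (- u) = - covector u.
Proof. by rewrite -scaleN1r covectorZ ext_scaleN1. Qed.

Lemma covectorB n (u v : 'rV[C]_n) : covector (u - v) = covector u - covector v.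
Proof. by rewrite covectorD covectorN. Qed.

Lemma covector_basis n (i : 'I_n) : covector ('e_i : 'rV[C]_n) = ext_basis [set i]%SET.
Proof.
apply/ffunP => A; rewrite !ffunE; case: (eqVneq A [set i]%SET) => [->|nA].
  rewrite (big_pred1 i) ?mxE ?eqxx // => j /=.
  by rewrite eq_sym; apply/eqP/eqP => [/finset.set1_inj|->].
rewrite big1 // => j /eqP Aj; rewrite mxE eqxx /=; case: eqP => // ji.
by rewrite Aj ji eqxx in nA.
Qed.

Lemma covector_sum n (u : 'rV[C]_n) : covector u = \sum_i ext_scale (u 0 i) (ext_basis [set i]%SET).
Proof.
rewrite {1}(row_sum_delta u).
elim/big_rec2: _ => [|i x y _ <-]; first exact: covector0.
by rewrite covectorD covectorZ covector_basis.
Qed.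

Lemma inversions1 n (i : 'I_n) (B : {set 'I_n}) :
  inversions [set i]%SET B = #|[set j in B | (j < i)%N]%SET|.
Proof.
rewrite inversionsE -(card_imset _ (can_inj (fun j : 'I_n => erefl : (i, j).2 = j))).
apply: eq_card => p; rewrite !inE; apply/idP/imsetP => [/and3P[/eqP <- pB lt]|[j]].
  by exists p.2; rewrite ?inE ?pB //=; case: p {pB lt}.
by rewrite inE => /andP[jB lt ->] /=; rewrite eqxx jB.
Qed.

Lemma covector_anticomm n (u v : 'rV[C]_n) :
  wedge (covector u) (covector v) = - wedge (covector v) (covector u).
Proof.
rewrite !covector_sum !wedge_suml -sumrN.
under eq_bigr do rewrite wedge_sumr; under [RHS]eq_bigr do rewrite wedge_sumr -sumrN.
rewrite exchange_big /=; apply: eq_bigr => i _; apply: eq_bigr => j _.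
rewrite !wedgeZl !wedgeZr !ext_scaleA !wedge_basis disjoint_sym.
case: ifP => dij; last by rewrite !ext_scalex0 oppr0.
rewrite finset.setUC -ext_scaleN1 !ext_scaleA; congr (ext_scale _ _).
have nij : i != j.
  by move: dij; rewrite finset.disjoints1 inE.
rewrite !inversions1.
have E (k l : 'I_n) : #|[set x : 'I_n in [set k]%SET | (x < l)%N]%SET| = (k < l)%N.
  case: ltnP => kl.
    rewrite -[RHS](cards1 k); apply: eq_card => x; rewrite !inE.
    by case: eqP => [->|]; rewrite ?kl.
  by apply: eq_card0 => x; rewrite !inE; case: eqP => // ->; rewrite ltnNge kl.
rewrite !E; move: nij; rewrite -val_eqE /=; case: ltngtP => //= _ _; by rewrite ?expr0 ?expr1; ring.
Qed.

Lemma covector_sqr n (u : 'rV[C]_n) : wedge (covector u) (covector u) = 0.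
Proof.
have := covector_anticomm u u => /eqP; rewrite -subr_eq0 opprK => /eqP E.
apply/ffunP => A; move/ffunP: E => /(_ A); rewrite !ffunE => /eqP.
by rewrite -mulr2n mulrn_eq0 /= => /eqP.
Qed.

Lemma covector_move n (I : Type) (u : 'rV[C]_n) (s : seq I) (v : I -> 'rV[C]_n) (b : ext R n) :
  wedge (covector u) (wedge (\big[wedge/ext1]_(i <- s) covector (v i)) b) =
  ext_scale ((-1) ^+ size s)
    (wedge (\big[wedge/ext1]_(i <- s) covector (v i)) (wedge (covector u) b)).
Proof.
elim: s => [|i s IH]; first by rewrite !big_nil !wedge1l expr0 ext_scale1.
rewrite !big_cons -!wedgeA (wedgeA (covector u)) covector_anticomm wedgeNl -wedgeA IH /=.
by rewrite wedgeZr -ext_scaleN1 ext_scaleA exprS.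
Qed.

Lemma covector_repeat n (I : eqType) (v : I -> 'rV[C]_n) (s : seq I) (i : I) : i \in s ->
  wedge (covector (v i)) (\big[wedge/ext1]_(j <- s) covector (v j)) = 0.
Proof.
move=> /splitPr[s1 s2]; rewrite big_cat big_cons covector_move.
by rewrite (wedgeA (covector (v i))) covector_sqr wedge0l wedge0r ext_scalex0.
Qed.

(** The algebra morphism induced by a linear map on covectors, where [row j M] is the image of the
    j-th basis covector. It has the shape of [pullback] at one point, with [M] the transposed
    Jacobian. *)
Definition ext_map {m n : nat} (M : 'M[C]_(m, n)) (a : ext R m) : ext R n :=
  \sum_A ext_scale (a A) (\big[wedge/ext1]_(j <- enum A) covector (row j M)).

Lemma ext_mapD m n (M : 'M[C]_(m, n)) a b : ext_map M (a + b) = ext_map M a + ext_map M b.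
Proof. by rewrite -big_split; apply: eq_bigr => A _; rewrite ffunE ext_scaleDl. Qed.

Lemma ext_mapZ m n (M : 'M[C]_(m, n)) c a : ext_map M (ext_scale c a) = ext_scale c (ext_map M a).
Proof. by rewrite ext_scale_sum; apply: eq_bigr => A _; rewrite ext_scaleA ffunE. Qed.

Lemma ext_map0 m n (M : 'M[C]_(m, n)) : ext_map M 0 = 0.
Proof. by rewrite /ext_map big1 // => A _; rewrite ffunE ext_scale0. Qed.

Lemma ext_map_sum m n (M : 'M[C]_(m, n)) (I : Type) (r : seq I) (P : pred I) F :
  ext_map M (\sum_(i <- r | P i) F i) = \sum_(i <- r | P i) ext_map M (F i).
Proof. by elim/big_rec2: _ => [|i x y _ <-]; rewrite ?ext_map0 // ext_mapD. Qed.

Lemma ext_map_basis m n (M : 'M[C]_(m, n)) A :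
  ext_map M (ext_basis A) = \big[wedge/ext1]_(j <- enum A) covector (row j M).
Proof.
rewrite /ext_map (bigD1 A) //= ffunE eqxx ext_scale1 [X in _ + X]big1 ?addr0 // => B nB.
by rewrite ffunE (negPf nB) ext_scale0.
Qed.

Lemma sorted_enum_set n (A : {set 'I_n}) : sorted (relpre val ltn) (enum A).
Proof.
rewrite {1}/enum_mem; apply: sorted_filter; first by move=> x y z /=; apply: ltn_trans.
by rewrite -enumT -sorted_map val_enum_ord iota_ltn_sorted.
Qed.

Lemma mem_enum_set n (A : {set 'I_n}) (i : 'I_n) : (i \in enum A) = (i \in A).
Proof. exact: fintype.mem_enum. Qed.

(** The part of the list before [i] has length [inversions [set i] B], which is the sign met when a
    covector is moved to its place. Two strictly increasing lists with the same members are
    equal. *)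
Lemma enum_setU1 n (i : 'I_n) (B : {set 'I_n}) : i \notin B ->
  enum (i |: B)%SET = [seq j : 'I_n <- enum B | (j < i)%N] ++ i :: [seq j : 'I_n <- enum B | (i < j)%N].
Proof.
move=> niB; apply: (@irr_sorted_eq 'I_n (relpre val ltn)).
- by move=> x y z /=; apply: ltn_trans.
- by move=> x /=; rewrite ltnn.
- exact: sorted_enum_set.
- have tr : transitive (relpre (val : 'I_n -> nat) ltn) by move=> x y z /=; apply: ltn_trans.
  rewrite (sorted_pairwise tr) pairwise_cat /= -!(sorted_pairwise tr).
  apply/and4P; split; try by apply: (sorted_filter tr); exact: sorted_enum_set.
    apply/allrelP => x y; rewrite mem_filter => /andP[xi _].
    by rewrite inE mem_filter => /orP[/eqP ->//|/andP[iy _]] /=; apply: ltn_trans iy.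
  by apply/allP => x; rewrite mem_filter => /andP[].
- suff H (x : 'I_n) : (x \in enum (i |: B)%SET) = (x \in [seq j : 'I_n <- enum B | (j < i)%N]
      ++ i :: [seq j : 'I_n <- enum B | (i < j)%N]) by exact: H.
  rewrite mem_enum_set !inE; move: (enum B) (mem_enum_set B x) => s Es.
  rewrite mem_cat inE !mem_filter Es.
  case: (eqVneq x i) => [->|nxi]; first by rewrite orbT.
  by move: nxi; rewrite -val_eqE /=; case: ltngtP; rewrite ?orbF.
Qed.

Lemma filter_enum_split n (i : 'I_n) (B : {set 'I_n}) : i \notin B ->
  enum B = [seq j : 'I_n <- enum B | (j < i)%N] ++ [seq j : 'I_n <- enum B | (i < j)%N].
Proof.
move=> niB; apply: (@irr_sorted_eq 'I_n (relpre val ltn)).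
- by move=> x y z /=; apply: ltn_trans.
- by move=> x /=; rewrite ltnn.
- exact: sorted_enum_set.
- have tr : transitive (relpre (val : 'I_n -> nat) ltn) by move=> x y z /=; apply: ltn_trans.
  rewrite (sorted_pairwise tr) pairwise_cat /= -!(sorted_pairwise tr).
  apply/and3P; split; try by apply: (sorted_filter tr); exact: sorted_enum_set.
  apply/allrelP => x y; rewrite mem_filter => /andP[xi _].
  by rewrite mem_filter => /andP[iy _] /=; apply: ltn_trans iy.
- suff H (x : 'I_n) : (x \in enum B) = (x \in [seq j : 'I_n <- enum B | (j < i)%N]
      ++ [seq j : 'I_n <- enum B | (i < j)%N]) by exact: H.
  rewrite mem_enum_set; move: (enum B) (mem_enum_set B x) => s Es.
  rewrite mem_cat !mem_filter Es.
  case: (eqVneq x i) => [->|nxi]; first by rewrite (negPf niB) !andbF.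
  by move: nxi; rewrite -val_eqE /=; case: ltngtP; rewrite ?orbF.
Qed.

(** By linearity [v] and [b] are basis elements [i] and [B]. If [i] lies in [B], a row is repeated
    and both sides vanish. Otherwise moving row [i] past the smaller rows costs the sign with which
    the basis product inserts [i]. *)
Lemma ext_map_wedge1 m n (M : 'M[C]_(m, n)) (v : 'rV[C]_m) (b : ext R m) :
  ext_map M (wedge (covector v) b) = wedge (covector (v *m M)) (ext_map M b).
Proof.
rewrite (ext_sum_basis b) wedge_sumr !ext_map_sum wedge_sumr; apply: eq_bigr => B _.
rewrite wedgeZr !ext_mapZ wedgeZr; congr (ext_scale _ _) => {b}.
rewrite covector_sum wedge_suml ext_map_sum.
have -> : v *m M = \sum_i v 0 i *: row i M.
  by rewrite {1}(row_sum_delta v) mulmx_suml; apply: eq_bigr => i _; rewrite -scalemxAl rowE.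
have -> : covector (\sum_i v 0 i *: row i M) = \sum_i ext_scale (v 0 i) (covector (row i M)).
  by elim/big_rec2: _ => [|i x y _ <-]; rewrite ?covector0 // covectorD covectorZ.
rewrite wedge_suml; apply: eq_bigr => i _; rewrite !wedgeZl ext_mapZ; congr (ext_scale _ _).
rewrite wedge_basis finset.disjoints1 ext_map_basis; case: (boolP (i \in B)) => iB /=.
  by rewrite ext_map0 (covector_repeat (fun i => row i M)) // mem_enum_set.
rewrite ext_mapZ ext_map_basis enum_setU1 // [in RHS](filter_enum_split iB) !big_cat big_cons.
rewrite covector_move inversions1; congr (ext_scale (_ ^+ _) _).
rewrite -[RHS](card_uniqP (filter_uniq _ (enum_uniq _))); apply: eq_card => j.
by move: (enum B) (mem_enum_set B j) => s Es; rewrite !inE mem_filter Es andbC.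
Qed.

Lemma ext_map1 m n (M : 'M[C]_(m, n)) : ext_map M ext1 = ext1.
Proof.
have -> : (ext1 : ext R m) = ext_basis finset.set0 by [].
by rewrite ext_map_basis enum_set0 big_nil.
Qed.

Lemma ext_map_wedges m n (M : 'M[C]_(m, n)) (I : Type) (s : seq I) (v : I -> 'rV[C]_m) b :
  ext_map M (wedge (\big[wedge/ext1]_(i <- s) covector (v i)) b) =
  wedge (\big[wedge/ext1]_(i <- s) covector (v i *m M)) (ext_map M b).
Proof.
elim: s => [|i s IH]; first by rewrite !big_nil !wedge1l.
by rewrite !big_cons -!wedgeA ext_map_wedge1 IH.
Qed.

Lemma ext_map_covectors m n (M : 'M[C]_(m, n)) (I : Type) (s : seq I) (v : I -> 'rV[C]_m) :
  ext_map M (\big[wedge/ext1]_(i <- s) covector (v i)) =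
  \big[wedge/ext1]_(i <- s) covector (v i *m M).
Proof. by have := ext_map_wedges M s v ext1; rewrite ext_map1 !wedge1r. Qed.

Lemma ext_map_comp m n p (M : 'M[C]_(m, n)) (N : 'M[C]_(n, p)) a :
  ext_map N (ext_map M a) = ext_map (M *m N) a.
Proof.
rewrite [ext_map M a]/ext_map ext_map_sum; apply: eq_bigr => A _.
by rewrite ext_mapZ ext_map_covectors; under eq_bigr do rewrite -row_mul.
Qed.

Lemma wedge_sorted_basis n (s : seq 'I_n) : sorted (relpre val ltn) s ->
  \big[wedge/ext1]_(i <- s) (ext_basis [set i]%SET : ext R n) = ext_basis [set i in s]%SET.
Proof.
elim: s => [_|i s IH] /=; first by rewrite big_nil finset.set_nil.
move=> ps; rewrite big_cons IH; last exact: path_sorted ps.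
have /allP lt_s : all (fun j : 'I_n => (i < j)%N) s.
  by apply: (order_path_min (leT := relpre val ltn)) ps => x y z /=; apply: ltn_trans.
rewrite wedge_basis finset.disjoints1 inE.
have nis : i \notin s by apply/negP => /lt_s; rewrite ltnn.
rewrite nis inversions1 eq_card0 ?expr0 ?ext_scale1; first by rewrite finset.set_cons.
move=> j; rewrite !inE; apply/negP => /andP[/lt_s lt_ij]; by rewrite ltnNge ltnW.
Qed.

(** Basis monomials are eigenvectors. This serves for the pullbacks along [t_square] and along
    radial scalings, and to count how many [dt] a product contains. *)
Lemma ext_map_diag n (l : 'rV[C]_n) (a : ext R n) A :
  ext_map (diag_mx l) a A = (\prod_(j in A) l 0 j) * a A.
Proof.
have E B : ext_map (diag_mx l) (ext_basis B) = ext_scale (\prod_(j in B) l 0 j) (ext_basis B).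
  rewrite ext_map_basis; have -> : ext_basis B = ext_basis [set i in enum B]%SET :> ext R n.
    by congr ext_basis; apply/setP => i; rewrite inE mem_enum_set.
  rewrite -(wedge_sorted_basis (sorted_enum_set B)) -big_enum /=.
  elim: (enum B) => [|i s IH]; first by rewrite !big_nil ext_scale1.
  rewrite !big_cons IH wedgeZr; have -> : row i (diag_mx l) = l 0 i *: 'e_i.
    by rewrite row_diag_mx.
  by rewrite covectorZ covector_basis wedgeZl ext_scaleA mulrC.
rewrite {1}(ext_sum_basis a) ext_map_sum sum_ffunE (bigD1 A) //= ext_mapZ E !ffunE eqxx mulr1.
rewrite [X in _ + X]big1 ?addr0 ?(mulrC (a A)) // => B nB; rewrite ext_mapZ E !ffunE eq_sym (negPf nB).
by rewrite !mulr0.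
Qed.

Lemma covectors_degree n (I : Type) (s : seq I) (v : I -> 'rV[C]_n) (A : {set 'I_n}) :
  #|A| != size s -> (\big[wedge/ext1]_(i <- s) covector (v i)) A = 0.
Proof.
elim: s A => [|i s IH] A.
  by rewrite big_nil ffunE cards_eq0 => /negPf ->.
move=> nA; rewrite big_cons wedgeE big1 // => B BA.
have [B1|nB] := eqVneq #|B| 1%N; last first.
  rewrite [covector _ _]ffunE big1 ?mulr0 ?mul0r // => j /eqP Bj.
  by rewrite Bj cards1 in nB.
rewrite IH ?mulr0 //; apply: contraNneq nA => AB.
by rewrite -(finset.cardsID B) (finset.setIidPr BA) B1 AB.
Qed.

(** Through a rank factorization, the product is the image of a product of [K] covectors on a space
    of dimension less than [K], and that product vanishes for degree reasons. *)
Lemma wedge_rows_rank n K (A : 'M[C]_(K, n)) : (\rank A < K)%N ->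
  \big[wedge/ext1]_(i < K) covector (row i A) = 0.
Proof.
move=> rK; rewrite -(mulmx_base A).
under eq_bigr do rewrite row_mul.
rewrite -ext_map_covectors; set w := (X in ext_map _ X).
suff -> : w = 0 by rewrite ext_map0.
apply/ffunP => B; rewrite [RHS]ffunE; apply: covectors_degree.
rewrite -[index_enum _](enumT) size_enum_ord neq_ltn (leq_ltn_trans _ rK) //.
by have := max_card B; rewrite card_ord.
Qed.

End ExteriorAlgebra.

(** * Iterated integrals *)

Section MatrixContinuity.
Context {R : realType}.

Lemma cvg_mx (T : Type) (F : set_system T) (FF : Filter F) m n (f : T -> 'M[R]_(m, n)) (M : 'M[R]_(m, n)) :
  (forall i j, (fun x => f x i j) @ F --> M i j) -> f @ F --> M.
Proof.
move=> h A [B MB BA].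
have : \forall x \near F, forall i j, B i j (f x i j).
  apply: filter_forall => i; apply: filter_forall => j; exact: h (MB i j).
by apply: filterS => x /BA.
Qed.

Lemma cvg_coord (T : Type) (F : set_system T) (FF : Filter F) m n (f : T -> 'M[R]_(m, n)) (M : 'M[R]_(m, n)) i j :
  f @ F --> M -> (fun x => f x i j) @ F --> M i j.
Proof. by move=> h; apply: (@cvg_comp _ _ _ f (fun N : 'M[R]_(m, n) => N i j) _ _ _ h); exact: coord_continuous. Qed.

Lemma continuous_mx (T : topologicalType) m n (f : T -> 'M[R]_(m, n)) :
  (forall i j, continuous (fun x => f x i j)) -> continuous f.
Proof. by move=> h x; apply: cvg_mx => i j; exact: h. Qed.

Lemma continuous_row_mx (T : topologicalType) m n1 n2 (f : T -> 'M[R]_(m, n1)) (g : T -> 'M[R]_(m, n2)) :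
  continuous f -> continuous g -> continuous (fun x => row_mx (f x) (g x)).
Proof.
move=> cf cg; apply: continuous_mx => i j x; rewrite /continuous_at mxE.
under eq_fun do rewrite mxE.
by case: (fintype.split j) => k; apply: cvg_coord; [exact: cf|exact: cg].
Qed.

Lemma cvg_scalar_mx (T : Type) (F : set_system T) (FF : Filter F) (f : T -> R) (a : R) n :
  f @ F --> a -> (fun x => (f x)%:M : 'M[R]_n) @ F --> (a%:M : 'M[R]_n).
Proof.
move=> h; apply: cvg_mx => i j; rewrite mxE; under eq_fun do rewrite mxE.
by case: (i == j); [exact: h|exact: cvg_cst].
Qed.

Lemma cvg_row_mx (T : Type) (F : set_system T) (FF : Filter F) m n1 n2
  (f : T -> 'M[R]_(m, n1)) (g : T -> 'M[R]_(m, n2)) (a : 'M[R]_(m, n1)) (b : 'M[R]_(m, n2)) :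
  f @ F --> a -> g @ F --> b -> (fun x => row_mx (f x) (g x)) @ F --> row_mx a b.
Proof.
move=> cf cg; apply: cvg_mx => i j; rewrite mxE; under eq_fun do rewrite mxE.
by case: (fintype.split j) => k; apply: cvg_coord; [exact: cf|exact: cg].
Qed.

End MatrixContinuity.

(** * Dominated convergence, linearity and triangular substitutions for iterated integrals *)

Section IteratedIntegral.
Context {R : realType}.
Local Notation mu := (@lebesgue_measure R).

Let b (s : R) : R := (1 + s ^+ 2)^-1.

Let b_gt0 s : 0 < b s.
Proof. by rewrite invr_gt0 ltr_pwDl // sqr_ge0. Qed.

Let b_le1 s : b s <= 1.
Proof. by rewrite invf_le1 ?lerDl ?sqr_ge0 // ltr_pwDl // sqr_ge0. Qed.

Let cb : continuous b.
Proof. by move=> s; exact: continuous_oneDsqrV. Qed.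

Let integrable_b : mu.-integrable setT (EFin \o b).
Proof.
apply/integrableP; split.
  by apply/measurable_EFinP; apply: continuous_measurable_fun; exact: cb.
under eq_integral => x _ do rewrite /= ger0_norm ?ltW //.
rewrite ge0_symfun_integralT.
- rewrite -set_itvcy integral0y_oneDsqr -EFinM; exact: ltry.
- by move=> x; rewrite ltW.
- exact: cb.
- by move=> x; rewrite /= /b sqrrN.
Qed.

(** An integrable majorant that factors over the coordinates, so that a bound by it passes to slices
    and then to the inner integrals. *)
Definition decay {n : nat} (v : 'rV[R]_n) : R := \prod_(i < n) (1 + v 0 i ^+ 2)^-1.

Lemma decay_gt0 n (v : 'rV[R]_n) : 0 < decay v.
Proof. by apply: prodr_gt0 => i _; exact: b_gt0. Qed.

Lemma decay_row_mx n (s : R) (v : 'rV[R]_n) : decay (row_mx (s%:M : 'rV[R]_1) v) = (1 + s ^+ 2)^-1 * decay v.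
Proof.
rewrite /decay big_split_ord /= big_ord1 row_mxEl mxE eqxx mulr1n.
by congr (_ * _); apply: eq_bigr => i _; rewrite row_mxEr.
Qed.

Let integral1_dct (F : nat -> R -> R) (f : R -> R) (C : R) :
  (forall k, continuous (F k)) -> (forall k s, `|F k s| <= C * b s) ->
  (forall s, (fun k => F k s) @ \oo --> f s) ->
  (fun k => Rintegral mu setT (F k)) @ \oo --> Rintegral mu setT f.
Proof.
move=> cF bF Ff.
have C0 : 0 <= C.
  by have := le_trans (normr_ge0 _) (bF 0%N 0); rewrite pmulr_lge0.
have ib : mu.-integrable setT (EFin \o (fun s => C * b s)).
  have -> : EFin \o (fun s => C * b s) = (fun s => C%:E * (EFin \o b) s)%E.
    by apply/funext => s; rewrite /= EFinM.
  exact: integrableZl.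
have mF k : measurable_fun setT (EFin \o F k).
  by apply/measurable_EFinP; apply: continuous_measurable_fun.
have [] := @dominated_convergence _ _ R mu setT measurableT (fun k => EFin \o F k) (EFin \o f)
  (EFin \o (fun s => C * b s)) mF.
- apply/measurable_EFinP; apply: (measurable_fun_cvg (h := F)) => [k|s _]; last exact: Ff.
  exact: continuous_measurable_fun.
- by apply: aeW => s _; apply: cvg_EFin; [exact: nearW|exact: Ff].
- exact: ib.
- by apply: aeW => s k _ /=; rewrite lee_fin.
move=> If _ cv; rewrite /Rintegral.
have fin : (\int[mu]_x (f x)%:E)%E \is a fin_num by exact: integrable_fin_num If.
apply: fine_cvg; rewrite fineK //; exact: cv.
Qed.

Let integral1_bound (f : R -> R) (C : R) : continuous f -> (forall s, `|f s| <= C * b s) ->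
  mu.-integrable setT (EFin \o f) /\ `|Rintegral mu setT f| <= C * Rintegral mu setT b.
Proof.
move=> cf bf.
have C0 : 0 <= C.
  by have := le_trans (normr_ge0 _) (bf 0); rewrite pmulr_lge0.
have ib : mu.-integrable setT (EFin \o (fun s => C * b s)).
  have -> : EFin \o (fun s => C * b s) = (fun s => C%:E * (EFin \o b) s)%E.
    by apply/funext => s; rewrite /= EFinM.
  exact: integrableZl.
have intf : mu.-integrable setT (EFin \o f).
  apply: (le_integrable measurableT _ _ ib).
    by apply/measurable_EFinP; apply: continuous_measurable_fun.
  by move=> s _ /=; rewrite lee_fin (le_trans (bf s)) // ler_norm.
split=> //; rewrite -RintegralZl //.
apply: le_trans (le_normr_Rintegral _ intf) _ => //.
apply: le_Rintegral => //.
exact: integrable_norm.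
Qed.

Let continuous_slice n (f : 'rV[R]_(1 + n) -> R) (s : R) : continuous f ->
  continuous (fun v : 'rV[R]_n => f (row_mx (s%:M : 'rV[R]_1) v)).
Proof.
move=> cf v; apply: continuous_comp; last exact: cf.
by apply: continuous_row_mx; [exact: cst_continuous|move=> ?; exact: cvg_id].
Qed.

Let slice_bound n (f : 'rV[R]_(1 + n) -> R) C (s : R) : (forall v, `|f v| <= C * decay v) ->
  forall v, `|f (row_mx (s%:M : 'rV[R]_1) v)| <= C * b s * decay v.
Proof. by move=> bf v; rewrite -mulrA -decay_row_mx. Qed.

(** The two claims need each other in the induction: continuity of the inner integral in the outer
    variable is dominated convergence one dimension lower, and the majorant for the outer integral
    is the bound one dimension lower. *)
Lemma integral_rV_dct_bound n :
  (forall (F : nat -> 'rV[R]_n -> R) (f : 'rV[R]_n -> R) (C : R),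
    (forall k, continuous (F k)) -> (forall k v, `|F k v| <= C * decay v) ->
    (forall v, (fun k => F k v) @ \oo --> f v) -> continuous f ->
    (fun k => integral_rV (F k)) @ \oo --> integral_rV f) /\
  (forall (f : 'rV[R]_n -> R) (C : R), continuous f -> (forall v, `|f v| <= C * decay v) ->
    `|integral_rV f| <= C * (Rintegral mu setT b) ^+ n).
Proof.
elim: n => [|n [dct bnd]].
  split=> [F f C _ _ Ff _|f C _ bf] /=; first exact: Ff.
  by have := bf 0; rewrite /decay big_ord0 expr0.
have inner_cont (f : 'rV[R]_(1 + n) -> R) C : continuous f -> (forall v, `|f v| <= C * decay v) ->
    continuous (fun s : R => integral_rV (fun v : 'rV[R]_n => f (row_mx (s%:M : 'rV[R]_1) v))).
  (* Continuity on the line may be tested on sequences, which is the form of the induction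
     hypothesis. *)
  move=> cf bf s; apply/(@cvg_nbhsP _ R^o) => u us.
  have C0 : 0 <= C by have := le_trans (normr_ge0 _) (bf 0); rewrite pmulr_lge0 // decay_gt0.
  apply: (dct _ _ C) => [k|k v|v|].
  - exact: continuous_slice.
  - apply: le_trans (slice_bound _ bf _) _.
    by rewrite ler_wpM2r ?(ltW (decay_gt0 _)) // ler_piMr.
  - apply: (@cvg_comp _ _ _ (fun k => row_mx ((u k)%:M : 'rV[R]_1) v) f _ _ _ _ (cf _)).
    by apply: cvg_row_mx; [exact: cvg_scalar_mx us|exact: cvg_cst].
  - exact: continuous_slice.
have inner_bnd (f : 'rV[R]_(1 + n) -> R) C s : continuous f -> (forall v, `|f v| <= C * decay v) ->
    `|integral_rV (fun v : 'rV[R]_n => f (row_mx (s%:M : 'rV[R]_1) v))|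
      <= C * (Rintegral mu setT b) ^+ n * b s.
  move=> cf bf; rewrite mulrAC; apply: bnd; first exact: continuous_slice.
  exact: slice_bound.
split=> [F f C cF bF Ff cf|f C cf bf].
  have bf v : `|f v| <= C * decay v.
    have h : (fun k => `|F k v|) @ \oo --> `|f v| by apply: cvg_norm; exact: Ff.
    by apply: (cvgr_to_le h); apply: nearW => k; exact: bF.
  have C0 : 0 <= C by have := le_trans (normr_ge0 _) (bf 0); rewrite pmulr_lge0 // decay_gt0.
  apply: (@integral1_dct _ _ (C * (Rintegral mu setT b) ^+ n)) => [k|k s|s].
  - exact: inner_cont (cF k) (bF k).
  - exact: inner_bnd (cF k) (bF k).
  - apply: (dct _ _ C) => [k|k v|v|].
    + exact: continuous_slice.
    + apply: le_trans (slice_bound _ (bF k) _) _.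
      by rewrite ler_wpM2r ?(ltW (decay_gt0 _)) // ler_piMr.
    + exact: Ff.
    + exact: continuous_slice.
rewrite exprSr mulrA.
have [] := @integral1_bound _ (C * (Rintegral mu setT b) ^+ n) (inner_cont f C cf bf) => //.
by move=> s; exact: inner_bnd.
Qed.

(** A class stable under slicing, in which every inner integral is again continuous and integrable;
    linearity of the iterated integral follows by induction. *)
Definition admissible n (f : 'rV[R]_n -> R) :=
  continuous f /\ exists C, forall v, `|f v| <= C * decay v.

Lemma integral_rV_dct n (F : nat -> 'rV[R]_n -> R) (f : 'rV[R]_n -> R) (C : R) :
  (forall k, continuous (F k)) -> (forall k v, `|F k v| <= C * decay v) ->
  (forall v, (fun k => F k v) @ \oo --> f v) -> continuous f ->
  (fun k => integral_rV (F k)) @ \oo --> integral_rV f.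
Proof. exact: (integral_rV_dct_bound n).1. Qed.

Let slice_admissible n (f : 'rV[R]_(1 + n) -> R) s : admissible f ->
  admissible (fun v : 'rV[R]_n => f (row_mx (s%:M : 'rV[R]_1) v)).
Proof.
move=> [cf [C bf]]; split; first exact: continuous_slice.
by exists (C * b s); exact: slice_bound.
Qed.

Let inner_admissible n (f : 'rV[R]_(1 + n) -> R) : admissible f ->
  continuous (fun s : R => integral_rV (fun v : 'rV[R]_n => f (row_mx (s%:M : 'rV[R]_1) v))) /\
  exists C, forall s : R,
    `|integral_rV (fun v : 'rV[R]_n => f (row_mx (s%:M : 'rV[R]_1) v))| <= C * b s.
Proof.
move=> [cf [C bf]]; split; last first.
  exists (C * (Rintegral mu setT b) ^+ n) => s; rewrite mulrAC.
  apply: (integral_rV_dct_bound n).2; first exact: continuous_slice.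
  exact: slice_bound.
move=> s; apply/(@cvg_nbhsP _ R^o) => u us.
have C0 : 0 <= C by have := le_trans (normr_ge0 _) (bf 0); rewrite pmulr_lge0 // decay_gt0.
apply: (@integral_rV_dct _ _ _ C) => [k|k v|v|].
- exact: continuous_slice.
- apply: le_trans (slice_bound _ bf _) _.
  by rewrite ler_wpM2r ?(ltW (decay_gt0 _)) // ler_piMr.
- apply: (@cvg_comp _ _ _ (fun k => row_mx ((u k)%:M : 'rV[R]_1) v) f _ _ _ _ (cf _)).
  by apply: cvg_row_mx; [exact: cvg_scalar_mx us|exact: cvg_cst].
- exact: continuous_slice.
Qed.

Let adm1_integrable (f : R -> R) : continuous f -> (exists C, forall s, `|f s| <= C * b s) ->
  mu.-integrable setT (EFin \o f).
Proof. by move=> cf [C bf]; have [] := integral1_bound cf bf. Qed.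

Lemma integral_rVD n (f g : 'rV[R]_n -> R) : admissible f -> admissible g ->
  integral_rV (fun v => f v + g v) = integral_rV f + integral_rV g.
Proof.
elim: n f g => [//|n IH] f g af ag.
transitivity (Rintegral mu setT (fun s : R =>
    integral_rV (fun v : 'rV[R]_n => f (row_mx (s%:M : 'rV[R]_1) v)) +
    integral_rV (fun v : 'rV[R]_n => g (row_mx (s%:M : 'rV[R]_1) v)))).
  by apply: eq_Rintegral => s _; apply: IH; exact: slice_admissible.
have [cf bf] := inner_admissible af; have [cg bg] := inner_admissible ag.
by apply: RintegralD => //; exact: adm1_integrable.
Qed.

Lemma integral_rVZ n (c : R) (f : 'rV[R]_n -> R) : admissible f ->
  integral_rV (fun v => c * f v) = c * integral_rV f.
Proof.
elim: n f => [//|n IH] f af.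
transitivity (Rintegral mu setT (fun s : R =>
    c * integral_rV (fun v : 'rV[R]_n => f (row_mx (s%:M : 'rV[R]_1) v)))).
  by apply: eq_Rintegral => s _; apply: IH; exact: slice_admissible.
have [cf bf] := inner_admissible af.
by apply: RintegralZl => //; exact: adm1_integrable.
Qed.

(** With w = l s + c, the constant comes from s^2 = (w - c)^2 / l^2 and (w - c)^2 <= 2 (1 + c^2) (1
    + w^2). *)
Let affine_bound (C l c s : R) : l != 0 -> 0 <= C ->
  C * b (l * s + c) <= C * (1 + 2 * (1 + c ^+ 2) / l ^+ 2) * b s.
Proof.
move=> l0 C0; rewrite -mulrA ler_wpM2l // /b ler_pdivlMr ?ltr_pwDl ?sqr_ge0 //.
rewrite ler_pdivrMl ?ltr_pwDl ?sqr_ge0 //.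
have l2 : 0 < l ^+ 2 by rewrite exprn_even_gt0.
set w := l * s + c; have -> : s = (w - c) / l by rewrite /w addrK mulrC mulKf.
rewrite expr_div_n mulrDr mulr1 lerD ?lerDl ?sqr_ge0 // mulrA ler_pM2r ?invr_gt0 //.
have := sqr_ge0 (w + c); have := sqr_ge0 (w * c); nra.
Qed.

Let integral1N (G : R -> R) : continuous G -> (forall s, 0 <= G s) ->
  (\int[mu]_s (G (- s))%:E = \int[mu]_s (G s)%:E)%E.
Proof.
move=> cG G0; pose phi := (-%R : measurableTypeR R -> measurableTypeR R).
have mG : measurable_fun setT (EFin \o G).
  by apply/measurable_EFinP; apply: continuous_measurable_fun.
have mphi : measurable_fun setT phi by exact: oppr_measurable.
transitivity (\int[pushforward mu phi]_s (G s)%:E)%E; last first.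
  by apply: eq_measure_integral => A mA _; exact: lebesgue_measureN.
by rewrite ge0_integral_pushforward // => x _; rewrite lee_fin.
Qed.

Let integral1_scale (G : R -> R) (l c : R) : 0 < l -> continuous G -> (forall s, 0 <= G s) ->
  (\int[mu]_s (G s)%:E = \int[mu]_s (l * G (l * s + c))%:E)%E.
Proof.
move=> l0 cG G0; pose F s : R := l * s + c.
have dF (s : R) : is_derive s 1 F l.
  by apply: is_derive_eq; rewrite addr0 /GRing.scale /= mulr1.
have F'E : derive1 F = cst l by apply/funext => s; rewrite derive1E derive_val.
rewrite (@increasing_ge0_integration_by_substitutionT _ F G) //.
- by apply: eq_integral => s _; rewrite fctE /= F'E /cst mulrC.
- by move=> x y xy; rewrite /F ltrD2r ltr_pM2l.
- by rewrite F'E; exact: cst_continuous.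
- by rewrite F'E; exact: is_cvg_cst.
- by rewrite F'E; exact: is_cvg_cst.
- apply/cvgrNyPle => A; apply: filterS (nbhs_ninfty_le (num_real (l^-1 * (A - c)))) => x.
  by rewrite /F -lerBrDr -ler_pdivlMl.
- apply/cvgryPge => A; apply: filterS (nbhs_pinfty_ge (num_real (l^-1 * (A - c)))) => x.
  by rewrite /F -lerBlDr -ler_pdivrMl.
Qed.

Let integral1_affine (f : R -> R) (l c : R) : l != 0 -> continuous f ->
  (exists C, forall s, `|f s| <= C * b s) ->
  [/\ continuous (fun s => f (l * s + c)), exists C, forall s, `|f (l * s + c)| <= C * b s &
   `|l| * Rintegral mu setT (fun s => f (l * s + c)) = Rintegral mu setT f].
Proof.
move=> l0 cf [C bf].
have C0 : 0 <= C by have := le_trans (normr_ge0 _) (bf 0); rewrite pmulr_lge0.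
have caff (g : R -> R) : continuous g -> continuous (fun s => g (l * s + c)).
  move=> cg s; apply: (@continuous_comp _ _ _ (fun s => l * s + c)); last exact: cg.
  by apply: cvgD; [apply: cvgM; [exact: cvg_cst|exact: cvg_id]|exact: cvg_cst].
have baff (g : R -> R) D : 0 <= D -> (forall s, `|g s| <= D * b s) ->
    exists C, forall s, `|g (l * s + c)| <= C * b s.
  move=> D0 bg; exists (D * (1 + 2 * (1 + c ^+ 2) / l ^+ 2)) => s.
  by apply: le_trans (bg _) _; exact: affine_bound.
split; [exact: caff|exact: baff bf|].
have pos (g : R -> R) D : 0 <= D -> continuous g -> (forall s, `|g s| <= D * b s) -> (forall s, 0 <= g s) ->
    `|l| * Rintegral mu setT (fun s => g (l * s + c)) = Rintegral mu setT g.
  move=> D0 cg bg g0; rewrite -RintegralZl //; last first.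
    by apply: adm1_integrable; [exact: caff|exact: baff bg].
  rewrite /Rintegral; congr fine; have [lp|ln|lz] := ltrgt0P l.
  - by rewrite -integral1_scale.
  - transitivity (\int[mu]_s (- l * g (- l * (- s) + c))%:E)%E.
      by apply: eq_integral => s _; rewrite mulrNN.
    have ln0 : 0 < - l by rewrite oppr_gt0.
    rewrite (integral1N (G := fun s => - l * g (- l * s + c))) -?integral1_scale //.
    + move=> s; apply: cvgM; first exact: cvg_cst.
      apply: (@continuous_comp _ _ _ (fun s => - l * s + c)); last exact: cg.
      by apply: cvgD; [apply: cvgM; [exact: cvg_cst|exact: cvg_id]|exact: cvg_cst].
    + by move=> s; rewrite mulr_ge0 // ltW.
  - by rewrite lz eqxx in l0.
(* Reduction to the nonnegative case [pos]: [f] is the difference of [f + C b] and [C b]. *)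
pose g1 s := f s + C * b s; pose g2 s := C * b s.
have cg2 : continuous g2 by move=> s; apply: cvgM; [exact: cvg_cst|exact: cb].
have cg1 : continuous g1 by move=> s; apply: cvgD; [exact: cf|exact: cg2].
have g2_0 s : 0 <= g2 s by rewrite mulr_ge0 // ltW.
have g1_0 s : 0 <= g1 s.
  by have := bf s; rewrite ler_norml => /andP[h _]; rewrite /g1 -lerBlDr sub0r.
have bg2 s : `|g2 s| <= C * b s by rewrite ger0_norm.
have bg1 s : `|g1 s| <= (2 * C) * b s.
  apply: le_trans (ler_normD _ _) _; rewrite -mulrA mulr_natl mulr2n; exact: lerD (bf s) (bg2 s).
have i1 := adm1_integrable cg1 (ex_intro _ _ bg1).
have i2 := adm1_integrable cg2 (ex_intro _ _ bg2).
have C20 : 0 <= 2 * C by rewrite mulr_ge0.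
have i1' := adm1_integrable (caff _ cg1) (baff _ _ C20 bg1).
have i2' := adm1_integrable (caff _ cg2) (baff _ _ C0 bg2).
transitivity (Rintegral mu setT (fun s => g1 s - g2 s)); last first.
  by apply: eq_Rintegral => s _; rewrite /g1 addrK.
rewrite RintegralB // -(pos g1 (2 * C)) // -(pos g2 C) // -mulrBr -RintegralB //.
by congr (_ * _); apply: eq_Rintegral => s _; rewrite /g1 addrK.
Qed.

(** For a fixed first coordinate the others undergo a triangular map in one dimension less, with
    shifts that depend on the fixed value as a parameter. What remains is an affine substitution in
    the first coordinate. *)
Lemma integral_rV_triangular n (T : 'rV[R]_n -> 'rV[R]_n) (l : 'I_n -> R)
    (tau : 'I_n -> 'rV[R]_n -> R) (f : 'rV[R]_n -> R) :
  (forall k y, T y 0 k = l k * y 0 k + tau k y) ->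
  (forall (k : 'I_n) (y y' : 'rV[R]_n), (forall j : 'I_n, (j < k)%N -> y 0 j = y' 0 j) -> tau k y = tau k y') ->
  (forall k, l k != 0) -> admissible f ->
  (\prod_k `|l k|) * integral_rV (f \o T) = integral_rV f.
Proof.
elim: n T l tau f => [|n IH]; last rewrite -[n.+1]/(1 + n)%N; move=> T l tau f TE tauE l0 af.
  by rewrite big_ord0 mul1r /=; congr f; apply/rowP => -[].
(* No coordinate precedes the first one, so [tau i0] is constant and may be evaluated at 0. *)
pose i0 : 'I_(1 + n) := lshift n ord0; pose c := tau i0 0.
pose Ts (s : R) (v : 'rV[R]_n) : 'rV[R]_n :=
  \row_k (l (rshift 1 k) * v 0 k + tau (rshift 1 k) (row_mx (s%:M : 'rV[R]_1) v)).
have TsE s v : T (row_mx (s%:M : 'rV[R]_1) v) = row_mx ((l i0 * s + c)%:M : 'rV[R]_1) (Ts s v).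
  apply/rowP => k; case: (@split_ordP 1 n k) => j ->.
    rewrite (ord1 j) row_mxEl mxE eqxx mulr1n TE row_mxEl mxE eqxx mulr1n; congr (_ + _).
    exact: tauE.
  by rewrite TE !row_mxEr mxE.
have [cI bI] := inner_admissible af; set I := (fun s : R => _) in cI bI.
have Pl0 : \prod_k `|l (rshift 1 k)| != 0.
  by apply/prodf_neq0 => k _; rewrite normr_eq0.
have E s : integral_rV (fun v : 'rV[R]_n => (f \o T) (row_mx (s%:M : 'rV[R]_1) v)) =
    (\prod_k `|l (rshift 1 k)|)^-1 * I (l i0 * s + c).
  apply: (mulfI Pl0); rewrite mulVKf // /I.
  rewrite -(IH (Ts s) (fun k => l (rshift 1 k))
    (fun k v => tau (rshift 1 k) (row_mx (s%:M : 'rV[R]_1) v))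
    (fun v => f (row_mx ((l i0 * s + c)%:M : 'rV[R]_1) v))) //.
  - by congr (_ * integral_rV _); apply/funext => v /=; rewrite TsE.
  - by move=> k v; rewrite mxE.
  - move=> k v v' vv'; apply: tauE => j; case: (@split_ordP 1 n j) => i ->.
      by rewrite !row_mxEl.
    by rewrite !row_mxEr /= ltn_add2l; exact: vv'.
  - exact: slice_admissible.
have [cA bA EA] := integral1_affine c (l0 i0) cI bI.
transitivity (Rintegral mu setT I) => //; rewrite -EA.
rewrite (_ : integral_rV _ = Rintegral mu setT (fun s =>
  (\prod_k `|l (rshift 1 k)|)^-1 * I (l i0 * s + c))); last first.
  by apply: eq_Rintegral => s _; exact: E.
rewrite RintegralZl //; last exact: adm1_integrable.
rewrite big_split_ord /= big_ord1 mulrA; congr (_ * _).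
by rewrite -mulrA divff ?mulr1.
Qed.

End IteratedIntegral.

(** * Differentiation on row vectors *)

Section RealContinuity.
Context {R : realType} {T : topologicalType}.
Implicit Types f g : T -> R.

Lemma continuous_addr f g : continuous f -> continuous g -> continuous (fun y => f y + g y).
Proof. by move=> cf cg y; exact: (@cvgD _ _ _ (nbhs y) _ f g _ _ (cf y) (cg y)). Qed.

Lemma continuous_oppr f : continuous f -> continuous (fun y => - f y).
Proof. by move=> cf y; exact: (@cvgN _ _ _ (nbhs y) _ f _ (cf y)). Qed.

Lemma continuous_subr f g : continuous f -> continuous g -> continuous (fun y => f y - g y).
Proof. by move=> cf cg; apply: continuous_addr => //; exact: continuous_oppr. Qed.

Lemma continuous_mulr f g : continuous f -> continuous g -> continuous (fun y => f y * g y).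
Proof. by move=> cf cg y; exact: (@cvgM _ _ (nbhs y) _ f g _ _ (cf y) (cg y)). Qed.

Lemma continuous_expR_comp f : continuous f -> continuous (fun y => expR (f y)).
Proof. by move=> cf y; apply: continuous_comp; [exact: cf|exact: continuous_expR]. Qed.

Lemma continuous_sumr (I : Type) (r : seq I) (f : I -> T -> R) :
  (forall i, continuous (f i)) -> continuous (fun y => \sum_(i <- r) f i y).
Proof.
move=> cf; elim: r => [|i r IH].
  by under eq_fun do rewrite big_nil; exact: (@cst_continuous _ _ (0 : R)).
by under eq_fun do rewrite big_cons; exact: continuous_addr.
Qed.

Lemma continuous_prodr (I : Type) (r : seq I) (f : I -> T -> R) :
  (forall i, continuous (f i)) -> continuous (fun y => \prod_(i <- r) f i y).
Proof.
move=> cf; elim: r => [|i r IH].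
  by under eq_fun do rewrite big_nil; exact: (@cst_continuous _ _ (1 : R)).
by under eq_fun do rewrite big_cons; exact: continuous_mulr.
Qed.

End RealContinuity.

(** * Derivatives of complex-valued functions, linear forms and Gaussians *)

Section DirectionalDerivative.
Context {R : realType}.
Local Notation C := R[i].
Local Notation Re := complex.Re.
Local Notation Im := complex.Im.

(** The passage to one variable, where the chain rule and the mean value theorem are applied. *)
Lemma is_derive_line n (x v : 'rV[R]_n) (s : R) (f : 'rV[R]_n -> R) (l : R) :
  is_derive (s *: v + x) v f l <-> is_derive s 1 (fun h => f (h *: v + x)) l.
Proof.
have E : (fun h : R => h^-1 *: ((f \o shift (s *: v + x)) (h *: v) - f (s *: v + x))) =
   (fun h : R => h^-1 *: (((fun h => f (h *: v + x)) \o shift s) (h *: 1) - f (s *: v + x))).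
  apply/funext => h /=; rewrite scalerDl addrA; congr (h^-1 *: (f (_ *: v + _ + _) - _)).
  by rewrite /GRing.scale /= mulr1.
split=> -[df vf]; split.
- by rewrite /derivable -E.
- by rewrite /derive -E.
- by rewrite /derivable E.
- by rewrite /derive E.
Qed.

Lemma is_derive_affine n (x v : 'rV[R]_n) (f : 'rV[R]_n -> R) (l : R) :
  (forall h, f (h *: v + x) = f x + h * l) -> is_derive x v f l.
Proof.
move=> fE; suff : is_derive (0 *: v + x) v f l by rewrite scale0r add0r.
apply/is_derive_line.
have -> : (fun h => f (h *: v + x)) = (fun h : R => f x + h * l) by apply/funext.
by apply: is_derive_eq; rewrite /GRing.scale /=; ring.
Qed.

Lemma is_derive_expRN n (x v : 'rV[R]_n) (f : 'rV[R]_n -> R) (l : R) :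
  is_derive x v f l -> is_derive x v (fun y => expR (f y)) (l * expR (f x)).
Proof.
move=> df; suff : is_derive (0 *: v + x) v (fun y => expR (f y)) (l * expR (f (0 *: v + x))).
  by rewrite scale0r add0r.
apply/is_derive_line; rewrite mulrC; apply: (is_derive1_comp (is_derive_expR _)).
by apply/is_derive_line; rewrite scale0r add0r.
Qed.

Definition is_cderive n (k : 'I_n) (F : 'rV[R]_n -> C) (x : 'rV[R]_n) (l : C) : Prop :=
  is_derive x ('e_k : 'rV[R]_n) (fun y => Re (F y)) (Re l) /\
  is_derive x ('e_k : 'rV[R]_n) (fun y => Im (F y)) (Im l).

Lemma is_cderiveE n (k : 'I_n) F (x : 'rV[R]_n) l : is_cderive k F x l -> cderive k F x = l.
Proof. by move=> [[_ h1] [_ h2]]; rewrite /cderive h1 h2; case: l {h1 h2}. Qed.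

Lemma is_cderive_cst n (k : 'I_n) (c : C) (x : 'rV[R]_n) : is_cderive k (fun=> c) x 0.
Proof. by split; [exact: (is_derive_cst (Re c))|exact: (is_derive_cst (Im c))]. Qed.

Lemma is_cderiveD n (k : 'I_n) F G (x : 'rV[R]_n) l m :
  is_cderive k F x l -> is_cderive k G x m -> is_cderive k (fun y => F y + G y) x (l + m).
Proof.
move=> [f1 f2] [g1 g2]; split; rewrite raddfD /=.
  have -> : (fun y => Re (F y + G y)) = (fun y => Re (F y)) + (fun y => Re (G y)).
    by apply/funext => y; rewrite raddfD.
  exact: is_deriveD.
have -> : (fun y => Im (F y + G y)) = (fun y => Im (F y)) + (fun y => Im (G y)).
  by apply/funext => y; rewrite raddfD.
exact: is_deriveD.
Qed.

Lemma ReD (a b : C) : Re (a + b) = Re a + Re b. Proof. by case: a b => [? ?] []. Qed.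

Lemma ImD (a b : C) : Im (a + b) = Im a + Im b. Proof. by case: a b => [? ?] []. Qed.

Lemma ReM (a b : C) : Re (a * b) = Re a * Re b - Im a * Im b.
Proof. by case: a b => [a1 a2] [b1 b2]. Qed.

Lemma ImM (a b : C) : Im (a * b) = Re a * Im b + Im a * Re b.
Proof. by case: a b => [a1 a2] [b1 b2]. Qed.

Lemma is_cderiveM n (k : 'I_n) F G (x : 'rV[R]_n) l m :
  is_cderive k F x l -> is_cderive k G x m ->
  is_cderive k (fun y => F y * G y) x (l * G x + F x * m).
Proof.
move=> [f1 f2] [g1 g2]; split.
  have -> : (fun y => Re (F y * G y)) = (fun y => Re (F y)) * (fun y => Re (G y)) -
     (fun y => Im (F y)) * (fun y => Im (G y)) by apply/funext => y; rewrite ReM.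
  by apply: is_derive_eq; rewrite ReD !ReM /GRing.scale /=; ring.
have -> : (fun y => Im (F y * G y)) = (fun y => Re (F y)) * (fun y => Im (G y)) +
   (fun y => Im (F y)) * (fun y => Re (G y)) by apply/funext => y; rewrite ImM.
have dh := is_deriveD (is_deriveM f1 g2) (is_deriveM f2 g1).
apply: (@is_derive_eq _ _ _ _ _ _ _ _ dh); rewrite ImD 2!ImM /GRing.scale /= addrACA [RHS]addrC.
by rewrite [Re l * _]mulrC [Im l * _]mulrC.
Qed.

Lemma is_cderive_real n (k : 'I_n) (f : 'rV[R]_n -> R) (x : 'rV[R]_n) l :
  is_derive x ('e_k : 'rV[R]_n) f l -> is_cderive k (fun y => (f y)%:C%C) x l%:C%C.
Proof. by move=> h; split=> //; exact: (is_derive_cst (0 : R)). Qed.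

Definition ccontinuous n (F : 'rV[R]_n -> C) : Prop :=
  continuous (fun y => Re (F y)) /\ continuous (fun y => Im (F y)).

(** The gradient is an argument, so that sum and product rules compute it as an explicit expression
    to which [along] can be applied. *)
Record C1 n (F : 'rV[R]_n -> C) (dF : 'rV[R]_n -> 'rV[C]_n) : Prop := MkC1 {
  C1_cont : ccontinuous F;
  C1_dcont : forall k, ccontinuous (fun y => dF y 0 k);
  C1_der : forall k y, is_cderive k F y (dF y 0 k) }.

Lemma ccontinuous_cst n c : ccontinuous (fun _ : 'rV[R]_n => c).
Proof. by split; [exact: (@cst_continuous _ _ (Re c))|exact: (@cst_continuous _ _ (Im c))]. Qed.

Lemma ccontinuousD n (F G : 'rV[R]_n -> C) :
  ccontinuous F -> ccontinuous G -> ccontinuous (fun y => F y + G y).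
Proof.
move=> [f1 f2] [g1 g2]; split.
  have -> : (fun y => Re (F y + G y)) = (fun y => Re (F y) + Re (G y)) by apply/funext => y; rewrite ReD.
  exact: continuous_addr.
have -> : (fun y => Im (F y + G y)) = (fun y => Im (F y) + Im (G y)) by apply/funext => y; rewrite ImD.
exact: continuous_addr.
Qed.

Lemma ccontinuousM n (F G : 'rV[R]_n -> C) :
  ccontinuous F -> ccontinuous G -> ccontinuous (fun y => F y * G y).
Proof.
move=> [f1 f2] [g1 g2]; split.
  have -> : (fun y => Re (F y * G y)) = (fun y => Re (F y) * Re (G y) - Im (F y) * Im (G y)).
    by apply/funext => y; rewrite ReM.
  by apply: continuous_subr; exact: continuous_mulr.
have -> : (fun y => Im (F y * G y)) = (fun y => Re (F y) * Im (G y) + Im (F y) * Re (G y)).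
  by apply/funext => y; rewrite ImM.
by apply: continuous_addr; exact: continuous_mulr.
Qed.

Lemma ccontinuous_real n (f : 'rV[R]_n -> R) : continuous f -> ccontinuous (fun y => (f y)%:C%C).
Proof. by move=> cf; split=> //; exact: (@cst_continuous _ _ (0 : R)). Qed.

Lemma C1_cst n c : C1 (fun _ : 'rV[R]_n => c) (fun=> 0).
Proof.
split=> [|k|k y]; first exact: ccontinuous_cst.
  exact: ccontinuous_cst.
by rewrite mxE; exact: is_cderive_cst.
Qed.

Lemma C1D n (F G : 'rV[R]_n -> C) dF dG : C1 F dF -> C1 G dG ->
  C1 (fun y => F y + G y) (fun y => dF y + dG y).
Proof.
move=> [f1 f2 f3] [g1 g2 g3]; split=> [|k|k y]; first exact: ccontinuousD.
  by under eq_fun do rewrite mxE; exact: ccontinuousD.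
by rewrite mxE; exact: is_cderiveD.
Qed.

Lemma C1M n (F G : 'rV[R]_n -> C) dF dG : C1 F dF -> C1 G dG ->
  C1 (fun y => F y * G y) (fun y => G y *: dF y + F y *: dG y).
Proof.
move=> [f1 f2 f3] [g1 g2 g3]; split=> [|k|k y]; first exact: ccontinuousM.
  by under eq_fun do rewrite !mxE; apply: ccontinuousD; exact: ccontinuousM.
by rewrite !mxE (mulrC (G y)); exact: is_cderiveM.
Qed.

Lemma C1_sum n (I : Type) (r : seq I) (F : I -> 'rV[R]_n -> C) dF :
  (forall i, C1 (F i) (dF i)) -> C1 (fun y => \sum_(i <- r) F i y) (fun y => \sum_(i <- r) dF i y).
Proof.
move=> cF; elim: r => [|i r IH].
  under eq_fun do rewrite big_nil.
  under [X in C1 _ X]eq_fun do rewrite big_nil; exact: C1_cst.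
under eq_fun do rewrite big_cons.
under [X in C1 _ X]eq_fun do rewrite big_cons; exact: C1D.
Qed.

Definition clin n (u : 'rV[C]_n) (y : 'rV[R]_n) : C := \sum_k u 0 k * (y 0 k)%:C%C.

Definition rlin n (u : 'rV[R]_n) (y : 'rV[R]_n) : R := \sum_k u 0 k * y 0 k.

Lemma continuous_rlin n (u : 'rV[R]_n) : continuous (rlin u).
Proof.
apply: continuous_sumr => k; apply: continuous_mulr; first exact: (@cst_continuous _ _ (u 0 k)).
by move=> ?; exact: coord_continuous.
Qed.

Lemma is_derive_rlin n (u : 'rV[R]_n) k (y : 'rV[R]_n) : is_derive y ('e_k : 'rV[R]_n) (rlin u) (u 0 k).
Proof.
apply: is_derive_affine => h; rewrite /rlin.
under eq_bigr do rewrite !mxE mulrDr; rewrite big_split /= addrC; congr (_ + _).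
rewrite (bigD1 k) //= !eqxx /= big1 ?addr0 => [|j jk]; first by ring.
by rewrite (negPf jk) !mulr0.
Qed.

Lemma C1_clin n (u : 'rV[C]_n) : C1 (clin u) (fun=> u).
Proof.
have coordE k : (fun y : 'rV[R]_n => (y 0 k)%:C%C) = (fun y => (rlin ('e_k) y)%:C%C).
  apply/funext => y; rewrite /rlin (bigD1 k) //= mxE !eqxx mul1r big1 ?addr0 // => j jk.
  by rewrite mxE (negPf jk) andbF mul0r.
have coord k : C1 (fun y : 'rV[R]_n => (y 0 k)%:C%C) (fun=> 'e_k).
  rewrite coordE; split=> [|j|j y].
  - exact/ccontinuous_real/continuous_rlin.
  - exact: ccontinuous_cst.
  - have -> : ('e_k : 'rV[C]_n) 0 j = (('e_k : 'rV[R]_n) 0 j)%:C%C.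
      by rewrite !mxE; case: (_ && _).
    exact/is_cderive_real/is_derive_rlin.
have -> : (fun=> u) = (fun y : 'rV[R]_n => \sum_k ((y 0 k)%:C%C *: 0 + u 0 k *: 'e_k)).
  apply/funext => y; rewrite {1}(row_sum_delta u); apply: eq_bigr => k _.
  by rewrite scaler0 add0r.
by apply: C1_sum => k; apply: C1M; [exact: C1_cst|exact: coord].
Qed.

Definition gaussian n (T : finType) (c : T -> R) (l : T -> 'rV[R]_n) (y : 'rV[R]_n) : R :=
  expR (- \sum_m c m * (rlin (l m) y) ^+ 2).

Lemma continuous_gaussian n (T : finType) (c : T -> R) (l : T -> 'rV[R]_n) :
  continuous (gaussian c l).
Proof.
apply/continuous_expR_comp/continuous_oppr/continuous_sumr => m.
apply: continuous_mulr; first exact: (@cst_continuous _ _ (c m)).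
by under eq_fun do rewrite expr2; apply: continuous_mulr; exact: continuous_rlin.
Qed.

Lemma C1_gaussian n (T : finType) (c : T -> R) (l : T -> 'rV[R]_n) :
  C1 (fun y => (gaussian c l y)%:C%C)
     (fun y => (gaussian c l y)%:C%C *: map_mx (fun a => a%:C%C)
        (\sum_m (- (2 * c m * rlin (l m) y)) *: l m)).
Proof.
split=> [|k|k y]; first exact/ccontinuous_real/continuous_gaussian.
  under eq_fun do rewrite !mxE -rmorphM.
  apply/ccontinuous_real/continuous_mulr; first exact: continuous_gaussian.
  under eq_fun do rewrite summxE; apply: continuous_sumr => m.
  under eq_fun do rewrite mxE; apply: continuous_mulr; last exact: (@cst_continuous _ _ (l m 0 k)).
  apply/continuous_oppr/continuous_mulr; last exact: continuous_rlin.
  exact: (@cst_continuous _ _ (2 * c m)).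
rewrite !mxE -rmorphM; apply: is_cderive_real; rewrite mulrC; apply: is_derive_expRN.
have E : - (fun y => \sum_m c m * (rlin (l m) y) ^+ 2) = (fun y => - \sum_m c m * (rlin (l m) y) ^+ 2) by [].
rewrite -E summxE.
have -> : \sum_i (- (2 * c i * rlin (l i) y) *: l i) 0 k = - \sum_i (2 * c i * rlin (l i) y) * l i 0 k.
  by rewrite -sumrN; apply: eq_bigr => m _; rewrite mxE mulNr.
apply: is_deriveN; elim: (index_enum _) => [|m r IH].
  by rewrite big_nil; under eq_fun do rewrite big_nil; exact: (is_derive_cst (0 : R)).
rewrite big_cons; under eq_fun do rewrite big_cons; apply: is_deriveD.
have dl := is_derive_rlin (l m) k y.
have -> : (fun x => c m * rlin (l m) x ^+ 2) = (fun=> c m) * (rlin (l m) * rlin (l m)).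
  by apply/funext => x; rewrite expr2.
by apply: is_derive_eq; rewrite /GRing.scale /=; ring.
Qed.

(** The bilinear pairing, without conjugation. Applied to a gradient it is the derivative along the
    constant complex vector field [w], such as d/dz. *)
Definition along n (w : 'rV[C]_n) (u : 'rV[C]_n) : C := \sum_k w 0 k * u 0 k.

End DirectionalDerivative.

(** * Derivatives of compactly supported functions have integral zero *)

Section IntegrationByParts.
Context {R : realType}.
Local Notation C := R[i].
Local Notation Re := complex.Re.
Local Notation Im := complex.Im.

Definition box_support n (V : zmodType) (r : R) (f : 'rV[R]_n -> V) : Prop :=
  forall (v : 'rV[R]_n) k, r < `|v 0 k| -> f v = 0.

Lemma bounded_on_box n (f : 'rV[R]_n -> R) (r : R) : continuous f ->
  exists2 M, 0 <= M & forall v : 'rV[R]_n, (forall k, `|v 0 k| <= r) -> `|f v| <= M.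
Proof.
move=> cf.
have /compact_bounded[M [_ bM]] :
    compact [set f v | v in [set v : 'rV[R]_n | forall k, [set` `[- r, r]] (v ord0 k)]].
  apply: continuous_compact; first exact: continuous_subspaceT.
  by apply: (@rV_compact _ n (fun=> [set` `[- r, r]])) => k; exact: segment_compact.
exists (Num.max 0 M + 1) => [|v bv]; first by rewrite addr_ge0 // le_max lexx.
apply: bM; first by rewrite (le_lt_trans (y := Num.max 0 M)) ?le_max ?lexx ?orbT // ltrDl.
by exists v => //= k; rewrite in_itv /= -ler_norml.
Qed.

Lemma decay_box n (v : 'rV[R]_n) (r : R) : (forall k, `|v 0 k| <= r) -> 1 <= (1 + r ^+ 2) ^+ n * decay v.
Proof.
move=> bv; have -> : (1 + r ^+ 2) ^+ n = \prod_(k < n) (1 + r ^+ 2) by rewrite prodr_const card_ord.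
rewrite /decay -big_split /=.
have h k : 1 <= (1 + r ^+ 2) * (1 + v 0 k ^+ 2)^-1.
  rewrite ler_pdivlMr ?ltr_pwDl ?sqr_ge0 // mul1r lerD2l -(real_normK (num_real (v 0 k))).
  by rewrite ler_sqr ?nnegrE // (le_trans _ (bv k)).
elim/big_rec: _ => // k x _ hx; exact: mulr_ege1.
Qed.

Lemma admissible_support n (f : 'rV[R]_n -> R) (r : R) : continuous f -> box_support r f -> admissible f.
Proof.
move=> cf sf; split => //; have [M M0 bM] := bounded_on_box r cf.
exists (M * (1 + r ^+ 2) ^+ n) => v.
have [bv|] := pselect (forall k, `|v 0 k| <= r).
  apply: le_trans (bM v bv) _; rewrite -mulrA ler_peMr //; exact: decay_box.
move=> /existsNP[k /negP]; rewrite -ltNge => /sf ->; rewrite normr0.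
by rewrite mulr_ge0 ?mulr_ge0 ?exprn_ge0 ?addr_ge0 ?sqr_ge0 // ltW // decay_gt0.
Qed.

Lemma harmonic_dnbhs : (fun m => m.+1%:R^-1 : R) @ \oo --> (0 : R)^'.
Proof.
move=> A; rewrite /dnbhs /within /= => nA.
have : \forall m \near \oo, (m.+1%:R^-1 : R) != 0 -> A m.+1%:R^-1 by exact: (@cvg_harmonic R _ nA).
by apply: filterS => m; apply; rewrite invr_eq0 pnatr_eq0.
Qed.

Lemma integral_rV_translate n (f : 'rV[R]_n -> R) (w : 'rV[R]_n) : admissible f ->
  integral_rV (fun v => f (w + v)) = integral_rV f.
Proof.
move=> af; rewrite -(@integral_rV_triangular _ _ (fun v => w + v) (fun=> 1) (fun k _ => w 0 k) f) //.
  by rewrite big1 ?mul1r // => k _; rewrite normr1.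
by move=> k y; rewrite mxE mul1r addrC.
Qed.

(** The difference quotients [Q m] have integral zero by translation invariance and converge to
    [DF]. The mean value theorem bounds them uniformly, so dominated convergence applies and the
    same bound makes [DF] admissible. *)
Lemma integral_rV_derive n (k : 'I_n) (F DF : 'rV[R]_n -> R) (r : R) :
  continuous F -> continuous DF -> (forall v, is_derive v ('e_k : 'rV[R]_n) F (DF v)) ->
  box_support r F -> admissible DF /\ integral_rV DF = 0.
Proof.
move=> cF cDF dF sF; pose h m : R := m.+1%:R^-1.
have h0 m : 0 < h m by rewrite invr_gt0.
have h1 m : h m <= 1 by rewrite invf_le1 // ler1n.
pose Q m v := (h m)^-1 * F (h m *: 'e_k + v) + - (h m)^-1 * F v.
(* The steps [h m] are at most 1, so the quotients live in the cube of radius r + 1, and the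
   intermediate point of the mean value theorem is at most 1 further out. *)
have [M M0 bM] := bounded_on_box (r + 2) cDF.
have cT m : continuous (fun v => F (h m *: 'e_k + v)).
  move=> v; apply: continuous_comp; last exact: cF.
  by apply: continuousD; [exact: cst_continuous|move=> ?; exact: cvg_id].
have aF := admissible_support cF sF.
have sT m : box_support (r + 1) (fun v => F (h m *: 'e_k + v)).
  move=> v j vj; apply: (sF _ j); rewrite !mxE eqxx /=.
  have b : `|h m * (j == k)%:R| <= 1.
    by case: (j == k); rewrite ?mulr1 ?mulr0 ?normr0 // gtr0_norm.
  rewrite -(ltrD2r 1); apply: lt_le_trans vj _.
  have := ler_normB (h m * (j == k)%:R + v 0 j) (h m * (j == k)%:R).
  by rewrite addrAC subrr add0r => /le_trans; apply; rewrite lerD2l.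
have aT m := admissible_support (cT m) (sT m).
have cQ m : continuous (Q m).
  apply: continuous_addr; apply: continuous_mulr => //.
    exact: (@cst_continuous _ _ ((h m)^-1)).
  exact: (@cst_continuous _ _ (- (h m)^-1)).
have QD v : (fun m => Q m v) @ \oo --> DF v.
  have [dv <-] := dF v.
  have := @cvg_comp _ _ _ (fun m => m.+1%:R^-1 : R)
    (fun h : R => h^-1 *: ((F \o shift v) (h *: 'e_k) - F v)) _ _ _ harmonic_dnbhs dv.
  apply: cvg_trans; apply: near_eq_cvg; apply: nearW => m /=.
  by rewrite /Q /GRing.scale /= mulrBr mulNr.
pose K := M * (1 + (r + 1) ^+ 2) ^+ n.
have bQ m v : `|Q m v| <= K * decay v.
  have [bv|] := pselect (forall j, `|v 0 j| <= r + 1); last first.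
    move=> /existsNP[j /negP]; rewrite -ltNge => vj.
    rewrite /Q (sT m v j vj) (sF v j) ?(le_lt_trans _ vj) ?lerDl // !mulr0 addr0 normr0.
    by rewrite mulr_ge0 ?mulr_ge0 ?exprn_ge0 ?addr_ge0 ?sqr_ge0 // ltW // decay_gt0.
  have dl (s : R) : is_derive s 1 (fun s : R => F (s *: 'e_k + v)) (DF (s *: 'e_k + v)) by apply/is_derive_line.
  have cl : {within `[0, h m], continuous (fun s : R => F (s *: 'e_k + v))}.
    apply: continuous_subspaceT => s; apply: continuous_comp; last exact: cF.
    apply: continuousD; last exact: cst_continuous.
    by apply: cvgZ; [exact: cvg_id|exact: cvg_cst].
  have [c] := MVT_segment (ltW (h0 m)) (fun s _ => dl s) cl.
  rewrite in_itv /= => /andP[c0 ch]; rewrite scale0r add0r subr0 => E.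
  rewrite /Q mulNr -mulrBr E mulrCA mulVf ?mulr1 ?gt_eqF //.
  apply: le_trans (bM _ _) _ => [j|]; last first.
    by rewrite -mulrA ler_peMr //; exact: decay_box.
  rewrite !mxE eqxx /=; apply: le_trans (ler_normD _ _) _.
  rewrite addrC (_ : r + 2 = r + 1 + 1); last by rewrite -addrA.
  apply: lerD; first exact: bv.
  by case: (j == k); rewrite ?mulr1 ?mulr0 ?normr0 // ger0_norm // (le_trans ch).
split.
  split=> //; exists K => v.
  have hv : (fun m => `|Q m v|) @ \oo --> `|DF v| by apply: cvg_norm; exact: QD.
  by apply: (cvgr_to_le hv); apply: nearW => m; exact: bQ.
have Q0 m : integral_rV (Q m) = 0.
  have aZ c (f : 'rV[R]_n -> R) : admissible f -> admissible (fun v => c * f v).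
    move=> [cf [D bf]]; split.
      by apply: continuous_mulr => //; exact: (@cst_continuous _ _ c).
    by exists (`|c| * D) => v; rewrite normrM -mulrA ler_wpM2l.
  rewrite integral_rVD; [|exact: aZ|exact: aZ].
  by rewrite !integral_rVZ // integral_rV_translate // mulNr subrr.
have := integral_rV_dct cQ bQ QD cDF.
under eq_fun do rewrite Q0; move=> /cvg_lim <- //; exact: lim_cst.
Qed.

End IntegrationByParts.

(** * Integration by parts for complex functions *)

Section ComplexIntegral.
Context {R : realType}.
Local Notation C := R[i].
Local Notation Re := complex.Re.
Local Notation Im := complex.Im.

Lemma admissibleD n (f g : 'rV[R]_n -> R) : admissible f -> admissible g ->
  admissible (fun v => f v + g v).
Proof.
move=> [cf [A bf]] [cg [B bg]]; split; first exact: continuous_addr.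
exists (A + B) => v; apply: le_trans (ler_normD _ _) _; rewrite mulrDl.
exact: lerD (bf v) (bg v).
Qed.

Lemma admissibleZ n (c : R) (f : 'rV[R]_n -> R) : admissible f -> admissible (fun v => c * f v).
Proof.
move=> [cf [D bf]]; split.
  by apply: continuous_mulr => //; exact: (@cst_continuous _ _ c).
by exists (`|c| * D) => v; rewrite normrM -mulrA ler_wpM2l.
Qed.

Definition cadmissible n (F : 'rV[R]_n -> C) : Prop :=
  admissible (fun v => Re (F v)) /\ admissible (fun v => Im (F v)).

Lemma cadmissibleD n (F G : 'rV[R]_n -> C) : cadmissible F -> cadmissible G ->
  cadmissible (fun v => F v + G v).
Proof.
move=> [f1 f2] [g1 g2]; split.
  by under eq_fun do rewrite ReD; exact: admissibleD.
by under eq_fun do rewrite ImD; exact: admissibleD.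
Qed.

Lemma cadmissibleZ n c (F : 'rV[R]_n -> C) : cadmissible F -> cadmissible (fun v => c * F v).
Proof.
move=> [f1 f2]; split.
  under eq_fun do rewrite ReM -mulNr.
  by apply: admissibleD; exact: admissibleZ.
under eq_fun do rewrite ImM.
by apply: admissibleD; exact: admissibleZ.
Qed.

Lemma admissible0 n : admissible (fun _ : 'rV[R]_n => 0 : R).
Proof.
split; first exact: (@cst_continuous _ _ (0 : R)).
by exists 0 => v; rewrite normr0 mul0r.
Qed.

Lemma cadmissible_sum n (I : Type) (r : seq I) (F : I -> 'rV[R]_n -> C) :
  (forall i, cadmissible (F i)) -> cadmissible (fun v => \sum_(i <- r) F i v).
Proof.
move=> aF; elim: r => [|i r IH].
  by under eq_fun do rewrite big_nil; split; exact: admissible0.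
by under eq_fun do rewrite big_cons; exact: cadmissibleD.
Qed.

Lemma cintegralD n (F G : 'rV[R]_n -> C) : cadmissible F -> cadmissible G ->
  cintegral_rV (fun v => F v + G v) = cintegral_rV F + cintegral_rV G.
Proof.
move=> [f1 f2] [g1 g2]; rewrite /cintegral_rV.
under eq_fun do rewrite ReD; under [X in (_ +i* integral_rV X)%C]eq_fun do rewrite ImD.
by rewrite !integral_rVD.
Qed.

Lemma cintegralZ n c (F : 'rV[R]_n -> C) : cadmissible F ->
  cintegral_rV (fun v => c * F v) = c * cintegral_rV F.
Proof.
move=> [f1 f2]; rewrite /cintegral_rV.
under eq_fun do rewrite ReM -mulNr; under [X in (_ +i* integral_rV X)%C]eq_fun do rewrite ImM.
rewrite !integral_rVD ?integral_rVZ //; try exact: admissibleZ.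
by case: c => a b; apply/eqP; rewrite eq_complex /= mulNr !eqxx.
Qed.

Lemma cintegral0 n : cintegral_rV (fun _ : 'rV[R]_n => 0 : C) = 0.
Proof.
have E : integral_rV (fun _ : 'rV[R]_n => 0 : R) = 0.
  have := integral_rVZ 0 (admissible0 n); under eq_fun do rewrite mul0r.
  by move=> ->; rewrite mul0r.
by rewrite /cintegral_rV /= E.
Qed.

Lemma cintegral_sum n (I : Type) (r : seq I) (F : I -> 'rV[R]_n -> C) :
  (forall i, cadmissible (F i)) ->
  cintegral_rV (fun v => \sum_(i <- r) F i v) = \sum_(i <- r) cintegral_rV (F i).
Proof.
move=> aF; elim: r => [|i r IH].
  by under eq_fun do rewrite big_nil; rewrite big_nil cintegral0.
under eq_fun do rewrite big_cons; rewrite big_cons cintegralD ?IH //.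
exact: cadmissible_sum.
Qed.

Lemma cadmissible_support n (F : 'rV[R]_n -> C) (r : R) :
  ccontinuous F -> box_support r F -> cadmissible F.
Proof.
by move=> [f1 f2] sF; split; apply: (@admissible_support _ _ _ r) => // v k vk; rewrite (sF v k).
Qed.

Lemma cintegral_along n (w : 'rV[C]_n) (F : 'rV[R]_n -> C) dF (r : R) :
  C1 F dF -> box_support r F -> cintegral_rV (fun y => along w (dF y)) = 0.
Proof.
move=> [[c1 c2] dc dF'] sF.
have h k : cadmissible (fun y => dF y 0 k) /\ cintegral_rV (fun y => dF y 0 k) = 0.
  have [d1 d2] := dc k.
  have [a1 i1] := integral_rV_derive c1 d1 (fun v => (dF' k v).1) (fun v j vj => congr1 (@Re R) (sF v j vj)).
  have [a2 i2] := integral_rV_derive c2 d2 (fun v => (dF' k v).2) (fun v j vj => congr1 (@Im R) (sF v j vj)).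
  by split=> //; rewrite /cintegral_rV i1 i2.
rewrite /along cintegral_sum => [|k]; last exact/cadmissibleZ/(h k).1.
by rewrite big1 // => k _; rewrite cintegralZ ?(h k).2 ?mulr0 //; exact: (h k).1.
Qed.

Definition csmooth n (F : 'rV[R]_n -> C) : Prop :=
  smooth_on setT (fun y => Re (F y)) /\ smooth_on setT (fun y => Im (F y)).

Lemma smooth_onD n (f g : 'rV[R]_n -> R) : smooth_on setT f -> smooth_on setT g ->
  smooth_on setT (fun y => f y + g y).
Proof.
move=> sf sg s.
have E : foldr (fun i h => 'D_('e_i) h) (fun y => f y + g y) s =
    foldr (fun i h => 'D_('e_i) h) f s + foldr (fun i h => 'D_('e_i) h) g s.
  elim: s => [//|i s IH] /=; rewrite IH; apply/funext => x; rewrite deriveD //.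
    exact: (sf s x I).2.
  exact: (sg s x I).2.
rewrite /= E => x _; split.
  by apply: continuousD; [exact: (sf s x I).1|exact: (sg s x I).1].
by move=> i; apply: derivableD; [exact: (sf s x I).2|exact: (sg s x I).2].
Qed.

Lemma smooth_onZ n (c : R) (f : 'rV[R]_n -> R) : smooth_on setT f -> smooth_on setT (fun y => c * f y).
Proof.
move=> sf s.
have E : foldr (fun i h => 'D_('e_i) h) (fun y => c * f y) s =
    c \*: foldr (fun i h => 'D_('e_i) h) f s.
  elim: s => [//|i s IH] /=; rewrite IH; apply/funext => x; rewrite deriveZ //.
  exact: (sf s x I).2.
rewrite /= E => x _; split.
  by apply: continuousZl_tmp; exact: (sf s x I).1.
by move=> i; apply: derivableZ; exact: (sf s x I).2.
Qed.

Lemma csmoothD n (F G : 'rV[R]_n -> C) : csmooth F -> csmooth G -> csmooth (fun y => F y + G y).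
Proof.
move=> [f1 f2] [g1 g2]; split.
  have -> : (fun y => Re (F y + G y)) = (fun y => Re (F y) + Re (G y)) by apply/funext => y; rewrite ReD.
  exact (smooth_onD f1 g1).
have -> : (fun y => Im (F y + G y)) = (fun y => Im (F y) + Im (G y)) by apply/funext => y; rewrite ImD.
exact (smooth_onD f2 g2).
Qed.

Lemma csmoothZ n c (F : 'rV[R]_n -> C) : csmooth F -> csmooth (fun y => c * F y).
Proof.
move=> [f1 f2]; split.
  have -> : (fun y => Re (c * F y)) = (fun y => Re c * Re (F y) + (- Im c) * Im (F y)).
    by apply/funext => y; rewrite ReM mulNr.
  exact (smooth_onD (smooth_onZ _ f1) (smooth_onZ _ f2)).
have -> : (fun y => Im (c * F y)) = (fun y => Re c * Im (F y) + Im c * Re (F y)).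
  by apply/funext => y; rewrite ImM.
exact (smooth_onD (smooth_onZ _ f2) (smooth_onZ _ f1)).
Qed.

Lemma csmooth_cderive n k (F : 'rV[R]_n -> C) : csmooth F -> csmooth (cderive k F).
Proof.
(* In [foldr] the last index of the list is the derivative taken first. *)
by move=> [f1 f2]; split=> s; [have := f1 (rcons s k)|have := f2 (rcons s k)]; rewrite foldr_rcons.
Qed.

Lemma csmooth_C1 n (F : 'rV[R]_n -> C) : csmooth F -> C1 F (fun y => \row_k cderive k F y).
Proof.
have cc (G : 'rV[R]_n -> C) : csmooth G -> ccontinuous G.
  by move=> [g1 g2]; split=> y; [exact: (g1 [::] y I).1|exact: (g2 [::] y I).1].
move=> sF; split=> [|k|k y]; first exact: cc.
  by under eq_fun do rewrite mxE; exact/cc/csmooth_cderive.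
rewrite mxE; have [f1 f2] := sF.
by split; split; [exact: (f1 [::] y I).2|by []|exact: (f2 [::] y I).2|by []].
Qed.

Lemma csmooth_cst0 n : csmooth (fun _ : 'rV[R]_n => 0 : C).
Proof.
have E s : foldr (fun i h => 'D_('e_i) h) (fun _ : 'rV[R]_n => 0 : R) s = cst 0.
  by elim: s => [//|i s IH] /=; rewrite IH; apply/funext => x; rewrite derive_cst.
by split=> s; rewrite /= E => x _; (split; [exact: cst_continuous|move=> ?; exact: derivable_cst]).
Qed.

Lemma box_support_cderive n k (F : 'rV[R]_n -> C) (r : R) : box_support r F -> box_support r (cderive k F).
Proof.
move=> sF v j vj.
have nz : \forall y \near v, F y = 0.
  have o : open [set y : 'rV[R]_n | r < `|y 0 j|].
    have -> : [set y : 'rV[R]_n | r < `|y 0 j|] = (fun y : 'rV[R]_n => `|y 0 j|) @^-1` [set s | r < s] by [].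
    apply: open_comp; last exact: open_gt.
    move=> y _; apply: (@continuous_comp _ _ _ (fun y : 'rV[R]_n => y 0 j)); first exact: coord_continuous.
    exact: norm_continuous.
  have := open_nbhs_nbhs (conj o (vj : [set y : 'rV[R]_n | r < `|y 0 j|] v)).
  by apply: filterS => y; exact: sF.
have e0 : ('e_k : 'rV[R]_n) != 0.
  by apply/eqP => /rowP /(_ k); rewrite !mxE !eqxx => /eqP; rewrite oner_eq0.
rewrite /cderive.
rewrite (@near_eq_derive _ _ _ (fun y => Re (F y)) (cst 0)) //; last by apply: filterS nz => y ->.
rewrite (@near_eq_derive _ _ _ (fun y => Im (F y)) (cst 0)) //; last by apply: filterS nz => y ->.
by rewrite !derive_cst.
Qed.

Definition dalong n (w : 'rV[C]_n) (F : 'rV[R]_n -> C) (y : 'rV[R]_n) : C :=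
  along w (\row_k cderive k F y).

Lemma csmooth_dalong n (w : 'rV[C]_n) (F : 'rV[R]_n -> C) : csmooth F -> csmooth (dalong w F).
Proof.
move=> sF; rewrite /dalong /along; elim: (index_enum _) => [|k r IH].
  by under eq_fun do rewrite big_nil; exact: csmooth_cst0.
under eq_fun do rewrite big_cons mxE.
exact (csmoothD (csmoothZ _ (csmooth_cderive k sF)) IH).
Qed.

Lemma box_support_dalong n (w : 'rV[C]_n) (F : 'rV[R]_n -> C) r :
  box_support r F -> box_support r (dalong w F).
Proof.
move=> sF v j vj; rewrite /dalong /along big1 // => k _.
by rewrite mxE (box_support_cderive k sF vj) mulr0.
Qed.

End ComplexIntegral.

(** * Gaussians on configurations *)

Lemma val_enum_rank (T : finType) (x : T) : val (enum_rank x) = index x (enum T).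
Proof.
rewrite -{2}(nth_enum_rank x x) index_uniq ?enum_uniq //.
by rewrite -cardE; exact: (ltn_ord (enum_rank x)).
Qed.

(** The coordinates of the vertex of index 0 precede all others. This makes a shift by the position
    of that vertex triangular. *)
Lemma mxvec_index_row0 m n (b v : 'I_m) (j k : 'I_n) :
  val b = 0%N -> v != b -> (mxvec_index b j < mxvec_index v k)%N.
Proof.
case: m b v => [[]//|m] b v b0 vb.
have {}b0 : b = ord0 by exact: val_inj.
rewrite /mxvec_index /= !val_enum_rank.
have -> : enum [the finType of ('I_m.+1 * 'I_n)%type] =
   [seq (ord0, j) | j <- enum 'I_n] ++ [seq (i, j) | i <- map (lift ord0) (enum 'I_m), j <- enum 'I_n].
  by rewrite enumT unlock /= /prod_enum enum_ordSl /= enumT.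
have inj1 : (b, j) \in [seq ((ord0 : 'I_m.+1), j) | j <- enum 'I_n].
  by rewrite b0; apply/mapP; exists j; rewrite ?fintype.mem_enum.
have nin : (v, k) \notin [seq ((ord0 : 'I_m.+1), j) | j <- enum 'I_n].
  by apply/mapP => -[j' _ [vE _]]; rewrite b0 vE eqxx in vb.
rewrite !index_cat inj1 (negPf nin); apply: leq_trans (leq_addr _ _).
by rewrite index_mem.
Qed.

Section Laplacian.
Context {R : realType}.

(** If the weighted Laplacian kills X, then each column of D X has weighted square norm zero, and
    positivity of the weights gives D X = 0. This is applied to the cokernel of the Laplacian. *)
Lemma laplacian_row_space m n (D : 'M[R]_(m, n)) (w : 'rV[R]_m) : (forall e, 0 < w 0 e) ->
  (D <= D^T *m diag_mx w *m D)%MS.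
Proof.
move=> w0; rewrite submxE; set X := cokermx _.
have A0 : D^T *m diag_mx w *m D *m X = 0 by rewrite mulmx_coker.
clearbody X.
have B0 : (D *m X)^T *m diag_mx w *m (D *m X) = 0.
  by have := congr1 (mulmx X^T) A0; rewrite mulmx0 trmx_mul !mulmxA.
apply/eqP; move: (D *m X) B0 => Y B0; apply/matrixP => e j; rewrite [RHS]mxE.
have /eqP := congr1 (fun M : 'M[R]_n => M j j) B0.
have E f : (Y^T *m diag_mx w) j f * Y f j = w 0 f * Y f j ^+ 2 by rewrite mul_mx_diag !mxE; ring.
rewrite mxE [X in _ == X]mxE; under eq_bigr do rewrite E.
rewrite psumr_eq0 => [/allP /(_ e (mem_index_enum _))|f _]; last by rewrite mulr_ge0 ?sqr_ge0 // ltW.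
by rewrite /= mulf_eq0 (gt_eqF (w0 e)) sqrf_eq0 => /eqP.
Qed.

End Laplacian.

(** * Edge covectors, the fields d/dz and the exponent of the Gaussian *)

Section GraphGaussian.
Context {R : realType} (d d' : nat) (G : digraph).
Local Notation C := R[i].
Local Notation N := (cdim d d' G).
Local Notation coord v k := (mxvec_index (v : 'I_(nV G)) (k : 'I_(pdim d d'))).

Definition edge_diff (e : 'I_(nE G)) (k : 'I_(pdim d d')) : 'rV[R]_N :=
  'e_(coord (head e) k) - 'e_(coord (tail e) k).

Definition incidence (e : 'I_(nE G)) (v : 'I_(nV G)) : R := (head e == v)%:R - (tail e == v)%:R.

Lemma rlin_delta n (k : 'I_n) (y : 'rV[R]_n) : rlin 'e_k y = y 0 k.
Proof.
rewrite /rlin (bigD1 k) //= mxE !eqxx mul1r big1 ?addr0 // => j jk.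
by rewrite mxE (negPf jk) andbF mul0r.
Qed.

Lemma rlinB n (u v y : 'rV[R]_n) : rlin (u - v) y = rlin u y - rlin v y.
Proof. by rewrite /rlin -sumrB; apply: eq_bigr => k _; rewrite !mxE mulrBl. Qed.

Lemma rlin_edge_diff e k (y : 'rV[R]_N) :
  rlin (edge_diff e k) y = y 0 (coord (head e) k) - y 0 (coord (tail e) k).
Proof. by rewrite rlinB !rlin_delta. Qed.

Local Notation tocomplex := (map_mx (fun a : R => a%:C%C)).

Lemma tocomplexE n (u : 'rV[R]_n) k : tocomplex u 0 k = (u 0 k)%:C%C.
Proof. by rewrite mxE. Qed.

(** Used in two roles: [covector] makes it the one-form dzbar_i of the edge difference, and [clin]
    the function zbar_i of the edge difference. *)
Definition zbar_form (e : 'I_(nE G)) (i : 'I_d) : 'rV[C]_N :=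
  tocomplex (edge_diff e (ire i)) - 'i%C *: tocomplex (edge_diff e (iim i)).

Definition x_form (e : 'I_(nE G)) (j : 'I_d') : 'rV[C]_N := tocomplex (edge_diff e (ix j)).

(** The vector field d/dz_i at the vertex [v]. *)
Definition z_field (v : 'I_(nV G)) (i : 'I_d) : 'rV[C]_N :=
  2^-1 *: ('e_(coord v (ire i)) - 'i%C *: 'e_(coord v (iim i))).

Lemma alongDl n (w w' u : 'rV[C]_n) : along (w + w') u = along w u + along w' u.
Proof. by rewrite /along -big_split; apply: eq_bigr => k _; rewrite mxE mulrDl. Qed.

Lemma alongDr n (w u u' : 'rV[C]_n) : along w (u + u') = along w u + along w u'.
Proof. by rewrite /along -big_split; apply: eq_bigr => k _; rewrite mxE mulrDr. Qed.

Lemma alongZl n c (w u : 'rV[C]_n) : along (c *: w) u = c * along w u.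
Proof. by rewrite /along mulr_sumr; apply: eq_bigr => k _; rewrite mxE mulrA. Qed.

Lemma alongZr n c (w u : 'rV[C]_n) : along w (c *: u) = c * along w u.
Proof. by rewrite /along mulr_sumr; apply: eq_bigr => k _; rewrite mxE mulrCA. Qed.

Lemma along0r n (w : 'rV[C]_n) : along w 0 = 0.
Proof. by rewrite /along big1 // => k _; rewrite mxE mulr0. Qed.

Lemma along0l n (w : 'rV[C]_n) : along 0 w = 0.
Proof. by rewrite /along big1 // => k _; rewrite mxE mul0r. Qed.

Lemma along_sumr n (I : Type) (r : seq I) (F : I -> 'rV[C]_n) w :
  along w (\sum_(i <- r) F i) = \sum_(i <- r) along w (F i).
Proof. by elim/big_rec2: _ => [|i x y _ <-]; rewrite ?along0r ?alongDr. Qed.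

Lemma along_suml n (I : Type) (r : seq I) (F : I -> 'rV[C]_n) u :
  along (\sum_(i <- r) F i) u = \sum_(i <- r) along (F i) u.
Proof. by elim/big_rec2: _ => [|i x y _ <-]; rewrite ?along0l ?alongDl. Qed.

Lemma along_delta n (k : 'I_n) (u : 'rV[C]_n) : along 'e_k u = u 0 k.
Proof.
rewrite /along (bigD1 k) //= mxE !eqxx mul1r big1 ?addr0 // => j jk.
by rewrite mxE (negPf jk) andbF mul0r.
Qed.

Lemma mxvec_index_eq m n (v w : 'I_m) (j k : 'I_n) :
  (mxvec_index v j == mxvec_index w k) = (v == w) && (j == k).
Proof.
apply/eqP/andP => [/cast_ord_inj/enum_rank_inj[-> ->]|[/eqP -> /eqP ->]] //.
Qed.

Lemma edge_diff_coord e k v k' : edge_diff e k 0 (coord v k') = incidence e v * (k == k')%:R.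
Proof.
rewrite /edge_diff /incidence !mxE !eqxx /= ![mxvec_index v _ == _]eq_sym !mxvec_index_eq mulrBl.
by rewrite -!natrM !mulnb.
Qed.

Lemma along_z_field v i e k : along (z_field v i) (tocomplex (edge_diff e k)) =
  2^-1 * (incidence e v)%:C%C * ((k == ire i)%:R - 'i%C * (k == iim i)%:R).
Proof.
rewrite /z_field alongZl alongDl -scaleN1r !alongZl !along_delta !tocomplexE !edge_diff_coord.
rewrite -!mulrA mulN1r; congr (_ * _); rewrite !rmorphM /= mulrBr; congr (_ - _).
  by case: (_ == _); rewrite /= ?mulr1 ?mulr0.
by rewrite mulrCA; congr (_ * _); case: (_ == _); rewrite /= ?mulr1 ?mulr0.
Qed.

Lemma ire_inj (i j : 'I_d) : (ire i == ire j :> 'I_(pdim d d')) = (i == j).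
Proof. by rewrite /ire eq_rshift mxvec_index_eq eqxx andbT. Qed.

Lemma iim_inj (i j : 'I_d) : (iim i == iim j :> 'I_(pdim d d')) = (i == j).
Proof. by rewrite /iim eq_rshift mxvec_index_eq eqxx andbT. Qed.

Lemma ire_iim (i j : 'I_d) : (ire i == iim j :> 'I_(pdim d d')) = false.
Proof. by rewrite /ire /iim eq_rshift mxvec_index_eq andbF. Qed.

Lemma ix_rshift (j : 'I_d') (k : 'I_(d * 2)) : (ix j == rshift d' k :> 'I_(pdim d d')) = false.
Proof. by rewrite /ix eq_lrshift. Qed.

Lemma along_z_field_zbar v i e i' : along (z_field v i) (zbar_form e i') = 0.
Proof.
rewrite /zbar_form alongDr -scaleN1r !alongZr !along_z_field.
rewrite ire_inj ire_iim (eq_sym (iim i')) ire_iim iim_inj.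
have i2 : 'i%C * 'i%C = -1 :> C by rewrite -expr2 sqr_i.
rewrite mulr0 subr0 sub0r; case: (i' == i); rewrite ?mulr0 ?oppr0 ?mulr0 ?addr0 // !mulr1.
by rewrite !mulrN mulN1r opprK mulrCA i2; ring.
Qed.

Lemma along_z_field_x v i e j : along (z_field v i) (x_form e j) = 0.
Proof. by rewrite /x_form along_z_field /ire /iim !ix_rshift mulr0 subr0 mulr0. Qed.

(* Weights of the quadratic form [2 |z|^2 + |x|^2]. *)
Definition weight (k : 'I_(pdim d d')) : R := if fintype.split k is inl _ then 1 else 2.

Lemma weight_ire i : weight (ire i) = 2.
Proof. by rewrite /weight /ire; case: split_ordP => k // /eqP; rewrite eq_rlshift. Qed.

Lemma weight_iim i : weight (iim i) = 2.
Proof. by rewrite /weight /iim; case: split_ordP => k // /eqP; rewrite eq_rlshift. Qed.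

Lemma weight_ix j : weight (ix j) = 1.
Proof. by rewrite /weight /ix; case: split_ordP => k // /eqP; rewrite eq_lrshift. Qed.

Lemma weight_gt0 k : 0 < weight k.
Proof. by rewrite /weight; case: fintype.split. Qed.

Definition edge_gaussian (e : 'I_(nE G)) (t : R) : 'rV[R]_N -> R :=
  gaussian (fun k => weight k / (4 * t)) (edge_diff e).

Definition graph_gaussian (t : 'I_(nE G) -> R) : 'rV[R]_N -> R :=
  gaussian (fun m : 'I_(nE G) * 'I_(pdim d d') => weight m.2 / (4 * t m.1)) (fun m => edge_diff m.1 m.2).

Lemma graph_gaussianE t y : graph_gaussian t y = \prod_e edge_gaussian e (t e) y.
Proof.
rewrite /graph_gaussian /edge_gaussian /gaussian -(pair_bigA _ (fun e k =>
  weight k / (4 * t e) * rlin (edge_diff e k) y ^+ 2)) /= -sumrN.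
by rewrite expR_sum.
Qed.

Lemma clin_zbar e i (y : 'rV[R]_N) : clin (zbar_form e i) y =
  (rlin (edge_diff e (ire i)) y)%:C%C - 'i%C * (rlin (edge_diff e (iim i)) y)%:C%C.
Proof.
rewrite /clin /rlin !rmorph_sum mulr_sumr -sumrB; apply: eq_bigr => k _.
by rewrite !mxE !rmorphM /=; ring.
Qed.

Lemma clin_x e j (y : 'rV[R]_N) : clin (x_form e j) y = (rlin (edge_diff e (ix j)) y)%:C%C.
Proof.
by rewrite /clin /rlin !rmorph_sum; apply: eq_bigr => k _; rewrite !mxE rmorphM.
Qed.

(* The vector on the left is the gradient of the exponent of [edge_gaussian e t]. *)
Lemma along_edge_exponent v i e (t : R) (y : 'rV[R]_N) :
  along (z_field v i) (tocomplex (\sum_k (- (2 * (weight k / (4 * t)) * rlin (edge_diff e k) y)) *: edge_diff e k))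
  = - (incidence e v / (2 * t))%:C%C * clin (zbar_form e i) y.
Proof.
have -> : tocomplex (\sum_k (- (2 * (weight k / (4 * t)) * rlin (edge_diff e k) y)) *: edge_diff e k) =
  \sum_k (- (2 * (weight k / (4 * t)) * rlin (edge_diff e k) y))%:C%C *: tocomplex (edge_diff e k).
  apply/rowP => k; rewrite !mxE summxE rmorph_sum summxE; apply: eq_bigr => m _.
  by rewrite !mxE rmorphM.
rewrite along_sumr; under eq_bigr do rewrite alongZr along_z_field.
have ri : ire i != iim i :> 'I_(pdim d d') by rewrite ire_iim.
rewrite (bigD1 (ire i)) //= (bigD1 (iim i)) //=; last by rewrite eq_sym.
rewrite big1 ?addr0 => [|k /andP[/negPf -> /negPf ->]]; last by rewrite mulr0 subr0 !mulr0.
rewrite !eqxx ire_iim (eq_sym (iim i)) ire_iim weight_ire weight_iim clin_zbar mulr0 subr0 sub0r !mulr1.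
have E a : (- (2 * (2 / (4 * t)) * a))%:C%C = - (t^-1)%:C%C * a%:C%C :> C.
  rewrite mulNr -rmorphM -rmorphN /=; congr (_%:C)%C.
  have [->|t0] := eqVneq t 0; first by rewrite mulr0 invr0 !(mulr0, mul0r) oppr0.
  by field.
rewrite !E; have -> : (incidence e v / (2 * t))%:C%C = 2^-1 * (incidence e v)%:C%C * (t^-1)%:C%C :> C.
  rewrite invfM mulrA rmorphM rmorphM /=; congr (_ * _); rewrite mulrC; congr (_ * _).
  by rewrite fmorphV rmorph_nat.
by ring.
Qed.

End GraphGaussian.

(** * Trading zbar factors for derivatives of the test function *)

Section GaussianByParts.
Context {R : realType} (d d' : nat) (G : digraph).
Local Notation C := R[i].
Local Notation N := (cdim d d' G).
Local Notation coord v k := (mxvec_index (v : 'I_(nV G)) (k : 'I_(pdim d d'))).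
Local Notation tocomplex := (map_mx (fun a : R => a%:C%C)).

(** The gradient of the exponent of [graph_gaussian t]. *)
Definition exponent_grad (t : 'I_(nE G) -> R) (y : 'rV[R]_N) : 'rV[C]_N :=
  tocomplex (\sum_(m : 'I_(nE G) * 'I_(pdim d d'))
    (- (2 * (weight m.2 / (4 * t m.1)) * rlin (edge_diff m.1 m.2) y)) *: edge_diff m.1 m.2).

Lemma C1_graph_gaussian (t : 'I_(nE G) -> R) :
  C1 (fun y => (graph_gaussian t y)%:C%C : C)
     (fun y : 'rV[R]_N => (graph_gaussian t y)%:C%C *: exponent_grad t y).
Proof. exact: C1_gaussian. Qed.

Lemma exponent_gradZ (t : 'I_(nE G) -> R) s y :
  exponent_grad (fun e => s * t e) y = (s^-1)%:C%C *: exponent_grad t y.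
Proof.
apply/rowP => k; rewrite [RHS]mxE ![map_mx _ _ _ _]mxE -rmorphM; congr (_%:C)%C.
rewrite !summxE mulr_sumr; apply: eq_bigr => m _; rewrite ![(_ *: edge_diff _ _) _ _]mxE [RHS]mulrA; congr (_ * _).
by rewrite !invfM; ring.
Qed.

Lemma along_exponent_grad v i (t : 'I_(nE G) -> R) (y : 'rV[R]_N) :
  along (z_field d' v i) (exponent_grad t y) =
  \sum_e - (incidence e v / (2 * t e))%:C%C * clin (zbar_form d' e i) y.
Proof.
rewrite /exponent_grad -(pair_bigA _ (fun e k =>
  (- (2 * (weight k / (4 * t e)) * rlin (edge_diff e k) y)) *: edge_diff e k)) /=.
rewrite raddf_sum along_sumr; apply: eq_bigr => e _; exact: along_edge_exponent.
Qed.

Definition zvertex (v : 'I_(nV G)) (i : 'I_d) (y : 'rV[R]_N) : C :=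
  (y 0 (coord v (ire i)))%:C%C - 'i%C * (y 0 (coord v (iim i)))%:C%C.

Lemma clin_zbar_vertex e i (y : 'rV[R]_N) :
  clin (zbar_form d' e i) y = \sum_v (incidence e v)%:C%C * zvertex v i y.
Proof.
rewrite clin_zbar !rlin_edge_diff /incidence.
under eq_bigr do rewrite rmorphB mulrBl.
have pick w : \sum_v ((w == v)%:R : R)%:C%C * zvertex v i y = zvertex w i y.
  rewrite (bigD1 w) //= eqxx mul1r big1 ?addr0 // => v; rewrite eq_sym => /negPf ->.
  by rewrite mul0r.
by rewrite sumrB !pick /zvertex !rmorphB /=; ring.
Qed.

(* The derivatives of the exponent along the [d/dz_i] at the vertices are the weighted Laplacian
   applied to the [zbar] of the vertices, and its rows span the differences [zbar_e]. *)
Lemma zbar_field_exists (t : 'I_(nE G) -> R) : (forall e, 0 < t e) ->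
  exists w : 'I_(nE G) -> 'I_d -> 'rV[C]_N,
   [/\ forall e i y, along (w e i) (exponent_grad t y) = clin (zbar_form d' e i) y,
       forall e i e' i', along (w e i) (zbar_form d' e' i') = 0 &
       forall e i e' j, along (w e i) (x_form d e' j) = 0].
Proof.
move=> t0; pose D : 'M[R]_(nE G, nV G) := \matrix_(e, v) incidence e v.
have /submxP[c cE] : (D <= D^T *m diag_mx (\row_e (t e)^-1) *m D)%MS.
  by apply: laplacian_row_space => e; rewrite mxE invr_gt0.
(* The derivative of the exponent carries the factor -1 / (2 t). The coefficient -2 [c] cancels it
   and leaves the row [e] of [c] times the Laplacian with weights 1 / t, which is the row [e] of
   [D]. *)
exists (fun e i => \sum_v (-2 * c e v)%:C%C *: z_field d' v i); split=> [e i y|e i e' i'|e i e' j].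
- rewrite along_suml clin_zbar_vertex.
  under eq_bigr do rewrite alongZl along_exponent_grad.
  transitivity (\sum_v \sum_f \sum_u (c e v * (incidence f v * (t f)^-1 * incidence f u))%:C%C * zvertex u i y).
    apply: eq_bigr => v _; rewrite mulr_sumr; apply: eq_bigr => f _.
    rewrite clin_zbar_vertex mulrA mulr_sumr; apply: eq_bigr => u _.
    rewrite mulrA; congr (_ * _); rewrite mulrN -rmorphM -rmorphN -rmorphM; congr (_%:C)%C.
    by have := t0 f => /gt_eqF/negbT tf; field.
  under eq_bigr do rewrite exchange_big /=.
  rewrite exchange_big /=; apply: eq_bigr => u _.
  under eq_bigr do rewrite -mulr_suml; rewrite -mulr_suml; congr (_ * _).
  under eq_bigr do rewrite -rmorph_sum; rewrite -rmorph_sum; congr (_%:C)%C.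
  have -> : incidence e u = (c *m (D^T *m diag_mx (\row_e (t e)^-1) *m D)) e u by rewrite -cE mxE.
  rewrite mxE; apply: eq_bigr => v _; rewrite -mulr_sumr; congr (_ * _).
  by rewrite mxE; apply: eq_bigr => f _; rewrite mul_mx_diag !mxE.
- by rewrite along_suml big1 // => v _; rewrite alongZl along_z_field_zbar mulr0.
- by rewrite along_suml big1 // => v _; rewrite alongZl along_z_field_x mulr0.
Qed.

Lemma C1_prod_annihilated n (w : 'rV[C]_n) (I : Type) (s : seq I) (u : I -> 'rV[C]_n) :
  (forall i, along w (u i) = 0) ->
  exists2 dP, C1 (fun y => \prod_(i <- s) clin (u i) y) dP & forall y, along w (dP y) = 0.
Proof.
move=> wu; elim: s => [|i s [dP cP wP]].
  exists (fun=> 0) => [|y]; last exact: along0r.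
  by under eq_fun do rewrite big_nil; exact: C1_cst.
eexists; first by under eq_fun do rewrite big_cons; apply: C1M; [exact: C1_clin|exact: cP].
by move=> y /=; rewrite alongDr !alongZr wu wP !mulr0 addr0.
Qed.

Lemma ccontinuous_prod_clin n (I : Type) (s : seq I) (u : I -> 'rV[C]_n) :
  ccontinuous (fun y => \prod_(i <- s) clin (u i) y).
Proof.
(* Along the zero vector the annihilation condition is automatic, and the continuity remains. *)
by have [dP [cP _ _] _] := @C1_prod_annihilated n 0 I s u (fun i => along0l _).
Qed.

(** A factor zbar times the Gaussian is [s] times the derivative of the Gaussian along a constant
    field [w e i], which kills the remaining zbar and x. Integration by parts therefore moves the
    derivative onto [phi] at the price of - [s]. The exponent gradient scales by 1 / [s], so the
    fields found for [t] serve every [s]; this gives a [psi] independent of [s], as the limit rho ->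
    0 requires. *)
Lemma cintegral_zbar (t : 'I_(nE G) -> R) (L : seq ('I_(nE G) * 'I_d)) (r : R) (phi : 'rV[R]_N -> C) :
  (forall e, 0 < t e) -> csmooth phi -> box_support r phi ->
  exists psi, [/\ csmooth psi, box_support r psi &
    forall (J : seq ('I_(nE G) * 'I_d')) (s : R), 0 < s ->
     cintegral_rV (fun y => \prod_(l <- L) clin (zbar_form d' l.1 l.2) y * \prod_(l <- J) clin (x_form d l.1 l.2) y *
        (graph_gaussian (fun e => s * t e) y)%:C%C * phi y) =
     ((- s)%:C%C) ^+ size L * cintegral_rV (fun y => \prod_(l <- J) clin (x_form d l.1 l.2) y *
        (graph_gaussian (fun e => s * t e) y)%:C%C * psi y)].
Proof.
move=> t0; have [w [wE wz wx]] := zbar_field_exists t0.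
elim: L phi => [|[e i] L IH] phi sphi bphi.
  exists phi; split=> // J s s0; rewrite expr0 mul1r; congr cintegral_rV.
  by apply/funext => y; rewrite big_nil mul1r.
have [psi [spsi bpsi E]] := IH (dalong (w e i) phi) (csmooth_dalong _ sphi) (box_support_dalong _ bphi).
exists psi; split=> // J s s0; rewrite /= exprSr -mulrA -mulrCA -E //.
set gs := graph_gaussian _.
have [dP cP wP] := C1_prod_annihilated L (u := fun l => zbar_form d' l.1 l.2) (fun l => wz e i l.1 l.2).
have [dQ cQ wQ] := C1_prod_annihilated J (u := fun l => x_form d l.1 l.2) (fun l => wx e i l.1 l.2).
have cF := C1M (C1M (C1M cP cQ) (C1_graph_gaussian (fun e => s * t e))) (csmooth_C1 sphi).
have bF : box_support r (fun y => \prod_(l <- L) clin (zbar_form d' l.1 l.2) y *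
    \prod_(l <- J) clin (x_form d l.1 l.2) y * (gs y)%:C%C * phi y).
  by move=> v k vk; rewrite (bphi v k) // mulr0.
have := cintegral_along (w e i) cF bF.
pose P y := \prod_(l <- L) clin (zbar_form d' l.1 l.2) y * \prod_(l <- J) clin (x_form d l.1 l.2) y * (gs y)%:C%C : C.
under eq_fun => y.
  rewrite !(alongDr, alongZr) wP wQ exponent_gradZ alongZr wE !(mulr0, addr0, add0r).
  rewrite (_ : _ + _ = (s^-1)%:C%C * (clin (zbar_form d' e i) y * P y * phi y) + P y * dalong (w e i) phi y); last first.
    by rewrite /P /dalong -/gs; ring.
  over.
have cg : ccontinuous (fun y => (gs y)%:C%C) by exact: C1_cont (C1_graph_gaussian _).
have ccP : ccontinuous P.
  by apply: ccontinuousM => //; apply: ccontinuousM; exact: ccontinuous_prod_clin.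
have a1 : cadmissible (fun y => clin (zbar_form d' e i) y * P y * phi y).
  apply: (@cadmissible_support _ _ _ r); last by move=> v k vk; rewrite (bphi v k) // mulr0.
  apply: ccontinuousM; last exact: C1_cont (csmooth_C1 sphi).
  by apply: ccontinuousM => //; exact: C1_cont (C1_clin _).
have a2 : cadmissible (fun y => P y * dalong (w e i) phi y).
  apply: (@cadmissible_support _ _ _ r).
    by apply: ccontinuousM => //; exact: C1_cont (csmooth_C1 (csmooth_dalong _ sphi)).
  by move=> v k vk; rewrite (box_support_dalong _ bphi vk) mulr0.
rewrite cintegralD //; last exact: cadmissibleZ.
rewrite cintegralZ // => /eqP; rewrite addr_eq0 => /eqP E1.
rewrite -[cintegral_rV (fun y => _ * dalong _ _ _)]opprK -E1 rmorphN mulrNN mulrA -rmorphM divff ?gt_eqF // mul1r.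
congr cintegral_rV; apply/funext => y; rewrite big_cons /P; ring.
Qed.

End GaussianByParts.

(** * The rescaling limit *)

Section PolynomialGaussianBound.
Context {R : realType}.

(** For p > 0 and x = q / p, the p-th root of the claim follows from 1 + K p x <= (1 + K p) (1 + x)
    and 1 + x <= e^x. The division by p is why p = 0 is treated apart. *)
Lemma poly_exp_bounded (K : R) (p : nat) : 0 <= K ->
  exists2 C, 0 <= C & forall q, 0 <= q -> (1 + K * q) ^+ p * expR (- q) <= C.
Proof.
move=> K0; case: p => [|p].
  by exists 1 => // q q0; rewrite expr0 mul1r expR_le1 oppr_le0.
have p0 : 0 < p.+1%:R :> R by rewrite ltr0n.
have Kp : 0 <= 1 + K * p.+1%:R by rewrite addr_ge0 // mulr_ge0 // ltW.
exists ((1 + K * p.+1%:R) ^+ p.+1) => [|q q0]; first exact: exprn_ge0.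
rewrite expRN ler_pdivrMr ?expR_gt0 //.
have -> : q = p.+1%:R * (q / p.+1%:R) by rewrite mulrC divfK // gt_eqF.
rewrite expRM_natl -exprMn; apply: lerXn2r; rewrite ?nnegrE.
- by rewrite addr_ge0 // mulr_ge0 // mulr_ge0 ?divr_ge0 // ltW.
- by rewrite mulr_ge0 // expR_ge0.
have := expR_ge1Dx (q / p.+1%:R); set x := q / _ => hx.
have x0 : 0 <= x by rewrite divr_ge0 // ltW.
apply: le_trans (_ : (1 + K * p.+1%:R) * (1 + x) <= _); last exact: ler_wpM2l.
rewrite -subr_ge0 (_ : _ - _ = x + K * p.+1%:R); last by ring.
by rewrite addr_ge0 // mulr_ge0 // ltW.
Qed.

End PolynomialGaussianBound.

Lemma big_mxvec (T : Type) (idx : T) (op : Monoid.com_law idx) m n (F : 'I_(m * n) -> T) :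
  \big[op/idx]_k F k = \big[op/idx]_i \big[op/idx]_j F (mxvec_index i j).
Proof.
rewrite pair_bigA (reindex _ (curry_mxvec_bij m n)) /=.
by apply: eq_bigr => -[i j] _.
Qed.

(** * Scaling of the offsets from a base vertex *)

Section Dilation.
Context {R : realType} (d d' : nat) (G : digraph).
Local Notation C := R[i].
Local Notation N := (cdim d d' G).
Local Notation coord v k := (mxvec_index (v : 'I_(nV G)) (k : 'I_(pdim d d'))).
Local Notation xmono J := (fun y : 'rV[R]_N => \prod_(l <- J) rlin (edge_diff l.1 (ix l.2)) y).

Lemma rV_coordP (y z : 'rV[R]_N) : (forall v k, y 0 (coord v k) = z 0 (coord v k)) -> y = z.
Proof. by move=> h; apply/rowP => k; case/mxvec_indexP: k => v k; exact: h. Qed.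

Context (b : 'I_(nV G)).

(* A vector [y] is also read as the position of [b] together with the offsets from [b] of the
   other vertices: [dilation rho] gives the positions for the offsets scaled by [rho]. *)
Definition relative (y : 'rV[R]_N) : 'rV[R]_N :=
  mxvec (\matrix_(v, k) if v == b then 0 else y 0 (coord v k)).

Definition dilation (rho : R) (y : 'rV[R]_N) : 'rV[R]_N :=
  mxvec (\matrix_(v, k) (rho * relative y 0 (coord v k) + y 0 (coord b k))).

Lemma relativeE y v k : relative y 0 (coord v k) = if v == b then 0 else y 0 (coord v k).
Proof. by rewrite mxvecE mxE. Qed.

Lemma dilationE rho y v k :
  dilation rho y 0 (coord v k) = rho * relative y 0 (coord v k) + y 0 (coord b k).
Proof. by rewrite mxvecE mxE. Qed.

Lemma rlin_dilation rho y e k : rlin (edge_diff e k) (dilation rho y) = rho * rlin (edge_diff e k) (relative y).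
Proof. by rewrite !rlin_edge_diff !dilationE; ring. Qed.

Lemma xmono_dilation (J : seq ('I_(nE G) * 'I_d')) rho y :
  xmono J (dilation rho y) = rho ^+ size J * xmono J (relative y).
Proof.
elim: J => [|l J IH]; first by rewrite !big_nil expr0 mul1r.
by rewrite !big_cons /= IH rlin_dilation exprS; ring.
Qed.

Lemma graph_gaussian_dilation (t : 'I_(nE G) -> R) rho y : rho != 0 ->
  graph_gaussian (fun e => rho ^+ 2 * t e) (dilation rho y) = graph_gaussian t (relative y).
Proof.
move=> r0; congr (expR (- _)); apply: eq_bigr => m _.
rewrite rlin_dilation exprMn (mulrA (weight _ / _)); congr (_ * _).
have r2 : rho ^+ 2 != 0 by rewrite expf_neq0.
have -> : 4 * (rho ^+ 2 * t m.1) = rho ^+ 2 * (4 * t m.1) by ring.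
rewrite invfM; by move: (4 * t m.1)^-1 => a; rewrite -!mulrA; congr (_ * _); rewrite mulrCA mulVf ?mulr1.
Qed.

Lemma continuous_relative : continuous relative.
Proof.
apply: continuous_mx => i j; rewrite (ord1 i); case/mxvec_indexP: j => v k.
under eq_fun do rewrite relativeE; case: (v == b); first exact: (@cst_continuous _ _ (0 : R)).
by move=> ?; exact: coord_continuous.
Qed.

Lemma continuous_dilation rho : continuous (dilation rho).
Proof.
apply: continuous_mx => i j; rewrite (ord1 i); case/mxvec_indexP: j => v k.
under eq_fun do rewrite dilationE; apply: continuous_addr; last by move=> ?; exact: coord_continuous.
apply: continuous_mulr; first exact: (@cst_continuous _ _ rho).
move=> y; apply: (@continuous_comp _ _ _ relative (fun z : 'rV[R]_N => z 0 (coord v k))).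
  exact: continuous_relative.
exact: coord_continuous.
Qed.

Lemma continuous_xmono (J : seq ('I_(nE G) * 'I_d')) : continuous (xmono J).
Proof. by apply: continuous_prodr => l; exact: continuous_rlin. Qed.

(** The offset vanishes at [b] and changes by at most [u] along an edge, and a path without repeated
    vertices from [b] to [v] has fewer edges than the graph has vertices. *)
Lemma relative_path_bound (u : R) (y : 'rV[R]_N) k :
  0 <= u -> connected_graph G -> (forall e, `|rlin (edge_diff e k) (relative y)| <= u) ->
  forall v, `|relative y 0 (coord v k)| <= (nV G)%:R * u.
Proof.
move=> u0 [_ conn] hu v; have /connectP[p0 pp0 ->] := conn b v.
case: (shortenP pp0) => p pp up _.
have nu : forall x p, path (@adjacent G) x p ->
    `|relative y 0 (coord (last x p) k)| <= `|relative y 0 (coord x k)| + (size p)%:R * u.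
  move=> x q; elim: q x => [|w q IH] x /=; first by rewrite mul0r addr0.
  move=> /andP[/existsP[e ew] /IH h]; apply: le_trans h _.
  have : `|relative y 0 (coord w k) - relative y 0 (coord x k)| <= u.
    have := hu e; rewrite rlin_edge_diff; case/orP: ew => /andP[/eqP -> /eqP ->] //.
    by rewrite distrC.
  have := lerB_dist (relative y 0 (coord w k)) (relative y 0 (coord x k)).
  rewrite -[(size q).+1]addn1 natrD mulrDl mul1r; lra.
have r0 : relative y 0 (coord b k) = 0 by rewrite relativeE eqxx.
have := nu b p pp; rewrite r0 normr0 add0r => h; apply: le_trans h _.
rewrite ler_wpM2r // ler_nat; have := card_uniqP up => /= cp.
by apply: ltnW; rewrite -cp -[X in (_ <= X)%N]card_ord; exact: max_card.
Qed.

(** The majorant for the rescaling limit. The cutoff function confines only the base vertex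
    uniformly in rho, so decay in the offsets must come from the Gaussian: in a connected graph its
    exponent [q] dominates the square of every offset, hence the monomial and the inverse of [decay]
    are polynomially bounded in [q]. *)
Lemma integrand_bound (t : 'I_(nE G) -> R) (J : seq ('I_(nE G) * 'I_d')) (r : R) :
  connected_graph G -> (forall e, 0 < t e) ->
  exists2 D, 0 <= D & forall y : 'rV[R]_N, (forall k, `|y 0 (coord b k)| <= r) ->
    `|xmono J (relative y) * graph_gaussian t (relative y)| <= D * decay y.
Proof.
move=> conn t0.
pose c (m : 'I_(nE G) * 'I_(pdim d d')) : R := weight m.2 / (4 * t m.1).
have c0 m : 0 < c m by rewrite divr_gt0 ?weight_gt0 // mulr_gt0.
pose K := \sum_m (c m)^-1.
have K0 : 0 <= K by apply: sumr_ge0 => m _; rewrite invr_ge0 ltW.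
pose q (y : 'rV[R]_N) := \sum_m c m * rlin (edge_diff m.1 m.2) (relative y) ^+ 2.
have q_ge y m : c m * rlin (edge_diff m.1 m.2) (relative y) ^+ 2 <= q y.
  by rewrite /q (bigD1 m) //= lerDl; apply: sumr_ge0 => i _; rewrite mulr_ge0 ?sqr_ge0 // ltW.
have q0 y : 0 <= q y by apply: sumr_ge0 => i _; rewrite mulr_ge0 ?sqr_ge0 // ltW.
have edge_bound y e k : `|rlin (edge_diff e k) (relative y)| <= Num.sqrt (K * q y).
  rewrite -sqrtr_sqr ler_wsqrtr //; have := q_ge y (e, k).
  rewrite mulrC -ler_pdivlMr ?c0 // => /le_trans; apply; rewrite mulrC ler_wpM2r //.
  by rewrite /K (bigD1 (e, k)) //= lerDl; apply: sumr_ge0 => i _; rewrite invr_ge0 ltW.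
(* The square of |V| comes from the path bound. The added 1 makes K <= K1, so the same constant
   bounds edge differences and offsets. *)
pose n2 : R := (nV G)%:R ^+ 2 + 1.
pose K1 := n2 * K.
have n20 : 1 <= n2 by rewrite lerDr sqr_ge0.
have n2ge0 : 0 <= n2 by rewrite (le_trans _ n20).
have K10 : 0 <= K1 by rewrite mulr_ge0.
have coord_bound y v k : relative y 0 (coord v k) ^+ 2 <= K1 * q y.
  have := relative_path_bound (sqrtr_ge0 _) conn (fun e => edge_bound y e k) v.
  rewrite -(real_normK (num_real (relative y 0 _))) => h.
  apply: le_trans (_ : ((nV G)%:R * Num.sqrt (K * q y)) ^+ 2 <= _).
    by apply: lerXn2r; rewrite ?nnegrE // mulr_ge0 // sqrtr_ge0.
  rewrite exprMn sqr_sqrtr ?mulr_ge0 // /K1 -mulrA ler_wpM2r ?mulr_ge0 //.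
  by rewrite /n2 lerDl.
have mono_bound y : `|xmono J (relative y)| <= (1 + K1 * q y) ^+ size J.
  have h0 : 0 <= 1 + K1 * q y by rewrite addr_ge0 // mulr_ge0.
  elim: J => [|l J IH]; first by rewrite big_nil normr1 expr0.
  rewrite big_cons normrM exprS; apply: ler_pM => //.
  apply: le_trans (edge_bound y l.1 (ix l.2)) _.
  rewrite -[leRHS](ger0_norm h0) -sqrtr_sqr ler_wsqrtr //.
  have Kq : K * q y <= K1 * q y by rewrite ler_wpM2r // /K1 ler_peMl.
  apply: le_trans Kq _; have : 0 <= K1 * q y by rewrite mulr_ge0.
  set a := K1 * q y => a0; rewrite sqrrD expr1n mul1r mulr2n -!addrA.
  by have := sqr_ge0 a; lra.
(* The inverse of [decay y] is a product of factors 1 + y_k^2, at most 1 + r^2 at the base vertex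
   and at most 1 + K1 q at the others. *)
have decay_bound (y : 'rV[R]_N) : (forall k, `|y 0 (coord b k)| <= r) ->
    1 <= (1 + r ^+ 2) ^+ N * (1 + K1 * q y) ^+ N * decay y.
  move=> yb; rewrite -exprMn /decay.
  have -> : ((1 + r ^+ 2) * (1 + K1 * q y)) ^+ N = \prod_(k < N) ((1 + r ^+ 2) * (1 + K1 * q y)).
    by rewrite prodr_const card_ord.
  rewrite -big_split /=; elim/big_rec: _ => // k x _ hx; apply: mulr_ege1 => //.
  case/mxvec_indexP: k => v k; rewrite ler_pdivlMr ?ltr_pwDl ?sqr_ge0 // mul1r.
  have r1 : 1 <= 1 + r ^+ 2 by rewrite lerDl sqr_ge0.
  have q1 : 1 <= 1 + K1 * q y by rewrite lerDl mulr_ge0.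
  have [vb|vb] := eqVneq v b.
    apply: le_trans (_ : 1 + r ^+ 2 <= _); last by rewrite ler_peMr // (le_trans _ r1).
    rewrite vb lerD2l -(real_normK (num_real (y 0 _))) ler_sqr ?nnegrE //.
    by rewrite (le_trans _ (yb k)).
  apply: le_trans (_ : 1 + K1 * q y <= _); last by rewrite ler_peMl // (le_trans _ q1).
  by rewrite lerD2l; have := coord_bound y v k; rewrite relativeE (negPf vb).
have [D D0 bD] := poly_exp_bounded (size J + N) K10.
have r0 : 0 <= (1 + r ^+ 2) ^+ N by rewrite exprn_ge0 // addr_ge0 // sqr_ge0.
exists ((1 + r ^+ 2) ^+ N * D) => [|y yb]; first exact: mulr_ge0.
have ge : graph_gaussian t (relative y) = expR (- q y) by [].
rewrite normrM ge (ger0_norm (expR_ge0 _)).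
have e0 := expR_ge0 (- q y).
have d0 := ltW (decay_gt0 y).
have h0 : 0 <= 1 + K1 * q y by rewrite addr_ge0 // mulr_ge0.
apply: le_trans (_ : (1 + K1 * q y) ^+ size J * expR (- q y) <= _); first exact: ler_wpM2r.
apply: le_trans (_ : (1 + K1 * q y) ^+ size J * expR (- q y) *
   ((1 + r ^+ 2) ^+ N * (1 + K1 * q y) ^+ N * decay y) <= _).
  by rewrite ler_peMr ?decay_bound // mulr_ge0 // exprn_ge0.
rewrite (_ : _ * _ = (1 + r ^+ 2) ^+ N * ((1 + K1 * q y) ^+ (size J + N) * expR (- q y)) * decay y).
  by rewrite ler_wpM2r // ler_wpM2l // bD.
by rewrite exprD; ring.
Qed.

End Dilation.

(** * Dilation, reflection and the odd Gaussian moment *)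

Section RescalingLimit.
Context {R : realType} (d d' : nat) (G : digraph).
Local Notation N := (cdim d d' G).
Local Notation coord v k := (mxvec_index (v : 'I_(nV G)) (k : 'I_(pdim d d'))).
Local Notation xmono J := (fun y : 'rV[R]_N => \prod_(l <- J) rlin (edge_diff l.1 (ix l.2)) y).

(** The dilation shifts every other vertex by the position of [b], which is triangular because [b]
    has index 0. Its diagonal is 1 at [b] and [rho] at the other |V| - 1 vertices. *)
Lemma dilation_integral (b : 'I_(nV G)) (rho : R) (f : 'rV[R]_N -> R) :
  val b = 0%N -> 0 < rho -> admissible f ->
  rho ^+ ((nV G).-1 * pdim d d') * integral_rV (f \o dilation b rho) = integral_rV f.
Proof.
move=> b0 rho0 af.
pose l : 'I_N -> R := mxvec (\matrix_(v < nV G, k < pdim d d') (if v == b then 1 else rho)) 0.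
pose tau (i : 'I_N) (y : 'rV[R]_N) : R :=
  mxvec (\matrix_(v, k) (if v == b then 0 else y 0 (coord b k))) 0 i.
rewrite -(@integral_rV_triangular _ _ (dilation b rho) l tau f) //.
- congr (_ * _); rewrite big_mxvec (bigD1 b) //= big1 ?mul1r => [|k _]; last first.
    by rewrite /l mxvecE mxE eqxx normr1.
  rewrite (eq_bigr (fun=> rho ^+ pdim d d')) => [|v vb].
    by rewrite prodr_const cardC1 card_ord -exprM mulnC.
  rewrite (eq_bigr (fun=> rho)) => [|k _]; first by rewrite prodr_const card_ord.
  by rewrite /l mxvecE mxE (negPf vb) gtr0_norm.
- move=> i y; case/mxvec_indexP: i => v k; rewrite dilationE relativeE /l /tau !mxvecE !mxE.
  by have [->|_] := eqVneq v b; rewrite ?mulr0 ?mul1r ?add0r ?addr0.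
- move=> i y y'; case/mxvec_indexP: i => v k yy'; rewrite /tau !mxvecE !mxE.
  by have [//|vb] := eqVneq v b; apply: yy'; exact: mxvec_index_row0.
- move=> i; case/mxvec_indexP: i => v k; rewrite /l mxvecE mxE.
  by case: (v == b); rewrite ?oner_neq0 // gt_eqF.
Qed.

(* It reverses [x_j] of all offsets from [b]: the Gaussian is invariant, and a monomial of odd
   degree in the differences [x_j] changes sign. *)
Definition reflection (b : 'I_(nV G)) (j : 'I_d') (y : 'rV[R]_N) : 'rV[R]_N :=
  mxvec (\matrix_(v, k) ((-1) ^+ ((v != b) && (k == ix j)) * y 0 (coord v k))).

Lemma reflectionE b j y v k :
  reflection b j y 0 (coord v k) = (-1) ^+ ((v != b) && (k == ix j)) * y 0 (coord v k).
Proof. by rewrite mxvecE mxE. Qed.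

Lemma reflection_integral b j (f : 'rV[R]_N -> R) : admissible f ->
  integral_rV (f \o reflection b j) = integral_rV f.
Proof.
move=> af; pose l : 'I_N -> R :=
  mxvec (\matrix_(v < nV G, k < pdim d d') ((-1) ^+ ((v != b) && (k == ix j)))) 0.
rewrite -(@integral_rV_triangular _ _ (reflection b j) l (fun _ _ => 0) f) //.
- rewrite big_mxvec big1 ?mul1r // => v _; rewrite big1 // => k _.
  by rewrite /l mxvecE mxE normrX normrN normr1 expr1n.
- by move=> i y; case/mxvec_indexP: i => v k; rewrite reflectionE /l mxvecE mxE addr0.
- by move=> i; case/mxvec_indexP: i => v k; rewrite /l mxvecE mxE signr_eq0.
Qed.

Lemma relative_reflection b j y e k : rlin (edge_diff e k) (relative b (reflection b j y)) =
  (-1) ^+ (k == ix j) * rlin (edge_diff e k) (relative b y).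
Proof.
rewrite !rlin_edge_diff mulrBr; congr (_ - _).
  rewrite !relativeE; case: (eqVneq (head e) b) => [_|hb]; first by rewrite mulr0.
  by rewrite reflectionE hb.
rewrite !relativeE; case: (eqVneq (tail e) b) => [_|hb]; first by rewrite mulr0.
by rewrite reflectionE hb.
Qed.

Lemma ix_inj (i j : 'I_d') : (ix i == ix j :> 'I_(pdim d d')) = (i == j).
Proof. by rewrite /ix eq_lshift. Qed.

(** The prefactor cancels one power of rho for each factor of the monomial and the Jacobian of the
    dilation. Then rho survives only inside [g], and [H s] is the rescaled integrand for rho = s,
    defined also at s = 0. *)
Lemma rescaling_limit (t : 'I_(nE G) -> R) (J : seq ('I_(nE G) * 'I_d')) (j : 'I_d')
    (g : 'rV[R]_N -> R) (r : R) (rho : nat -> R) :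
  connected_graph G -> (forall e, 0 < t e) -> odd (count (fun l => l.2 == j) J) ->
  continuous g -> box_support r g -> (forall k, 0 < rho k) -> rho @ \oo --> (0 : R) ->
  (fun k => (rho k)^-1 ^+ (size J + (nV G).-1 * pdim d d') *
     integral_rV (fun y => xmono J y * graph_gaussian (fun e => rho k ^+ 2 * t e) y * g y))
    @ \oo --> (0 : R).
Proof.
move=> conn t0 oddJ cg sg rho0 rhol.
have nV0 : (0 < nV G)%N by case: conn.
pose b := Ordinal nV0.
pose K (y : 'rV[R]_N) := xmono J (relative b y) * graph_gaussian t (relative b y).
have cK : continuous K.
  apply: continuous_mulr => y.
    by apply: (@continuous_comp _ _ _ (relative b) (xmono J)); [exact: continuous_relative|exact: continuous_xmono].
  by apply: (@continuous_comp _ _ _ (relative b) (graph_gaussian t)); [exact: continuous_relative|exact: continuous_gaussian].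
have cgd s : continuous (fun y => g (dilation b s y)).
  by move=> y; apply: (@continuous_comp _ _ _ (dilation b s) g); [exact: continuous_dilation|exact: cg].
pose H s (y : 'rV[R]_N) := K y * g (dilation b s y).
have cH s : continuous (H s) by exact: continuous_mulr.
have [M M0 bM] := bounded_on_box r cg.
have gM v : `|g v| <= M.
  have [bv|] := pselect (forall k, `|v 0 k| <= r); first exact: bM.
  by move=> /existsNP[k /negP]; rewrite -ltNge => /sg ->; rewrite normr0.
have [D D0 bD] := @integrand_bound R d d' G b t J r conn t0.
have bH s y : `|H s y| <= D * M * decay y.
  have [yb|] := pselect (forall k, `|y 0 (coord b k)| <= r).
    by rewrite normrM mulrAC; apply: ler_pM => //; exact: bD.
  move=> /existsNP[k /negP]; rewrite -ltNge => yk.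
  rewrite /H (sg _ (coord b k)); last by rewrite dilationE relativeE eqxx mulr0 add0r.
  by rewrite mulr0 normr0 !mulr_ge0 // ltW // decay_gt0.
have aH s : admissible (H s) by split=> //; exists (D * M).
have EH k : (rho k)^-1 ^+ (size J + (nV G).-1 * pdim d d') *
    integral_rV (fun y => xmono J y * graph_gaussian (fun e => rho k ^+ 2 * t e) y * g y) = integral_rV (H (rho k)).
  have r0 : rho k != 0 by rewrite gt_eqF.
  rewrite -(@dilation_integral b (rho k)) //; last first.
    apply: (@admissible_support _ _ _ r); last by move=> v i vi; rewrite (sg v i) // mulr0.
    apply: continuous_mulr => //; apply: continuous_mulr; first exact: continuous_xmono.
    exact: continuous_gaussian.
  rewrite exprD mulrA -(mulrA ((rho k)^-1 ^+ _)) -exprMn mulVf // expr1n mulr1.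
  transitivity ((rho k)^-1 ^+ size J * integral_rV (fun y => rho k ^+ size J * H (rho k) y)).
    congr (_ * integral_rV _); apply/funext => y /=.
    by rewrite xmono_dilation graph_gaussian_dilation // /H /K !mulrA.
  by rewrite integral_rVZ // mulrA -exprMn mulVf // expr1n mul1r.
under eq_fun do rewrite EH.
(* At rho = 0 all vertices sit at [b], so [g] no longer sees the offsets, and the reflection of the
   offsets in direction [j] changes the integrand by the sign of the odd monomial. *)
have H0 : integral_rV (H 0) = 0.
  have Hr y : H 0 (reflection b j y) = - H 0 y.
    have -> : H 0 (reflection b j y) = K (reflection b j y) * g (dilation b 0 y).
      congr (_ * g _); apply: rV_coordP => v k.
      by rewrite !dilationE !mul0r !add0r reflectionE eqxx expr0 mul1r.
    rewrite /H -mulNr; congr (_ * _); rewrite /K -mulNr; congr (_ * _).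
      have E L : xmono L (relative b (reflection b j y)) =
          (-1) ^+ count (fun l => l.2 == j) L * xmono L (relative b y).
        elim: L => [|l L IH]; first by rewrite !big_nil expr0 mul1r.
        by rewrite !big_cons /= IH relative_reflection ix_inj exprD; ring.
      by rewrite E -signr_odd oddJ expr1 mulN1r.
    congr (expR (- _)); apply: eq_bigr => m _.
    by rewrite relative_reflection exprMn sqrr_sign mul1r.
  have := reflection_integral b j (aH 0).
  rewrite (_ : H 0 \o reflection b j = (fun y => (-1) * H 0 y)); last first.
    by apply/funext => y /=; rewrite Hr mulN1r.
  by rewrite integral_rVZ // mulN1r => /eqP; rewrite eq_sym -addr_eq0 -mulr2n mulrn_eq0 /= => /eqP.
rewrite -H0; apply: (integral_rV_dct (C := D * M)) => // y.
apply: (@cvgM _ _ \oo _ (fun=> K y) (fun k => g (dilation b (rho k) y))); first exact: cvg_cst.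
apply: (@cvg_comp _ _ _ (fun k => dilation b (rho k) y) g _ _ _ _ (cg _)).
apply: cvg_mx => i k; rewrite (ord1 i); case/mxvec_indexP: k => v k.
rewrite dilationE; under eq_fun do rewrite dilationE.
by apply: cvgD; [apply: cvgM; [exact: rhol|exact: cvg_cst]|exact: cvg_cst].
Qed.

End RescalingLimit.

(** * The propagator as a product of one-forms *)

Section Contraction.
Context {R : realType}.
Local Notation C := R[i].

Lemma ext_scaleC n c d (a : ext R n) : ext_scale c (ext_scale d a) = ext_scale d (ext_scale c a).
Proof. by rewrite !ext_scaleA mulrC. Qed.

Lemma ext_scaleBr n c (a b : ext R n) : ext_scale c (a - b) = ext_scale c a - ext_scale c b.
Proof. by rewrite ext_scaleDr -!ext_scaleN1 ext_scaleC. Qed.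

Lemma contractE n (v : 'rV[C]_n) (a : ext R n) A : contract v a A =
  \sum_(i | i \notin A) (-1) ^+ #|[set j in A | (j < i)%N]%SET| * v 0 i * a (i |: A)%SET.
Proof. by rewrite ffunE. Qed.

Lemma contractDr n (v : 'rV[C]_n) (a b : ext R n) : contract v (a + b) = contract v a + contract v b.
Proof.
apply/ffunP => A; rewrite [RHS]ffunE !contractE -big_split; apply: eq_bigr => i _.
by rewrite ffunE mulrDr.
Qed.

Lemma contractZr n (v : 'rV[C]_n) c (a : ext R n) : contract v (ext_scale c a) = ext_scale c (contract v a).
Proof.
apply/ffunP => A; rewrite ext_scaleE !contractE mulr_sumr; apply: eq_bigr => i _.
by rewrite ext_scaleE mulrCA.
Qed.

Lemma contractDl n (v w : 'rV[C]_n) (a : ext R n) : contract (v + w) a = contract v a + contract w a.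
Proof.
apply/ffunP => A; rewrite [RHS]ffunE !contractE -big_split; apply: eq_bigr => i _.
by rewrite mxE mulrDr mulrDl.
Qed.

Lemma contractZl n (v : 'rV[C]_n) c (a : ext R n) : contract (c *: v) a = ext_scale c (contract v a).
Proof.
apply/ffunP => A; rewrite ext_scaleE !contractE mulr_sumr; apply: eq_bigr => i _.
by rewrite mxE; ring.
Qed.

Lemma contract0r n (v : 'rV[C]_n) : contract v (0 : ext R n) = 0.
Proof. by have := contractZr v 0 (0 : ext R n); rewrite !ext_scale0. Qed.

Lemma contract0l n (a : ext R n) : contract 0 a = 0.
Proof. by have := contractZl (0 : 'rV[C]_n) 0 a; rewrite scale0r ext_scale0. Qed.

Lemma contract_sumr n (v : 'rV[C]_n) (I : Type) (r : seq I) (F : I -> ext R n) :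
  contract v (\sum_(i <- r) F i) = \sum_(i <- r) contract v (F i).
Proof. by elim/big_rec2: _ => [|i x y _ <-]; rewrite ?contract0r ?contractDr. Qed.

Lemma contract_suml n (I : Type) (r : seq I) (F : I -> 'rV[C]_n) (a : ext R n) :
  contract (\sum_(i <- r) F i) a = \sum_(i <- r) contract (F i) a.
Proof. by elim/big_rec2: _ => [|i x y _ <-]; rewrite ?contract0l ?contractDl. Qed.

Lemma contract_basis n (j : 'I_n) (B : {set 'I_n}) : contract ('e_j : 'rV[C]_n) (ext_basis B) =
  if j \in B then ext_scale ((-1) ^+ inversions [set j]%SET (B :\ j)) (ext_basis (B :\ j)) else 0.
Proof.
apply/ffunP => A; rewrite contractE.
have E : \sum_(i | i \notin A) (-1) ^+ #|[set k in A | (k < i)%N]%SET| * ('e_j : 'rV[C]_n) 0 i * ext_basis B (i |: A)%SET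
   = if j \notin A then (-1) ^+ inversions [set j]%SET A * ext_basis B (j |: A)%SET else 0.
  case: ifP => jA.
    rewrite (bigD1 j) //= big1 ?addr0 => [|i /andP[_ ij]].
      by rewrite mxE !eqxx mulr1 inversions1.
    by rewrite mxE (negPf ij) andbF mulr0 mul0r.
  rewrite big1 // => i iA; rewrite mxE (_ : i == j = false) ?andbF ?mulr0 ?mul0r //.
  by apply/eqP => ij; rewrite -ij iA in jA.
rewrite {}E ffunE; have [jB|jB] := boolP (j \in B).
  rewrite !ffunE; case: (boolP (j \in A)) => jA /=.
    case: eqP => [AB|_]; last by rewrite mulr0.
    by rewrite AB !inE eqxx in jA.
  have -> : ((j |: A)%SET == B) = (A == B :\ j).
    apply/eqP/eqP => [<-|->]; last by rewrite finset.setD1K.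
    by rewrite setU1K.
  by case: eqP => [->|_]; rewrite ?mulr1 ?mulr0.
rewrite ffunE; case: ifP => // _; case: eqP => [AB|_]; last by rewrite mulr0.
by rewrite -AB !inE eqxx in jB.
Qed.

Lemma inversionsU1 n (j k : 'I_n) (B : {set 'I_n}) : k \notin B ->
  inversions [set j]%SET (k |: B) = ((k < j) + inversions [set j]%SET B)%N.
Proof.
move=> kB; rewrite inversionsUr; last by rewrite finset.disjoints1.
congr (_ + _)%N; rewrite inversions1; case: ltnP => kj.
  rewrite -[RHS](cards1 k); apply: eq_card => x; rewrite !inE.
  by case: eqP => [->|]; rewrite ?kj.
by apply: eq_card0 => x; rewrite !inE; case: eqP => // ->; rewrite ltnNge kj.
Qed.

(** The antiderivation rule. By linearity all three arguments are basis elements i, j and B; the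
    cases are whether i is in B and whether i = j, and the last sign compares the inversions of i
    and j with respect to B and to each other. *)
Lemma contract_wedge1 n (v u : 'rV[C]_n) (a : ext R n) :
  contract v (wedge (covector u) a) = ext_scale (along v u) a - wedge (covector u) (contract v a).
Proof.
rewrite (ext_sum_basis a) wedge_sumr !contract_sumr wedge_sumr ext_scale_sum -sumrB.
apply: eq_bigr => B _; rewrite wedgeZr !contractZr wedgeZr ext_scaleC -ext_scaleBr; congr (ext_scale _ _).
rewrite covector_sum !wedge_suml contract_sumr.
have -> : along v u = \sum_i u 0 i * v 0 i by apply: eq_bigr => i _; rewrite mulrC.
have -> : ext_scale (\sum_i u 0 i * v 0 i) (ext_basis B) =
    \sum_i ext_scale (u 0 i) (ext_scale (v 0 i) (ext_basis B)).
  elim/big_rec2: _ => [|i x y _ <-]; first exact: ext_scale0.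
  by rewrite ext_scaleDl ext_scaleA.
rewrite -sumrB; apply: eq_bigr => i _; rewrite !wedgeZl contractZr -ext_scaleBr; congr (ext_scale _ _).
rewrite {1 3}(row_sum_delta v) !contract_suml wedge_sumr.
have -> : ext_scale (v 0 i) (ext_basis B) =
    \sum_j ext_scale (v 0 j) (ext_scale (i == j)%:R (ext_basis B)).
  rewrite (bigD1 i) //= eqxx ext_scale1 big1 ?addr0 // => j; rewrite eq_sym => /negPf ->.
  by rewrite ext_scale0 ext_scalex0.
rewrite -sumrB; apply: eq_bigr => j _; rewrite !contractZl wedgeZr -ext_scaleBr; congr (ext_scale _ _).
rewrite wedge_basis finset.disjoints1 contract_basis.
have [iB|iB] := boolP (i \in B) => /=.
  rewrite contract0r; case: (eqVneq i j) => [<-|ij].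
    rewrite iB ext_scale1 wedgeZr wedge_basis finset.disjoints1 !inE eqxx /= ext_scaleA.
    by rewrite -exprD addnn -signr_odd odd_double expr0 ext_scale1 finset.setD1K // subrr.
  case: ifP => jB; last by rewrite wedge0r ext_scale0 subrr.
  by rewrite wedgeZr wedge_basis finset.disjoints1 !inE ij iB /= ext_scalex0 ext_scale0 subrr.
rewrite contractZr contract_basis !inE; case: (eqVneq j i) => [->|ji] /=.
  rewrite ext_scale1 (negPf iB) wedge0r subr0 setU1K // ext_scaleA.
  by rewrite -exprD addnn -signr_odd odd_double expr0 ext_scale1.
rewrite ext_scale0 sub0r; case: ifP => jB; last by rewrite ext_scalex0 wedge0r oppr0.
have jiB : i \notin B :\ j by rewrite !inE (negPf iB) andbF.
rewrite wedgeZr wedge_basis finset.disjoints1 jiB !ext_scaleA -ext_scaleN1 ext_scaleA.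
have -> : (i |: B) :\ j = i |: B :\ j.
  by apply/setP => x; rewrite !inE; case: (eqVneq x i) => [->|]; rewrite ?(eq_sym i) ?ji.
congr (ext_scale _ _); rewrite inversionsU1 //.
rewrite -{1}(finset.setD1K jB) inversionsU1 ?inE ?eqxx // !exprD.
move: ji; rewrite -val_eqE /=; case: ltngtP => //= _ _; rewrite ?expr0 ?expr1; ring.
Qed.

(* The Grassmann exponential [exp (- tau i_X)] acts on a product factor by factor. *)
Lemma wedge_shift n (X tau : 'rV[C]_n) (I : Type) (s : seq I) (v : I -> 'rV[C]_n) :
  \big[wedge/ext1]_(i <- s) covector (v i - along X (v i) *: tau) =
  \big[wedge/ext1]_(i <- s) covector (v i) -
  wedge (covector tau) (contract X (\big[wedge/ext1]_(i <- s) covector (v i))).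
Proof.
elim: s => [|i s IH].
  have c1 : contract X (ext1 : ext R n) = 0.
    apply/ffunP => A; rewrite contractE [RHS]ffunE big1 // => j _; rewrite ffunE.
    case: eqP => [/setP/(_ j)|_]; last by rewrite mulr0.
    by rewrite !inE eqxx.
  by rewrite !big_nil c1 wedge0r subr0.
rewrite !big_cons IH contract_wedge1; set O := \big[_/_]_(_ <- _) _.
rewrite covectorB covectorZ wedgeDl wedgeNl wedgeZl !wedgeDr !wedgeNr.
rewrite (wedgeA (covector tau) (covector tau)) covector_sqr wedge0l oppr0 addr0.
rewrite wedgeZr !wedgeA (covector_anticomm (v i) tau) wedgeNl !opprK opprB -!wedgeA.
by rewrite -addrA.
Qed.

End Contraction.

(** * The propagator as a Gaussian times shifted one-forms *)

Section Propagator.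
Context {R : realType} (d d' : nat).
Local Notation C := R[i].
Local Notation Re := complex.Re.
Local Notation Im := complex.Im.

Definition factors : seq ('I_d + 'I_d') :=
  [seq inl i | i <- index_enum 'I_d] ++ [seq inr j | j <- index_enum 'I_d'].

Definition factor_form (a : 'I_d + 'I_d') : 'rV[C]_(pdim d d' + 1) :=
  match a with inl i => 'e_(pre i) - 'i%C *: 'e_(pim i) | inr j => 'e_(px j) end.

Definition factor_shift (p : 'rV[R]_(pdim d d' + 1)) (a : 'I_d + 'I_d') : C :=
  match a with
  | inl i => ((p 0 (pre i))%:C%C - 'i%C * (p 0 (pim i))%:C%C) * ((p 0 pt)^-1)%:C%C
  | inr j => (p 0 (px j) / (2 * p 0 pt))%:C%C
  end.

Definition top_form : ext R (pdim d d' + 1) :=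
  \big[wedge/ext1]_(a <- factors) covector (factor_form a).

Lemma heat_formE p : @heat_form R d d' p = ext_scale (heat_coef p)%:C%C top_form.
Proof. by rewrite /heat_form /top_form big_cat !big_map. Qed.

Lemma sum_pdim (f : 'I_(pdim d d') -> R) :
  \sum_k weight k * f k = 2 * (\sum_(i < d) (f (ire i) + f (iim i))) + \sum_(j < d') f (ix j).
Proof.
rewrite big_split_ord /= addrC big_mxvec mulr_sumr; congr (_ + _).
  apply: eq_bigr => i _; rewrite big_ord_recl big_ord1 mulrDr.
  by rewrite -[rshift _ _]/(ire i) weight_ire (_ : lift ord0 ord0 = ord_max) ?weight_iim //; exact: val_inj.
by apply: eq_bigr => j _; rewrite weight_ix mul1r.
Qed.

(** Agreement along the line is enough. The heat coefficient equals a multiple of a Gaussian with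
    frozen t only on lines on which t is constant. *)
Lemma is_derive_eq_line n (x v : 'rV[R]_n) (f g : 'rV[R]_n -> R) l :
  (forall h, f (h *: v + x) = g (h *: v + x)) -> is_derive x v g l -> is_derive x v f l.
Proof.
move=> fg dg; suff : is_derive (0 *: v + x) v f l by rewrite scale0r add0r.
apply/is_derive_line.
have -> : (fun h => f (h *: v + x)) = (fun h => g (h *: v + x)) by apply/funext.
by apply/is_derive_line; rewrite scale0r add0r.
Qed.

Lemma is_derive_heat (p : 'rV[R]_(pdim d d' + 1)) (k : 'I_(pdim d d')) :
  is_derive p ('e_(lshift 1 k) : 'rV[R]_(pdim d d' + 1)) (@heat_coef R d d')
    (- (2 * (weight k / (4 * p 0 pt)) * p 0 (lshift 1 k)) * heat_coef p).
Proof.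
pose A := (2 ^+ (d + d') * (pi * p 0 pt) `^ (d%:R + d'%:R / 2))^-1.
pose g := gaussian (fun k : 'I_(pdim d d') => weight k / (4 * p 0 pt)) (fun k => 'e_(lshift 1 k)).
have heat_g (q : 'rV[R]_(pdim d d' + 1)) : q 0 pt = p 0 pt -> heat_coef q = A * g q.
  move=> qt; rewrite /heat_coef qt; congr (_ * expR _).
  under [in RHS]eq_bigr do rewrite rlin_delta mulrAC.
  by rewrite -mulr_suml (sum_pdim (fun k => q 0 (lshift 1 k) ^+ 2)) mulNr.
apply: (@is_derive_eq_line _ _ _ _ (fun q => A * g q)) => [h|].
  apply: heat_g; rewrite !mxE eqxx /= (_ : pt == _ = false) ?mulr0 ?add0r //.
  by rewrite /pt eq_rlshift.
rewrite heat_g // mulrCA.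
suff dg : is_derive p ('e_(lshift 1 k) : 'rV[R]_(pdim d d' + 1)) g
    (- (2 * (weight k / (4 * p 0 pt)) * p 0 (lshift 1 k)) * g p) by exact: (is_deriveZ A dg).
have [] := C1_der (C1_gaussian (fun k : 'I_(pdim d d') => weight k / (4 * p 0 pt))
  (fun k => 'e_(lshift 1 k) : 'rV[R]_(pdim d d' + 1))) (lshift 1 k) p.
set l := Re _ => dg _; suff <- : l = - (2 * (weight k / (4 * p 0 pt)) * p 0 (lshift 1 k)) * g p by exact: dg.
rewrite /l mxE [map_mx _ _ _ _]mxE -rmorphM /= mulrC; congr (_ * _).
rewrite summxE (bigD1 k) //= !mxE !eqxx rlin_delta mulr1 big1 ?addr0 // => m mk.
by rewrite !mxE (inj_eq (@lshift_inj _ _)) eq_sym (negPf mk) andbF mulr0.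
Qed.

Lemma cderive_heat_form (v : 'rV[C]_(pdim d d' + 1)) A (p : 'rV[R]_(pdim d d' + 1)) (k : 'I_(pdim d d')) :
  cderive (lshift 1 k) (fun q => contract v (@heat_form R d d' q) A) p =
  (- (2 * (weight k / (4 * p 0 pt)) * p 0 (lshift 1 k)) * heat_coef p)%:C%C * contract v top_form A.
Proof.
apply: is_cderiveE.
have -> : (fun q => contract v (@heat_form R d d' q) A) =
   (fun q => (heat_coef q)%:C%C * contract v top_form A).
  by apply/funext => q; rewrite heat_formE contractZr ext_scaleE.
have := is_cderiveM (is_cderive_real (is_derive_heat p k)) (is_cderive_cst (lshift 1 k) (contract v top_form A) p).
by rewrite mulr0 addr0.
Qed.

(** On the heat form the sum of the two adjoint operators is contraction with this field, because
    differentiating the Gaussian multiplies it by a linear function. *)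
Definition shift_field (p : 'rV[R]_(pdim d d' + 1)) : 'rV[C]_(pdim d d' + 1) :=
  \sum_(i < d) factor_shift p (inl i) *: vzbar d' i + \sum_(j < d') factor_shift p (inr j) *: 'e_(px j).

Lemma along_shift_field p a : along (shift_field p) (factor_form a) = factor_shift p a.
Proof.
have i2 : 'i%C * 'i%C = -1 :> C by rewrite -expr2 sqr_i.
have vz (i : 'I_d) a' : along (vzbar d' i) (factor_form a') = (a' == inl i)%:R.
  rewrite /vzbar alongZl alongDl alongZl !along_delta.
  case: a' => [i'|j'] /=; rewrite !mxE !eqxx /= /pre /pim /px !(inj_eq (@lshift_inj _ _)).
    rewrite ire_inj ire_iim (eq_sym (iim i)) ire_iim iim_inj mulr0 subr0 sub0r !mulrN mulrA i2 mulN1r opprK.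
    rewrite (inj_eq (@inl_inj _ _)) (eq_sym i'); case: (i == i') => /=; last by rewrite addr0 mulr0.
    by rewrite -mulr2n mulVf // pnatr_eq0.
  by rewrite !(eq_sym _ (ix j')) /ire /iim !ix_rshift mulr0 addr0 mulr0.
rewrite /shift_field alongDl !along_suml.
under eq_bigr do rewrite alongZl vz; under [X in _ + X]eq_bigr do rewrite alongZl along_delta.
case: a => [i|j].
  rewrite (bigD1 i) //= eqxx mulr1 big1 ?addr0 => [|i' i'i].
    rewrite big1 ?addr0 // => j _; rewrite !mxE !eqxx /= /pre /pim /px !(inj_eq (@lshift_inj _ _)).
    by rewrite /ire /iim !ix_rshift mulr0 subr0 mulr0.
  by rewrite (inj_eq (@inl_inj _ _)) eq_sym (negPf i'i) mulr0.
rewrite big1 ?add0r => [|i _]; last by rewrite mulr0.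
rewrite (bigD1 j) //= mxE !eqxx mulr1 big1 ?addr0 // => j' j'j.
by rewrite mxE eqxx /= /px !(inj_eq (@lshift_inj _ _)) (negPf j'j) mulr0.
Qed.

Lemma propagatorE p : @propagator R d d' p = ext_scale (heat_coef p)%:C%C
  (\big[wedge/ext1]_(a <- factors) covector (factor_form a - factor_shift p a *: 'e_pt)).
Proof.
(* The propagator is H - dt /\ i_X H with X the shift field, and [wedge_shift] distributes this over
   the factors of H. *)
have -> : \big[wedge/ext1]_(a <- factors) covector (factor_form a - factor_shift p a *: 'e_pt) =
   top_form - wedge (covector 'e_pt) (contract (shift_field p) top_form).
  by rewrite /top_form -wedge_shift; apply: eq_bigr => a _; rewrite along_shift_field.
rewrite ext_scaleBr -wedgeZr /propagator heat_formE addrC; congr (_ - wedge _ _).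
rewrite /shift_field contractDl ext_scaleDr !contract_suml !ext_scale_sum; congr (_ + _).
  rewrite /dbar_adj ext_scale_sum; apply: eq_bigr => i _; rewrite contractZl ext_scaleA.
  apply/ffunP => A; rewrite !ext_scaleE ffunE !cderive_heat_form weight_ire weight_iim.
  have E a : (- (2 * (2 / (4 * p 0 pt)) * a) * heat_coef p)%:C%C = - (heat_coef p)%:C%C * a%:C%C * ((p 0 pt)^-1)%:C%C :> C.
    rewrite mulNr -rmorphN -!rmorphM /=; congr (_%:C)%C; rewrite invfM.
    by move: (p 0 pt)^-1 => u; field.
  by rewrite !E /factor_shift; move: ((p 0 pt)^-1)%:C%C => u; field.
rewrite /d_adj -sumrN; apply: eq_bigr => j _; rewrite contractZl ext_scaleA.
apply/ffunP => A; rewrite !ext_scaleE [LHS]ffunE [X in - X]ffunE cderive_heat_form weight_ix.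
rewrite -mulNr; congr (_ * _); rewrite -rmorphN -[RHS]rmorphM /=; congr (_%:C)%C; rewrite !invfM.
by move: (p 0 pt)^-1 => u; field.
Qed.

End Propagator.

(** * Edge forms *)

Section LinearPullback.
Context {R : realType}.
Local Notation C := R[i].
Local Notation tocomplex := (map_mx (fun a : R => a%:C%C)).

Lemma continuous_mulmxr m n (A : 'M[R]_(m, n)) : continuous (fun q : 'rV[R]_m => q *m A).
Proof.
apply: continuous_mx => i j; under eq_fun do rewrite mxE; apply: continuous_sumr => k.
apply: continuous_mulr; first by move=> ?; exact: coord_continuous.
exact: (@cst_continuous _ _ (A k j)).
Qed.

Lemma jacobian_mulmxr m n (A : 'M[R]_(m, n)) (x : 'rV[R]_m) : jacobian (fun q => q *m A) x = A.
Proof.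
rewrite /jacobian (@diff_lin _ _ _ (mulmxr A)); last exact: continuous_mulmxr.
by apply/matrixP => i j; rewrite mxE /= -rowE mxE.
Qed.

Lemma pullbackE m n (f : 'rV[R]_m -> 'rV[R]_n) (w : dform R n) x :
  pullback f w x = ext_map (tocomplex (jacobian f x)^T) (w (f x)).
Proof.
apply: eq_bigr => A _; congr (ext_scale _ _); apply: eq_bigr => j _; congr covector.
by apply/rowP => i; rewrite !mxE.
Qed.

Lemma pullback_mulmxr m n (A : 'M[R]_(m, n)) (w : dform R n) x :
  pullback (fun q => q *m A) w x = ext_map (tocomplex A^T) (w (x *m A)).
Proof. by rewrite pullbackE jacobian_mulmxr. Qed.

Lemma cderive_lshift m n (k : 'I_m) (w : 'rV[R]_(m + n) -> C) (y : 'rV[R]_m) (t : 'rV[R]_n) :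
  cderive (lshift n k) w (row_mx y t) = cderive k (fun y => w (row_mx y t)) y.
Proof.
have E h (z : 'rV[R]_m) : h *: 'e_(lshift n k) + row_mx z t = row_mx (h *: 'e_k + z) t.
  have -> : ('e_(lshift n k) : 'rV[R]_(m + n)) = row_mx 'e_k 0.
    apply/rowP => j; case: (split_ordP j) => i ->; rewrite ?row_mxEl ?row_mxEr !mxE.
      by rewrite (inj_eq (@lshift_inj _ _)).
    by rewrite eq_rlshift andbF.
  by rewrite scale_row_mx add_row_mx scaler0 add0r.
have D (f : 'rV[R]_(m + n) -> R) : 'D_('e_(lshift n k)) f (row_mx y t) = 'D_('e_k) (fun y => f (row_mx y t)) y.
  rewrite /derive; suff -> : (fun h : R => h^-1 *: ((f \o shift (row_mx y t)) (h *: 'e_(lshift n k)) - f (row_mx y t))) =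
    (fun h : R => h^-1 *: (((fun y => f (row_mx y t)) \o shift y) (h *: 'e_k) - f (row_mx y t))) by [].
  by apply/funext => h /=; rewrite E.
by rewrite /cderive !D.
Qed.

Lemma covector_shiftE n (u v : 'rV[C]_n) c A :
  covector (v - c *: u) A = covector v A + c * - covector u A.
Proof. by rewrite -scaleNr covectorD covectorZ [LHS]ffunE ext_scaleE mulNr mulrN. Qed.

(** Such functions pass through the derivation along [w] like constants, as antiholomorphic
    functions do for d/dz. *)
Definition annihilated n (w : 'rV[C]_n) (f : 'rV[R]_n -> C) : Prop :=
  exists2 df, C1 f df & forall y, along w (df y) = 0.

Lemma annihilated_cst n (w : 'rV[C]_n) c : annihilated w (fun=> c).
Proof. by exists (fun=> 0) => [|y]; [exact: C1_cst|exact: along0r]. Qed.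

Lemma annihilatedD n (w : 'rV[C]_n) f g : annihilated w f -> annihilated w g ->
  annihilated w (fun y => f y + g y).
Proof.
move=> [df cf wf] [dg cg wg]; exists (fun y => df y + dg y) => [|y]; first exact: C1D.
by rewrite alongDr wf wg addr0.
Qed.

Lemma annihilatedM n (w : 'rV[C]_n) f g : annihilated w f -> annihilated w g ->
  annihilated w (fun y => f y * g y).
Proof.
move=> [df cf wf] [dg cg wg]; exists (fun y => g y *: df y + f y *: dg y) => [|y]; first exact: C1M.
by rewrite alongDr !alongZr wf wg !mulr0 addr0.
Qed.

Lemma annihilatedX n (w : 'rV[C]_n) f k : annihilated w f -> annihilated w (fun y => f y ^+ k).
Proof.
move=> af; elim: k => [|k IH]; first by under eq_fun do rewrite expr0; exact: annihilated_cst.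
by under eq_fun do rewrite exprS; exact: annihilatedM.
Qed.

Lemma annihilated_sum n (w : 'rV[C]_n) (I : Type) (r : seq I) (P : pred I) f :
  (forall i, annihilated w (f i)) -> annihilated w (fun y => \sum_(i <- r | P i) f i y).
Proof.
move=> af; elim: r => [|i r IH].
  by under eq_fun do rewrite big_nil; exact: annihilated_cst.
by under eq_fun do rewrite big_cons; case: (P i) => //; exact: annihilatedD.
Qed.

Lemma annihilated_prod n (w : 'rV[C]_n) (I : Type) (r : seq I) f :
  (forall i, annihilated w (f i)) -> annihilated w (fun y => \prod_(i <- r) f i y).
Proof.
move=> af; elim: r => [|i r IH].
  by under eq_fun do rewrite big_nil; exact: annihilated_cst.
by under eq_fun do rewrite big_cons; exact: annihilatedM.
Qed.

Lemma annihilated_clin n (w u : 'rV[C]_n) : along w u = 0 -> annihilated w (clin u).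
Proof. by move=> wu; exists (fun=> u) => //; exact: C1_clin. Qed.

Lemma annihilated_wedge n m (w : 'rV[C]_n) (a b : 'rV[R]_n -> ext R m) :
  (forall A, annihilated w (fun y => a y A)) -> (forall A, annihilated w (fun y => b y A)) ->
  forall A, annihilated w (fun y => wedge (a y) (b y) A).
Proof.
move=> aa ab A; under eq_fun do rewrite wedgeE; apply: annihilated_sum => B.
by apply: annihilatedM => //; apply: annihilatedM => //; exact: annihilated_cst.
Qed.

End LinearPullback.

(** * Pullback of the propagator to an edge and the derivatives of the decoration *)

Section EdgeForm.
Context {R : realType} (d d' : nat) (G : digraph) (n : decoration d G).
Local Notation C := R[i].
Local Notation N := (cdim d d' G).
Local Notation coord v k := (mxvec_index (v : 'I_(nV G)) (k : 'I_(pdim d d'))).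
Local Notation tocomplex := (map_mx (fun a : R => a%:C%C)).

(** Each row is the pullback of one coordinate covector, so that pulling forms back along the linear
    map [edge_map] is [ext_map] by this matrix. *)
Definition edge_rows (e : 'I_(nE G)) : 'M[R]_(pdim d d' + 1, N + nE G) :=
  col_mx (\matrix_k row_mx (edge_diff e k) 0) (row_mx 0 'e_e).

Lemma row_edge_rows_l e k : row (lshift 1 k) (edge_rows e) = row_mx (edge_diff e k) 0.
Proof. by rewrite rowKu rowK. Qed.

Lemma row_edge_rows_r e j : row (rshift (pdim d d') j) (edge_rows e) = row_mx 0 'e_e.
Proof. by rewrite rowKd (ord1 j) row_id. Qed.

Lemma edge_map_mulmx e : @edge_map R d d' G e = (fun q => q *m (edge_rows e)^T).
Proof.
apply/funext => q; rewrite /edge_map -[in RHS](hsubmxK q); move: (lsubmx q) (rsubmx q) => y t {q}.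
apply/rowP => k; rewrite [RHS]mxE big_split_ord /=.
under eq_bigr do rewrite row_mxEl; under [X in _ = _ + X]eq_bigr do rewrite row_mxEr.
have trE i j : (edge_rows e)^T i j = row j (edge_rows e) 0 i by rewrite !mxE.
under eq_bigr do rewrite trE; under [X in _ = _ + X]eq_bigr do rewrite trE.
case: (split_ordP k) => j -> {k}.
  rewrite row_edge_rows_l row_mxEl.
  under eq_bigr do rewrite row_mxEl mulrC; under [X in _ = _ + X]eq_bigr do rewrite row_mxEr mxE mulr0.
  by rewrite [X in _ = _ + X]big1 // addr0 -/(rlin _ _) rlin_edge_diff !mxE.
rewrite row_edge_rows_r row_mxEr (ord1 j) mxE eqxx mulr1n.
under eq_bigr do rewrite row_mxEl mxE mulr0; under [X in _ = _ + X]eq_bigr do rewrite row_mxEr mulrC.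
by rewrite big1 // add0r -/(rlin _ _) rlin_delta.
Qed.

Definition edge_factor (e : 'I_(nE G)) (a : 'I_d + 'I_d') : 'rV[C]_N :=
  match a with inl i => zbar_form d' e i | inr j => x_form d e j end.

(* The coefficient of [dt_e] in the factor [a] of the propagator of the edge [e]. *)
Definition edge_shift (e : 'I_(nE G)) (a : 'I_d + 'I_d') (s : R) (y : 'rV[R]_N) : C :=
  clin (edge_factor e a) y * (if a is inl _ then s^-1 else (2 * s)^-1)%:C%C.

Definition edge_wedge e (y : 'rV[R]_N) (t : 'rV[R]_(nE G)) : ext R (N + nE G) :=
  \big[wedge/ext1]_(a <- factors d d') covector
    (row_mx (edge_factor e a) 0 - edge_shift e a (t 0 e) y *: row_mx 0 'e_e).

Definition heat_const (s : R) : R := (2 ^+ (d + d') * (pi * s) `^ (d%:R + d'%:R / 2))^-1.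

Lemma pullback_propagator e y t :
  pullback (@edge_map R d d' G e) (@propagator R d d') (row_mx y t) =
  ext_scale (heat_const (t 0 e) * edge_gaussian e (t 0 e) y)%:C%C (edge_wedge e y t).
Proof.
pose p := edge_map e (row_mx y t).
have pl k : p 0 (lshift 1 k) = rlin (edge_diff e k) y.
  by rewrite /p /edge_map row_mxKl row_mxEl !mxE rlin_edge_diff.
have pr : p 0 pt = t 0 e by rewrite /p /edge_map row_mxKr /pt row_mxEr !mxE.
have Bl k : 'e_(lshift 1 k) *m tocomplex (edge_rows e) = row_mx (tocomplex (edge_diff e k)) 0.
  by rewrite -rowE -map_row row_edge_rows_l map_row_mx map_mx0.
have Br : 'e_pt *m tocomplex (edge_rows e) = row_mx 0 'e_e :> 'rV[C]_(N + nE G).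
  by rewrite -rowE -map_row row_edge_rows_r map_row_mx map_mx0 map_delta_mx.
rewrite {1}edge_map_mulmx pullback_mulmxr trmxK.
have -> : row_mx y t *m (edge_rows e)^T = p by rewrite /p edge_map_mulmx.
rewrite propagatorE ext_mapZ ext_map_covectors; congr (ext_scale _%:C%C _).
  rewrite /heat_coef pr; congr (_ * expR _).
  have := sum_pdim (fun k => p 0 (lshift 1 k) ^+ 2); rewrite /pre /pim /px => <-.
  by rewrite mulNr mulr_suml; congr (- _); apply: eq_bigr => k _; rewrite pl mulrAC.
apply: eq_bigr => a _; congr covector; rewrite mulmxBl -scalemxAl Br; congr (_ - _ *: _).
  case: a => [i|j] /=; last exact: Bl.
  rewrite mulmxBl -scalemxAl !Bl /zbar_form scale_row_mx opp_row_mx add_row_mx.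
  by rewrite scaler0 oppr0 addr0.
rewrite /edge_shift; case: a => [i|j] /=; rewrite pr.
  by rewrite clin_zbar /pre /pim !pl.
by rewrite clin_x /px pl -rmorphM.
Qed.

Lemma annihilated_edge_wedge v i e t A : annihilated (z_field d' v i) (fun y => edge_wedge e y t A).
Proof.
rewrite /edge_wedge; elim: (factors d d') A => [|a s IH] A.
  by under eq_fun do rewrite big_nil; exact: annihilated_cst.
under eq_fun do rewrite big_cons; move: A; apply: annihilated_wedge => //.
move=> A; under eq_fun do rewrite covector_shiftE.
apply: annihilatedD; first exact: annihilated_cst.
apply: annihilatedM; last exact: annihilated_cst.
apply: annihilatedM; last exact: annihilated_cst.
by apply: annihilated_clin; case: a => [i'|j]; [exact: along_z_field_zbar|exact: along_z_field_x].
Qed.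

Lemma along_z_fieldE v i (u : 'rV[C]_N) : along (z_field d' v i) u =
  2^-1 * (u 0 (coord v (ire i)) - 'i%C * u 0 (coord v (iim i))).
Proof. by rewrite /z_field alongZl alongDl -scaleN1r !alongZl !along_delta mulN1r. Qed.

(** All factors except the Gaussian are annihilated by d/dz at the head, so each derivative merely
    brings down - zbar / (2 t) from the exponent. As the edge is no loop, the incidence number at
    its head is 1. *)
Lemma edge_formE e y t : tail e <> head e -> @edge_form R d d' G n e (row_mx y t) =
  ext_scale ((heat_const (t 0 e) * edge_gaussian e (t 0 e) y)%:C%C *
    \prod_(i <- enum 'I_d) (- ((2 * t 0 e)^-1)%:C%C * clin (zbar_form d' e i) y) ^+ n e i)
   (edge_wedge e y t).
Proof.
move=> loop; rewrite /edge_form; elim: (enum 'I_d) y => [|i s IH] y /=.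
  by rewrite big_nil mulr1; exact: pullback_propagator.
set w := foldr _ _ s in IH *; rewrite big_cons.
set Q := fun y => \prod_(j <- s) (- ((2 * t 0 e)^-1)%:C%C * clin (zbar_form d' e j) y) ^+ n e j.
pose kap y := - ((2 * t 0 e)^-1)%:C%C * clin (zbar_form d' e i) y.
have akap j : annihilated (z_field d' (head e) i) (fun y => - ((2 * t 0 e)^-1)%:C%C * clin (zbar_form d' e j) y).
  by apply: annihilatedM; [exact: annihilated_cst|apply: annihilated_clin; exact: along_z_field_zbar].
have aQ : annihilated (z_field d' (head e) i) Q by apply: annihilated_prod => j; exact: annihilatedX.
elim: (n e i) y => [|k IHk] y.
  by rewrite -/(Q y) -/(kap y) [kap y ^+ 0]expr0 [1 * Q y]mul1r; exact: IH.
rewrite [iter _ _ _]iterS -/(Q y) -/(kap y).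
apply/ffunP => A; rewrite ffunE !cderive_lshift ext_scaleE.
have -> : (fun y0 => iter k (@dz_vertex R d d' G (head e) i) w (row_mx y0 t) A) =
  (fun y0 => (heat_const (t 0 e))%:C%C * (edge_gaussian e (t 0 e) y0)%:C%C *
     (kap y0 ^+ k * Q y0 * edge_wedge e y0 t A)).
  by apply/funext => z; rewrite IHk ext_scaleE rmorphM !mulrA.
have [df cf wf] : annihilated (z_field d' (head e) i) (fun y0 => kap y0 ^+ k * Q y0 * edge_wedge e y0 t A).
  apply: annihilatedM; last exact: annihilated_edge_wedge.
  by apply: annihilatedM => //; apply: annihilatedX; exact: akap.
have cg := C1M (C1_cst N (heat_const (t 0 e))%:C%C) (C1_gaussian (fun k => weight k / (4 * t 0 e)) (@edge_diff R d d' G e)).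
have cF := C1M cg cf; set dF := (fun y => _ *: _ + _) in cF.
transitivity (along (z_field d' (head e) i) (dF y)).
  by rewrite along_z_fieldE !(is_cderiveE (C1_der cF _ _)) mulrC.
have kapE : along (z_field d' (head e) i) (tocomplex (\sum_m
    - (2 * (weight m / (4 * t 0 e)) * rlin (edge_diff e m) y) *: edge_diff e m)) = kap y.
  rewrite along_edge_exponent /kap; have -> : incidence e (head e) = 1 :> R.
    by rewrite /incidence eqxx; case: eqP => // _; rewrite subr0.
  by rewrite mul1r.
rewrite /dF !(alongDr, alongZr) along0r wf kapE.
rewrite exprSr rmorphM /= /edge_gaussian; clearbody kap Q dF; clear.
move: (kap y ^+ k) (kap y) (Q y) (edge_wedge _ _ _ _) (heat_const _)%:C%C (gaussian _ _ _)%:C%C => p x q w h g.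
ring.
Qed.

End EdgeForm.

(** * Expansion of the product of propagators *)

Section Expansion.
Context {R : realType} (d d' : nat) (G : digraph).
Local Notation C := R[i].
Local Notation N := (cdim d d' G).
Local Notation coord v k := (mxvec_index (v : 'I_(nV G)) (k : 'I_(pdim d d'))).
Local Notation tocomplex := (map_mx (fun a : R => a%:C%C)).
Local Notation kind := ('I_d + 'I_d')%type.

(** The slots in the order of their factors in the product. Numbering them by ordinals keeps this
    order and lets the factors be rows of a matrix. *)
Definition graph_factors : seq ('I_(nE G) * kind) :=
  [seq (e, a) | e <- index_enum 'I_(nE G), a <- factors d d'].

Local Notation K := (size graph_factors).

Definition slot (i : 'I_K) : 'I_(nE G) * kind := tnth (in_tuple graph_factors) i.

(* [S] is the set of the slots that contribute their [dt_e] part. *)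
Definition slot_matrix (S : {set 'I_K}) : 'M[C]_(K, N + nE G) :=
  \matrix_i (if i \in S then row_mx 0 'e_(slot i).1 else row_mx (edge_factor (slot i).1 (slot i).2) 0).

Lemma wedges_scale m (I : Type) (s : seq I) (c : I -> C) (v : I -> ext R m) :
  \big[wedge/ext1]_(i <- s) ext_scale (c i) (v i) =
  ext_scale (\prod_(i <- s) c i) (\big[wedge/ext1]_(i <- s) v i).
Proof.
elim: s => [|i s IH]; first by rewrite !big_nil ext_scale1.
by rewrite !big_cons IH wedgeZl wedgeZr ext_scaleA.
Qed.

Lemma wedge_expand (y : 'rV[R]_N) (t : 'rV[R]_(nE G)) :
  \big[wedge/ext1]_(e < nE G) edge_wedge e y t =
  \sum_(S : {set 'I_K}) ext_scale (\prod_(i in S) - edge_shift (slot i).1 (slot i).2 (t 0 (slot i).1) y)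
    (\big[wedge/ext1]_(i < K) covector (row i (slot_matrix S))).
Proof.
rewrite -(@big_allpairs _ _ wedge _ _ _ _ (fun p => covector
  (row_mx (edge_factor p.1 p.2) 0 - edge_shift p.1 p.2 (t 0 p.1) y *: row_mx 0 'e_p.1))).
rewrite big_tnth.
transitivity (\big[wedge/ext1]_(i < K)
   (ext_scale (- edge_shift (slot i).1 (slot i).2 (t 0 (slot i).1) y) (covector (row_mx 0 'e_(slot i).1)) +
    covector (row_mx (edge_factor (slot i).1 (slot i).2) 0))).
  by apply: eq_bigr => i _; rewrite -/(slot i) covectorB covectorZ addrC -covectorZ -covectorN -scaleNr covectorZ.
rewrite wedge_distr; apply: eq_bigr => S _.
transitivity (\big[wedge/ext1]_(i < K)
   ext_scale (if i \in S then - edge_shift (slot i).1 (slot i).2 (t 0 (slot i).1) y else 1)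
     (covector (row i (slot_matrix S)))).
  by apply: eq_bigr => i _; rewrite rowK; case: ifP => _; rewrite ?ext_scale1.
by rewrite wedges_scale; congr (ext_scale _ _); rewrite [RHS]big_mkcond.
Qed.

Definition config_embedding : 'M[C]_(N, N + nE G) := row_mx 1%:M 0.

(** The monomial whose coefficient [fiber_integral] integrates: the volume form of the
    configurations times the [dt_e] with [e] in [B]. *)
Definition fiber_set (B : {set 'I_(nE G)}) : {set 'I_(N + nE G)} :=
  ([set lshift (nE G) i | i in 'I_N] :|: [set rshift N e | e in B])%SET.

Definition slot_coef (S : {set 'I_K}) (B : {set 'I_(nE G)}) (a : ext R N) : C :=
  wedge (\big[wedge/ext1]_(i < K) covector (row i (slot_matrix S))) (ext_map config_embedding a) (fiber_set B).

Lemma slot_coef_linear S B : exists c : {set 'I_N} -> C, forall a, slot_coef S B a = \sum_A c A * a A.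
Proof.
set w := \big[wedge/ext1]_(i < K) covector (row i (slot_matrix S)).
exists (fun A => wedge w (ext_map config_embedding (ext_basis A)) (fiber_set B)) => a.
rewrite /slot_coef -/w {1}(ext_sum_basis a) ext_map_sum wedge_sumr sum_ffunE.
by apply: eq_bigr => A _; rewrite ext_mapZ wedgeZr ext_scaleE mulrC.
Qed.

Lemma mem_fiber_set_r B e : (rshift N e \in fiber_set B) = (e \in B).
Proof.
rewrite /fiber_set finset.in_setU (finset.mem_imset B e (@rshift_inj N (nE G))).
apply/orP/idP => [[|]|->]; [|by []|by right].
by move=> /finset.imsetP[i _ /eqP]; rewrite eq_rlshift.
Qed.

(** The diagonal map that doubles every [dt_e] and fixes the other covectors multiplies the product
    by 2^|S| and the coefficient of the monomial by 2^|B|. *)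
Lemma slot_coef_degree S B a : slot_coef S B a != 0 -> #|S| = #|B|.
Proof.
pose l : 'rV[C]_(N + nE G) := row_mx (const_mx 1) (const_mx 2); pose D := diag_mx l.
have Dl m (u : 'M[C]_(m, N)) : row_mx u 0 *m D = row_mx u 0.
  rewrite /D /l; apply/matrixP => i j; rewrite mul_mx_diag mxE.
  by case: (split_ordP j) => k ->; rewrite ?row_mxEl ?row_mxEr !mxE ?mulr1 ?mul0r.
have Dr (u : 'rV[C]_(nE G)) : row_mx 0 u *m D = 2 *: row_mx 0 u.
  rewrite /D /l; apply/matrixP => i j; rewrite mul_mx_diag mxE [RHS]mxE.
  by case: (split_ordP j) => k ->; rewrite ?row_mxEl ?row_mxEr !mxE ?mul0r ?mulr0 // mulrC.
set w := slot_coef S B a => w0.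
have E1 : ext_map D (wedge (\big[wedge/ext1]_(i < K) covector (row i (slot_matrix S)))
    (ext_map config_embedding a)) (fiber_set B) = 2 ^+ #|S| * w.
  rewrite ext_map_wedges ext_map_comp (Dl _ 1%:M : config_embedding *m D = config_embedding).
  have -> : \big[wedge/ext1]_(i < K) covector (row i (slot_matrix S) *m D) =
      \big[wedge/ext1]_(i < K) ext_scale (if i \in S then 2 else 1) (covector (row i (slot_matrix S))).
    by apply: eq_bigr => i _; rewrite rowK; case: ifP => iS; rewrite ?Dl ?Dr ?covectorZ ?ext_scale1.
  by rewrite wedges_scale -big_mkcond prodr_const wedgeZl ext_scaleE.
have E2 : \prod_(j in fiber_set B) l 0 j = 2 ^+ #|B|.
  rewrite big_mkcond big_split_ord /= [X in X * _]big1 ?mul1r => [|i _]; last first.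
    by rewrite /l row_mxEl mxE if_same.
  rewrite -prodr_const [RHS]big_mkcond; apply: eq_bigr => e _.
  by rewrite /l row_mxEr mxE mem_fiber_set_r.
move: E1; rewrite ext_map_diag E2 => /(mulIf w0) /eqP.
rewrite -!natrX eqr_nat => /eqP /(congr1 (logn 2)).
by rewrite !pfactorK.
Qed.

Lemma slot_coef_rank S B a : slot_coef S B a != 0 -> \rank (slot_matrix S) = K.
Proof.
move=> c0; apply/eqP; rewrite eqn_leq rank_leq_row /= leqNgt; apply/negP => /wedge_rows_rank E.
by rewrite /slot_coef E wedge0l ffunE eqxx in c0.
Qed.

Definition vertex_form (v : 'I_(nV G)) (a : kind) : 'rV[C]_N :=
  match a with inl i => 'e_(coord v (ire i)) - 'i%C *: 'e_(coord v (iim i)) | inr j => 'e_(coord v (ix j)) end.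

Lemma edge_factor_incidence e a :
  edge_factor e a = \sum_v (incidence e v : R)%:C%C *: vertex_form v a.
Proof.
have E k : tocomplex (edge_diff e k) = \sum_v (incidence e v : R)%:C%C *: ('e_(coord v k) : 'rV[C]_N).
  rewrite /edge_diff map_mxB !map_delta_mx.
  have pick w : ('e_(coord w k) : 'rV[C]_N) = \sum_v ((w == v)%:R : R)%:C%C *: 'e_(coord v k).
    rewrite (bigD1 w) //= eqxx scale1r big1 ?addr0 // => v; rewrite eq_sym => /negPf ->.
    by rewrite scale0r.
  rewrite (pick (head e)) (pick (tail e)) -sumrB; apply: eq_bigr => v _.
  by rewrite /incidence rmorphB scalerBl.
case: a => [i|j] /=; last by rewrite /x_form E.
rewrite /zbar_form !E scaler_sumr -sumrB; apply: eq_bigr => v _.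
by rewrite scalerBr !scalerA mulrC.
Qed.

(** Let T be the set counted. The rows in T factor through the boundary map, and the other K - |T|
    rows add at most their number to the rank. Full rank K then leaves at least |T| for the boundary
    map. *)
Lemma slot_rank_bound (S : {set 'I_K}) (a : kind) : \rank (slot_matrix S) = K ->
  (#|[set i | (i \notin S) && ((slot i).2 == a)]%SET| <= \rank (boundary_map G))%N.
Proof.
move=> rS; set T := [set i | _]%SET; pose Q := (~: T)%SET.
(* The Betti number is defined over the rationals; extending the field keeps the rank. *)
pose D : 'M[C]_(nE G, nV G) := map_mx (ratr : rat -> C) (boundary_map G).
have DE e v : D e v = (incidence e v : R)%:C%C.
  by rewrite !mxE /incidence !rmorphB /= !ratr_nat !rmorph_nat.
have rD : \rank D = \rank (boundary_map G) by rewrite mxrank_map.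
pose X : 'M[C]_(K, nE G) := \matrix_(i, e) ((i \in T) && ((slot i).1 == e))%:R.
pose Y : 'M[C]_(nV G, N + nE G) := \matrix_v row_mx (vertex_form v a) 0.
pose Z : 'M[C]_(K, #|Q|) := \matrix_(i, k) (i == enum_val k)%:R.
pose W : 'M[C]_(#|Q|, N + nE G) := \matrix_k row (enum_val k) (slot_matrix S).
have SE : slot_matrix S = X *m D *m Y + Z *m W.
  apply/row_matrixP => i; rewrite linearD /= !row_mul.
  have [iT|iT] := boolP (i \in T).
    rewrite [X in _ + X](_ : _ = 0) ?addr0; last first.
      apply/rowP => j; rewrite !mxE big1 // => k _; rewrite !mxE.
      case: eqP => [ik|_]; last by rewrite mul0r.
      by have := enum_valP k; rewrite -ik inE iT.
    have -> : row i X = 'e_(slot i).1 by apply/rowP => e; rewrite !mxE iT eqxx eq_sym.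
    move: iT; rewrite inE => /andP[iS /eqP ia]; rewrite rowK (negPf iS) ia edge_factor_incidence.
    rewrite -rowE mulmx_sum_row; have -> : row_mx (\sum_v (incidence (slot i).1 v : R)%:C%C *: vertex_form v a) 0
      = \sum_v (incidence (slot i).1 v : R)%:C%C *: row_mx (vertex_form v a) (0 : 'rV[C]_(nE G)).
      elim/big_rec2: _ => [|v x z _ <-]; first by rewrite row_mx0.
      by rewrite scale_row_mx add_row_mx scaler0 addr0.
    by apply: eq_bigr => v _; rewrite rowK mxE DE.
  have -> : row i X = 0 by apply/rowP => e; rewrite !mxE (negPf iT).
  rewrite !mul0mx add0r.
  have iQ : i \in Q by rewrite inE.
  have -> : row i Z = 'e_(enum_rank_in iQ i).
    apply/rowP => k; rewrite !mxE eqxx; congr (nat_of_bool _)%:R; apply/eqP/eqP.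
      by move=> ik; apply: enum_val_inj; rewrite enum_rankK_in.
    by move=> ->; rewrite enum_rankK_in.
  by rewrite -rowE [RHS]rowK enum_rankK_in.
have h1 : (\rank (X *m D *m Y) <= \rank D)%N.
  by apply: leq_trans (mxrankM_maxl _ _) _; exact: mxrankM_maxr.
have h2 : (\rank (Z *m W) <= #|Q|)%N.
  by apply: leq_trans (mxrankM_maxr _ _) _; exact: rank_leq_row.
have h3 := mxrank_add (X *m D *m Y) (Z *m W); rewrite -SE rS in h3.
have := cardsC T; rewrite -/Q card_ord; lia.
Qed.

(** The constant function on the vertices is a nonzero vector killed by the boundary map. *)
Lemma rank_boundary : (0 < nV G)%N -> (\rank (boundary_map G) <= (nV G).-1)%N.
Proof.
move=> nV0; have h : boundary_map G *m (const_mx 1 : 'cV[rat]_(nV G)) = 0.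
  apply/matrixP => e j; rewrite !mxE; under eq_bigr do rewrite !mxE mulr1.
  have pick w : \sum_(v < nV G) ((w == v)%:R : rat) = 1.
    by rewrite (bigD1 w) //= eqxx big1 ?addr0 // => v; rewrite eq_sym => /negPf ->.
  by rewrite sumrB !pick subrr.
have := mulmx0_rank_max h.
have : (0 < \rank (const_mx 1%R : 'cV[rat]_(nV G)))%N.
  rewrite lt0n mxrank_eq0; apply/eqP => /matrixP /(_ (Ordinal nV0) ord0); rewrite !mxE => /eqP.
  by rewrite oner_eq0.
lia.
Qed.

Lemma betti1E : betti1 G = (nE G - \rank (boundary_map G))%N.
Proof. by rewrite /betti1 mxrank_ker. Qed.

Lemma count_factors (a : kind) : count_mem a (factors d d') = 1%N.
Proof.
rewrite /factors count_cat !count_map; case: a => [i|j].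
  rewrite (eq_count (a2 := pred1 i)) => [|i']; last by [].
  rewrite (count_uniq_mem _ (index_enum_uniq _)) mem_index_enum (eq_count (a2 := pred0)) ?count_pred0 //.
rewrite (eq_count (a2 := pred0)) => [|i'] //; rewrite count_pred0 add0n.
by rewrite (eq_count (a2 := pred1 j)) // (count_uniq_mem _ (index_enum_uniq _)) mem_index_enum.
Qed.

Lemma card_slots (a : kind) : #|[set i | (slot i).2 == a]%SET| = nE G.
Proof.
rewrite -sum1_card; under eq_bigl do rewrite inE.
rewrite -(big_tnth _ _ graph_factors (fun p => p.2 == a) (fun=> 1%N)) big_mkcond big_allpairs /=.
under eq_bigr do rewrite -big_mkcond sum1_count count_factors.
by rewrite sum1_card card_ord.
Qed.

Definition kind_count (S : {set 'I_K}) (a : kind) : nat := #|[set i in S | (slot i).2 == a]%SET|.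

Lemma sum_kind_count S : (\sum_a kind_count S a = #|S|)%N.
Proof.
rewrite -sum1_card (partition_big (fun i => (slot i).2) predT) //=; apply: eq_bigr => a _.
by rewrite /kind_count -sum1_card; apply: eq_bigl => i; rewrite inE.
Qed.

(* The rank bound gives at least [h_1] slots of every kind in [S], and by the Laman equality
   there are only [|E| - 1 = (d + d') h_1] slots in [S]. *)
Lemma kind_count_betti (S : {set 'I_K}) (B : {set 'I_(nE G)}) (w : ext R N) :
  laman d d' G -> (0 < d')%N -> (0 < nE G)%N -> #|B| = (nE G).-1 -> slot_coef S B w != 0 ->
  (forall a, kind_count S a = betti1 G) /\ (betti1 G + nV G = nE G + 1)%N.
Proof.
move=> [[nV0 _] _ _ leq] d0 nE0 cB cS.
have cardS := slot_coef_degree cS; have rkS := slot_coef_rank cS.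
have rV := rank_boundary nV0; set r := \rank (boundary_map G) in rV.
have lower a : (nE G <= kind_count S a + r)%N.
  have := slot_rank_bound a rkS; rewrite -/r => h; have := card_slots a.
  rewrite -(finset.cardsID S); have -> : ([set i | (slot i).2 == a] :&: S)%SET = [set i in S | (slot i).2 == a]%SET.
    by apply/setP => i; rewrite !inE andbC.
  have -> : ([set i | (slot i).2 == a] :\: S)%SET = [set i | (i \notin S) && ((slot i).2 == a)]%SET.
    by apply/setP => i; rewrite !inE.
  rewrite -/(kind_count S a); lia.
have tot := sum_kind_count S; rewrite cardS cB in tot.
have cardk : #|{: kind}| = (d + d')%N by rewrite card_sum !card_ord.
have ge : ((d + d') * (nE G - r) <= (nE G).-1)%N.
  rewrite -tot -cardk -sum_nat_const; apply: leq_sum => a _; have := lower a; lia.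
(* The Laman equality over the naturals; the second part makes the truncated subtraction a true
   one. *)
have rE : (nE G).-1 = ((d + d') * (nE G + 1 - nV G))%N /\ (nV G <= nE G + 1)%N.
  move: leq; set D := (d + d')%N => leq; have D0 : (0 < D)%N by rewrite addn_gt0 d0 orbT.
  have : (D * nV G + nE G = D * nE G + D + 1)%N.
    by move: leq; clearbody D; clear; lia.
  move=> E; have : (nV G <= nE G + 1)%N by nia.
  by split => //; nia.
case: rE => rE1 rE2.
(* Here [ge] and the Laman equality give r >= |V| - 1, and [rV] gives the converse. *)
have rk : (nE G - r = nE G + 1 - nV G)%N by nia.
rewrite betti1E -/r; split; last lia.
have : (\sum_a kind_count S a = \sum_(a : kind) (nE G - r))%N.
  by rewrite tot sum_nat_const cardk rk.
move=> E a; apply/eqP; rewrite eqn_leq [X in _ && X](_ : _ = true) ?andbT; last first.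
  by have := lower a; lia.
move: E; rewrite (bigD1 a) //= [RHS](bigD1 a) //=.
have : (\sum_(i | i != a) (nE G - r) <= \sum_(i | i != a) kind_count S i)%N.
  by apply: leq_sum => i _; have := lower i; lia.
move=> h E; rewrite -(leq_add2r (\sum_(i : kind | i != a) (nE G - r))) -E.
by rewrite leq_add2l.
Qed.

End Expansion.

(** * Vanishing of the rescaled fibre integral *)

Section MonomialLimit.
Context {R : realType} (d d' : nat) (G : digraph).
Local Notation C := R[i].
Local Notation N := (cdim d d' G).
Local Notation kind := ('I_d + 'I_d')%type.
Local Notation Re := complex.Re.
Local Notation Im := complex.Im.
Local Notation xmono J := (fun y : 'rV[R]_N => \prod_(l <- J) rlin (edge_diff l.1 (ix l.2)) y).

Definition cvanish (u : nat -> C) : Prop :=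
  (fun k => Re (u k)) @ \oo --> (0 : R) /\ (fun k => Im (u k)) @ \oo --> (0 : R).

Lemma eq_cvanish u v : (forall k, u k = v k) -> cvanish v -> cvanish u.
Proof. by move=> /funext ->. Qed.

Lemma cvanish0 : cvanish (fun=> 0).
Proof. by split; exact: (cvg_cst (0 : R)). Qed.

Lemma cvanishD u v : cvanish u -> cvanish v -> cvanish (fun k => u k + v k).
Proof.
move=> [u1 u2] [v1 v2]; split.
  by under eq_fun do rewrite ReD; rewrite -[0]addr0; exact: cvgD.
by under eq_fun do rewrite ImD; rewrite -[0]addr0; exact: cvgD.
Qed.

Lemma cvanishZ c u : cvanish u -> cvanish (fun k => c * u k).
Proof.
move=> [u1 u2]; have Z a (v : nat -> R) : v @ \oo --> (0 : R) -> (fun k => a * v k) @ \oo --> (0 : R).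
  by move=> v0; rewrite -[X in _ --> X](mulr0 a); exact: cvgMr.
split.
  under eq_fun do rewrite ReM -mulNr; rewrite -[0]addr0; apply: cvgD; exact: Z.
under eq_fun do rewrite ImM; rewrite -[0]addr0; apply: cvgD; exact: Z.
Qed.

Lemma cvanish_sum (I : Type) (s : seq I) (u : I -> nat -> C) :
  (forall i, cvanish (u i)) -> cvanish (fun k => \sum_(i <- s) u i k).
Proof.
move=> u0; elim: s => [|i s IH].
  by under eq_fun do rewrite big_nil; exact: cvanish0.
by under eq_fun do rewrite big_cons; exact: cvanishD.
Qed.

Definition multiplicity (L : seq ('I_(nE G) * kind)) (a : kind) : nat := count (fun l => l.2 == a) L.

Lemma split_kinds (L : seq ('I_(nE G) * kind)) :
  exists (Lz : seq ('I_(nE G) * 'I_d)) (Lx : seq ('I_(nE G) * 'I_d')),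
  [/\ forall y : 'rV[R]_N, \prod_(l <- L) clin (edge_factor l.1 l.2) y =
        \prod_(l <- Lz) clin (zbar_form d' l.1 l.2) y * \prod_(l <- Lx) clin (x_form d l.1 l.2) y,
      size Lz = (\sum_i multiplicity L (inl i))%N, size Lx = (\sum_j multiplicity L (inr j))%N &
      forall j, count (fun l => l.2 == j) Lx = multiplicity L (inr j)].
Proof.
have pick (I : finType) (i : I) : (\sum_(i' : I) (i == i') = 1)%N.
  by rewrite (bigD1 i) //= eqxx big1 ?addn0 // => i'; rewrite eq_sym => /negPf ->.
elim: L => [|[e a] L [Lz [Lx [pE zE xE cE]]]].
  by exists [::], [::]; split=> [y|||j] //; rewrite ?big_nil ?mulr1 // big1.
case: a => [i|j].
  exists ((e, i) :: Lz), Lx; split=> [y|||j'] /=; rewrite ?big_cons ?pE ?mulrA //.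
  by rewrite zE -add1n -[X in (X + _)%N](pick _ i) -big_split.
exists Lz, ((e, j) :: Lx); split=> [y|||j'] /=; rewrite ?big_cons ?pE ?cE // 1?mulrCA //.
by rewrite xE -add1n -[X in (X + _)%N](pick _ j) -big_split.
Qed.

(** The exponent collects what the integral gains: rho^2 from the integration by parts of each zbar,
    rho from each x, and the volume of the rescaled offsets. *)
Lemma monomial_limit (t : 'I_(nE G) -> R) L j (phi : 'rV[R]_N -> C) r (rho : nat -> R) :
  connected_graph G -> (forall e, 0 < t e) -> odd (multiplicity L (inr j)) ->
  csmooth phi -> box_support r phi -> (forall k, 0 < rho k) -> rho @ \oo --> (0 : R) ->
  cvanish (fun k => ((rho k)^-1 ^+ (2 * (\sum_i multiplicity L (inl i)) +
      ((\sum_j multiplicity L (inr j)) + (nV G).-1 * pdim d d')))%:C%C *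
    cintegral_rV (fun y => \prod_(l <- L) clin (edge_factor l.1 l.2) y *
      (graph_gaussian (fun e => rho k ^+ 2 * t e) y)%:C%C * phi y)).
Proof.
move=> conn t0 + sphi bphi rho0 rhol; have [Lz [Lx [pE <- <- <-]]] := split_kinds L; move=> oddj.
have [psi [spsi bpsi E]] := cintegral_zbar Lz t0 sphi bphi.
have [cr ci] := C1_cont (csmooth_C1 spsi).
have lim (g : 'rV[R]_N -> R) (cg : continuous g) (bg : box_support r g) :=
  rescaling_limit conn t0 oddj cg bg rho0 rhol.
have EE k : ((rho k)^-1 ^+ (2 * size Lz + (size Lx + (nV G).-1 * pdim d d')))%:C%C *
    cintegral_rV (fun y => \prod_(l <- L) clin (edge_factor l.1 l.2) y *
      (graph_gaussian (fun e => rho k ^+ 2 * t e) y)%:C%C * phi y) =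
  (-1) ^+ size Lz * (((rho k)^-1 ^+ (size Lx + (nV G).-1 * pdim d d'))%:C%C *
    cintegral_rV (fun y => (xmono Lx y * graph_gaussian (fun e => rho k ^+ 2 * t e) y)%:C%C * psi y)).
  under eq_fun do rewrite pE; rewrite E ?exprn_gt0 //.
  have -> : (fun y => \prod_(l <- Lx) clin (x_form d l.1 l.2) y * (graph_gaussian (fun e => rho k ^+ 2 * t e) y)%:C%C * psi y)
    = (fun y => (xmono Lx y * graph_gaussian (fun e => rho k ^+ 2 * t e) y)%:C%C * psi y).
    apply/funext => y; rewrite rmorphM; congr (_ * _ * _); rewrite rmorph_prod.
    by apply: eq_bigr => l _; rewrite clin_x.
  rewrite !mulrA; congr (_ * _); rewrite exprD rmorphM /= mulrAC; congr (_ * _).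
  rewrite exprM exprVn rmorphXn /= -exprMn; congr (_ ^+ _).
  by rewrite rmorphN mulrN -rmorphM mulVf // expf_neq0 // gt_eqF.
apply: (eq_cvanish EE); apply: cvanishZ; split.
  under eq_fun => k.
    rewrite ReM /= mul0r subr0; under eq_fun => y do rewrite ReM /= mul0r subr0.
    over.
  by apply: lim => // v k vk; rewrite (bpsi v k).
under eq_fun => k.
  rewrite ImM /= mul0r addr0; under eq_fun => y do rewrite ImM /= mul0r addr0.
  over.
by apply: lim => // v k vk; rewrite (bpsi v k).
Qed.

End MonomialLimit.

(** * Expansion of the fibre integral over slot sets and the balance of powers *)

Section FiberLimit.
Context {R : realType} (d d' : nat) (G : digraph) (n : decoration d G).
Local Notation C := R[i].
Local Notation N := (cdim d d' G).
Local Notation kind := ('I_d + 'I_d')%type.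
Local Notation tocomplex := (map_mx (fun a : R => a%:C%C)).
Local Notation K := (size (graph_factors d d' G)).
Context (Phi : dform R N).

Lemma pullback_lsubmx (y : 'rV[R]_N) (t : 'rV[R]_(nE G)) :
  pullback lsubmx Phi (row_mx y t) = ext_map (config_embedding d d' G) (Phi y).
Proof.
have -> : lsubmx = (fun q : 'rV[R]_(N + nE G) => q *m col_mx 1%:M 0).
  by apply/funext => q; rewrite -{2}(hsubmxK q) mul_row_col mulmx1 mulmx0 addr0.
rewrite pullback_mulmxr mul_row_col mulmx1 mulmx0 addr0 tr_col_mx trmx1 trmx0 map_row_mx.
by rewrite map_mx0 map_mx1.
Qed.

Lemma WtildeE (y : 'rV[R]_N) (t : 'rV[R]_(nE G)) :
  Wtilde n Phi (row_mx y t) =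
  wedge (\big[wedge/ext1]_(e < nE G) @edge_form R d d' G n e (row_mx y t))
    (ext_map (config_embedding d d' G) (Phi y)).
Proof.
rewrite /Wtilde /form_wedge pullback_lsubmx; congr (wedge _ _).
exact: (big_morph (fun w : dform R (N + nE G) => w (row_mx y t))).
Qed.

(** One entry for every single derivative of the decoration, hence for every zbar that it brings
    down. *)
Definition decoration_factors : seq ('I_(nE G) * 'I_d) :=
  flatten [seq nseq (n p.1 p.2) p | p <- [seq (e, i) | e <- index_enum 'I_(nE G), i <- enum 'I_d]].

Lemma prod_decoration (F : 'I_(nE G) * 'I_d -> C) :
  \prod_(l <- decoration_factors) F l = \prod_e \prod_(i <- enum 'I_d) F (e, i) ^+ n e i.
Proof.
rewrite /decoration_factors big_flatten big_map big_allpairs; apply: eq_bigr => e _.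
by apply: eq_bigr => i _; rewrite big_nseq iter_mulr_1.
Qed.

Definition slot_list (S : {set 'I_K}) : seq ('I_(nE G) * kind) :=
  [seq (l.1, inl l.2) | l <- decoration_factors] ++ [seq slot i | i <- enum S].

Definition shift_const (a : kind) (s : R) : R := if a is inl _ then s^-1 else (2 * s)^-1.

Definition slot_const (S : {set 'I_K}) (t : 'I_(nE G) -> R) : R :=
  (\prod_e @heat_const R d d' (t e)) * \prod_(l <- decoration_factors) (- (2 * t l.1)^-1) *
  \prod_(i in S) - shift_const (slot i).2 (t (slot i).1).

Definition slot_integrand (S : {set 'I_K}) (B : {set 'I_(nE G)}) (t : 'I_(nE G) -> R) (y : 'rV[R]_N) : C :=
  \prod_(l <- slot_list S) clin (edge_factor l.1 l.2) y * (graph_gaussian t y)%:C%C * slot_coef S B (Phi y).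

Lemma Wtilde_fiber_set B y t : no_self_loops G ->
  Wtilde n Phi (row_mx y t) (fiber_set d d' B) =
  \sum_(S : {set 'I_K}) (slot_const S (t 0))%:C%C * slot_integrand S B (t 0) y.
Proof.
move=> loop; rewrite WtildeE.
under eq_bigr do rewrite (edge_formE n y t (loop _)).
rewrite wedges_scale wedge_expand wedgeZl ext_scaleE wedge_suml sum_ffunE mulr_sumr.
apply: eq_bigr => S _; rewrite wedgeZl ext_scaleE -/(slot_coef S B (Phi y)) mulrA.
rewrite /slot_integrand [RHS]mulrA; congr (_ * _).
have decE : \prod_e \prod_(i <- enum 'I_d) (- ((2 * t 0 e)^-1)%:C%C * clin (zbar_form d' e i) y) ^+ n e i =
    \prod_(l <- decoration_factors) (- ((2 * t 0 l.1)^-1)%:C%C * clin (zbar_form d' l.1 l.2) y).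
  by rewrite prod_decoration.
rewrite /slot_list big_cat !big_map big_split /= decE big_split /=.
rewrite /slot_const !rmorphM /= big_enum /= graph_gaussianE.
rewrite (_ : \prod_(i in S) - edge_shift _ _ _ _ =
  (\prod_(i in S) - shift_const (slot i).2 (t 0 (slot i).1))%:C%C *
  \prod_(i in S) clin (edge_factor (slot i).1 (slot i).2) y); last first.
  rewrite rmorph_prod -big_split; apply: eq_bigr => i _.
  by rewrite /= rmorphN mulNr mulrC.
rewrite (_ : \prod_(e < nE G) _%:C%C = (\prod_e @heat_const R d d' (t 0 e))%:C%C *
  (\prod_e edge_gaussian e (t 0 e) y)%:C%C); last by rewrite -rmorphM -big_split rmorph_prod.
rewrite (_ : \prod_(l <- decoration_factors) - _ =
  (\prod_(l <- decoration_factors) (- (2 * t 0 l.1)^-1))%:C%C); last first.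
  by rewrite rmorph_prod; apply: eq_bigr => l _; rewrite /= rmorphN.
ring.
Qed.

Lemma heat_constZ (rho s : R) : 0 < rho -> 0 < s ->
  @heat_const R d d' (rho ^+ 2 * s) = rho^-1 ^+ (2 * d + d') * @heat_const R d d' s.
Proof.
move=> rho0 s0; rewrite /heat_const [pi * _]mulrCA [(_ * (pi * s)) `^ _]powRM ?exprn_ge0 ?mulr_ge0 ?pi_ge0 ?ltW //.
have -> : (rho ^+ 2) `^ (d%:R + d'%:R / 2) = rho ^+ (2 * d + d').
  rewrite -powR_mulrn ?ltW // -powRrM -powR_mulrn ?ltW //; congr (_ `^ _).
  by rewrite natrD natrM; field.
by rewrite mulrCA invfM exprVn.
Qed.

(** With t of order rho^2, a heat kernel costs 2 d + d' powers of rho, and each derivative of the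
    decoration and each [dt] slot costs two. *)
Lemma slot_constZ S (t : 'I_(nE G) -> R) rho : 0 < rho -> (forall e, 0 < t e) ->
  slot_const S (fun e => rho ^+ 2 * t e) =
  rho^-1 ^+ ((2 * d + d') * nE G + 2 * size decoration_factors + 2 * #|S|) * slot_const S t.
Proof.
move=> rho0 t0; rewrite /slot_const.
under eq_bigr do rewrite heat_constZ //.
under [X in _ * X * _]eq_bigr do rewrite mulrCA invfM -mulrN -exprVn.
under [X in _ * _ * X]eq_bigr => i _.
  rewrite (_ : - shift_const _ _ = rho^-1 ^+ 2 * - shift_const (slot i).2 (t (slot i).1)); last first.
    by rewrite /shift_const exprVn mulrN; case: (slot i).2 => _; rewrite -invfM // mulrCA.
  over.
rewrite !big_split /= !prodr_const card_ord.
have -> (x : R) : \prod_(l <- decoration_factors) x = x ^+ size decoration_factors.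
  by rewrite big_const_seq count_predT iter_mulr_1.
rewrite -!exprM !mul2n -!addnn !exprD.
by rewrite [in LHS](mulrACA (rho^-1 ^+ _)) [LHS]mulrACA.
Qed.

Context (Phi_smooth : smooth_form setT Phi).
Context (Phi_supp : compactly_supported Phi).

Lemma compact_box_support : exists r, box_support r Phi.
Proof.
have [X /compact_bounded[M [_ bM]] sX] := Phi_supp; exists (M + 1) => y k yk.
apply: sX => Xy; have h : `|y| <= M + 1 by apply: bM Xy; rewrite ltrDl.
have : `|y 0 k| <= `|y|.
  rewrite -[`|y|]/(mx_norm y) mx_normrE; exact: (le_bigmax _ (fun ij => `|y ij.1 ij.2|) (ord0, k)).
by move=> /le_trans /(_ h); rewrite leNgt yk.
Qed.

Lemma csmooth_slot_coef S B : csmooth (fun y => slot_coef S B (Phi y)).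
Proof.
have [c cE] := @slot_coef_linear R d d' G S B.
have -> : (fun y => slot_coef S B (Phi y)) = (fun y => \sum_A c A * Phi y A) by apply/funext => y.
elim: (index_enum _) => [|A s IH].
  by under eq_fun do rewrite big_nil; exact: csmooth_cst0.
under eq_fun do rewrite big_cons.
exact (csmoothD (csmoothZ (c A) (Phi_smooth A : csmooth (fun y => Phi y A))) IH).
Qed.

Lemma box_support_slot_coef S B r : box_support r Phi -> box_support r (fun y => slot_coef S B (Phi y)).
Proof.
move=> bPhi y k yk; have [c ->] := @slot_coef_linear R d d' G S B; rewrite (bPhi y k yk) big1 // => A _.
by rewrite ffunE mulr0.
Qed.

Lemma fiber_integralE B t : no_self_loops G ->
  fiber_integral (Wtilde n Phi) t B =
  \sum_(S : {set 'I_K}) (slot_const S (t 0))%:C%C * cintegral_rV (slot_integrand S B (t 0)).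
Proof.
move=> loop; have [r bPhi] := compact_box_support.
have a S : cadmissible (slot_integrand S B (t 0)).
  apply: (@cadmissible_support _ _ _ r); last first.
    by move=> y k yk; rewrite /slot_integrand (box_support_slot_coef S B bPhi yk) mulr0.
  apply: ccontinuousM; last exact: C1_cont (csmooth_C1 (csmooth_slot_coef S B)).
  apply: ccontinuousM; last exact: C1_cont (@C1_graph_gaussian R d d' G (t 0)).
  exact: ccontinuous_prod_clin.
rewrite ffunE -[X in cintegral_rV X]/(fun y => Wtilde n Phi (row_mx y t) (fiber_set d d' B)).
under eq_fun do rewrite Wtilde_fiber_set //.
rewrite cintegral_sum => [|S]; last exact: cadmissibleZ.
by apply: eq_bigr => S _; rewrite cintegralZ.
Qed.

Lemma multiplicity_slot_list S a : multiplicity (slot_list S) a =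
  (count (fun l : 'I_(nE G) * 'I_d => inl l.2 == a) decoration_factors + kind_count S a)%N.
Proof.
rewrite /multiplicity /slot_list count_cat !count_map /kind_count; congr addn.
rewrite -sum1_count big_enum_cond -sum1_card; apply: eq_bigl => i.
by rewrite inE.
Qed.

Lemma sum_multiplicity_inl S :
  (\sum_i multiplicity (slot_list S) (inl i) = size decoration_factors + \sum_i kind_count S (inl i))%N.
Proof.
under eq_bigr do rewrite multiplicity_slot_list.
rewrite big_split /=; congr addn; elim: decoration_factors => [|[e i] s IH] /=; first by rewrite big1.
rewrite big_split /= IH -add1n; congr addn.
by rewrite (bigD1 i) //= eqxx big1 ?addn0 // => i'; rewrite (inj_eq (@inl_inj _ _)) eq_sym => /negPf ->.
Qed.

Lemma multiplicity_inr S j : multiplicity (slot_list S) (inr j) = kind_count S (inr j).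
Proof. by rewrite multiplicity_slot_list (eq_count (a2 := pred0)) ?count_pred0. Qed.

(** The prefactor pays for the |E| - 1 slots in [S]. The remaining cost, (2 d + d') |E| and two for
    each derivative of the decoration, equals the gain in [monomial_limit] exactly, because |E| =
    h_1 + |V| - 1. *)
Lemma fiber_integral_vanish (t : 'I_(nE G) -> R) (rho : nat -> R) (B : {set 'I_(nE G)}) :
  laman d d' G -> (0 < d')%N -> odd (betti1 G) -> (0 < nE G)%N -> #|B| = (nE G).-1 ->
  (forall e, 0 < t e) -> (forall k, 0 < rho k) -> rho @ \oo --> (0 : R) ->
  cvanish (fun k => (rho k ^+ (2 * (nE G).-1))%:C%C *
    fiber_integral (Wtilde n Phi) (\row_e (rho k ^+ 2 * t e)) B).
Proof.
move=> hG d0 oddh nE0 cB t0 rho0 rhol; have [conn loop _ _] := hG.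
apply: (@eq_cvanish _ _ (fun k => \sum_(S : {set 'I_K}) (rho k ^+ (2 * (nE G).-1))%:C%C *
   ((slot_const S (fun e => rho k ^+ 2 * t e))%:C%C * cintegral_rV (slot_integrand S B (fun e => rho k ^+ 2 * t e))))).
  move=> k; rewrite fiber_integralE // mulr_sumr.
  have -> : (\row_e (rho k ^+ 2 * t e)) 0 = (fun e => rho k ^+ 2 * t e) by apply/funext => e; rewrite mxE.
  by [].
apply: cvanish_sum => S.
(* The rank and degree conditions concern [S] and [B] alone, so one constant form with nonzero
   coefficient yields them at every point of the configuration space. *)
have [E|] := pselect (forall a : ext R N, slot_coef S B a = 0).
  apply: (@eq_cvanish _ _ (fun=> 0)); last exact: cvanish0.
  move=> k; have -> : slot_integrand S B (fun e => rho k ^+ 2 * t e) = fun=> 0.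
    by apply/funext => y; rewrite /slot_integrand E mulr0.
  by rewrite cintegral0 !mulr0.
move=> /existsNP[w /eqP cS].
have [hk hE] := kind_count_betti hG d0 nE0 cB cS; have cardS := slot_coef_degree cS.
have [r bPhi] := compact_box_support.
have odd_j : odd (multiplicity (slot_list S) (inr (Ordinal d0))) by rewrite multiplicity_inr hk.
have := monomial_limit conn t0 odd_j (csmooth_slot_coef S B) (box_support_slot_coef S B bPhi) rho0 rhol.
rewrite sum_multiplicity_inl; under [X in (_ + (X + _))%N]eq_bigr do rewrite multiplicity_inr hk.
under [X in (2 * (_ + X))%N]eq_bigr do rewrite hk.
rewrite !sum_nat_const !card_ord => /(cvanishZ (slot_const S t)%:C%C).
apply: eq_cvanish => k; rewrite slot_constZ // mulrA -rmorphM [RHS]mulrA -rmorphM.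
congr (_%:C%C * _); rewrite mulrA [RHS]mulrC; congr (_ * _).
have rk : rho k != 0 by rewrite gt_eqF.
rewrite cardS cB addnC exprD mulrA -[RHS]mul1r; congr (_ * _).
  by rewrite exprVn mulfV // expf_neq0.
have {}hE : nE G = (betti1 G + (nV G).-1)%N by have := conn.1; lia.
(* The balance of powers: (2 d + d') (h_1 + |V| - 1) on one side, 2 d h_1 + d' h_1 + (|V| - 1) (d' +
   2 d) on the other, and 2 z on both. *)
by congr (_ ^+ _); move: (size _) => z; rewrite hE /pdim; ring.
Qed.

End FiberLimit.

(** * Restriction to the boundary *)

Section Jacobian.
Context {R : realType}.
Local Notation C := R[i].
Local Notation tocomplex := (map_mx (fun a : R => a%:C%C)).

Lemma differentiable_coordinates m n (f : 'rV[R]_m -> 'rV[R]_n) (x : 'rV[R]_m) :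
  (forall j, differentiable (fun y => f y 0 j) x) -> differentiable f x.
Proof.
move=> df; have -> : f = \sum_(j < n) (fun y => f y 0 j *: ('e_j : 'rV[R]_n)).
  by apply/funext => y; rewrite fct_sumE [LHS]row_sum_delta.
by apply: differentiable_sum => j; exact: differentiableZl.
Qed.

Lemma row_jacobian m n (f : 'rV[R]_m -> 'rV[R]_n) (x : 'rV[R]_m) i : differentiable f x ->
  row i (jacobian f x) = 'D_('e_i) f x.
Proof. by move=> df; rewrite rowE deriveEjacobian. Qed.

Lemma jacobian_entry m n (f : 'rV[R]_m -> 'rV[R]_n) (x : 'rV[R]_m) i j : differentiable f x ->
  jacobian f x i j = 'D_('e_i) (fun y => f y 0 j) x.
Proof.
move=> df; transitivity (row i (jacobian f x) 0 j); first by rewrite [RHS]mxE.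
by rewrite row_jacobian // derive_mx ?mxE //; exact: diff_derivable.
Qed.

Lemma jacobian_comp l m n (f : 'rV[R]_l -> 'rV[R]_m) (g : 'rV[R]_m -> 'rV[R]_n) (x : 'rV[R]_l) :
  differentiable f x -> differentiable g (f x) -> jacobian (g \o f) x = jacobian f x *m jacobian g (f x).
Proof.
move=> df dg; have dgf := differentiable_comp df dg.
apply/row_matrixP => i; rewrite !rowE mulmxA.
rewrite -(deriveEjacobian _ dgf) -(deriveEjacobian _ df) -(deriveEjacobian _ dg).
by rewrite (deriveE _ dgf) (deriveE _ df) (deriveE _ dg) diff_comp.
Qed.

Lemma near_jacobian m n (f g : 'rV[R]_m -> 'rV[R]_n) (x : 'rV[R]_m) :
  differentiable f x -> differentiable g x -> (\near x, f x = g x) -> jacobian f x = jacobian g x.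
Proof.
move=> df dg fg; apply/row_matrixP => i; apply: etrans (row_jacobian i df) _; apply: etrans _ (esym (row_jacobian i dg)).
exact: near_eq_derive.
Qed.

Lemma pullback_comp l m n (f : 'rV[R]_l -> 'rV[R]_m) (g : 'rV[R]_m -> 'rV[R]_n) (w : dform R n) x :
  differentiable f x -> differentiable g (f x) ->
  pullback (g \o f) w x = ext_map (tocomplex (jacobian f x)^T) (pullback g w (f x)).
Proof.
by move=> df dg; rewrite !pullbackE jacobian_comp // trmx_mul map_mxM ext_map_comp.
Qed.

Lemma jacobianD_cst m n (f : 'rV[R]_m -> 'rV[R]_n) c (x : 'rV[R]_m) : differentiable f x ->
  jacobian (fun y => f y + c) x = jacobian f x.
Proof.
move=> df; have dc : differentiable (cst c) x := @differentiable_cst _ _ _ c x.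
have dfc : differentiable (fun y => f y + c) x by exact: (differentiableD df dc).
apply/row_matrixP => i; apply: etrans (row_jacobian i dfc) _; apply: etrans _ (esym (row_jacobian i df)).
rewrite (@deriveD _ _ _ f (cst c)) ?derive_cst ?addr0 //; exact: diff_derivable.
Qed.

Lemma jacobianZ m n (f : 'rV[R]_m -> 'rV[R]_n) c (x : 'rV[R]_m) : differentiable f x ->
  jacobian (fun y => c *: f y) x = c *: jacobian f x.
Proof.
move=> df; have dcf : differentiable (fun y => c *: f y) x by exact: differentiableZ.
apply/row_matrixP => i; apply: etrans (row_jacobian i dcf) _.
by rewrite linearZ /= row_jacobian // deriveZ //; exact: diff_derivable.
Qed.

End Jacobian.

(** * Differentiability and Jacobians of [t_square], polar coordinates and the sphere chart *)

Section Boundary.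
Context {R : realType}.
Local Notation C := R[i].
Local Notation Re := complex.Re.
Local Notation Im := complex.Im.
Local Notation tocomplex := (map_mx (fun a : R => a%:C%C)).

Lemma eq_differentiable (V W : normedModType R) (f g : V -> W) x : g =1 f ->
  differentiable f x -> differentiable g x.
Proof. by move=> /funext ->. Qed.

Lemma differentiable_square n (k : 'I_n) (x : 'rV[R]_n) : differentiable (fun y : 'rV[R]_n => y 0 k ^+ 2) x.
Proof. by apply: (@differentiableX _ _ (fun y : 'rV[R]_n => y 0 k) 1); exact: differentiable_coord. Qed.

Lemma differentiable_sqnorm n (x : 'rV[R]_n) : differentiable (fun y : 'rV[R]_n => \sum_k y 0 k ^+ 2) x.
Proof.
have -> : (fun y : 'rV[R]_n => \sum_k y 0 k ^+ 2) = \sum_(k < n) (fun y : 'rV[R]_n => y 0 k ^+ 2).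
  by apply/funext => y; rewrite fct_sumE.
by apply: differentiable_sum => k; exact: differentiable_square.
Qed.

Lemma differentiable_sqrt (V : normedModType R) (f : V -> R) x : differentiable f x -> 0 < f x ->
  differentiable (fun y => Num.sqrt (f y)) x.
Proof.
move=> df fx; apply: (@differentiable_comp _ _ _ _ f Num.sqrt) => //.
by apply/derivable1_diffP; have [] := is_derive1_sqrt fx.
Qed.

Lemma differentiable_t_square n (x : 'rV[R]_n) : differentiable t_square x.
Proof.
apply: differentiable_coordinates => j; rewrite /t_square; under eq_fun do rewrite mxE.
exact: differentiable_square.
Qed.

Lemma jacobian_t_square n (x : 'rV[R]_n) : jacobian t_square x = diag_mx (\row_e (2 * x 0 e)).
Proof.
apply/matrixP => i j; rewrite jacobian_entry; last exact: differentiable_t_square.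
rewrite /t_square; under eq_fun do rewrite mxE.
have dc : is_derive x ('e_i : 'rV[R]_n) (fun y : 'rV[R]_n => y 0 j) ((i == j)%:R : R).
  have := is_derive_rlin ('e_j : 'rV[R]_n) i x; rewrite mxE eqxx /=.
  by rewrite (_ : rlin 'e_j = fun y : 'rV[R]_n => y 0 j) //; apply/funext => y; rewrite rlin_delta.
have [_ E] := is_deriveM dc dc.
rewrite (_ : (fun y : 'rV[R]_n => y 0 j ^+ 2) = (fun y : 'rV[R]_n => y 0 j) * (fun y : 'rV[R]_n => y 0 j)); last first.
  by apply/funext => y; rewrite expr2.
rewrite E !mxE /GRing.scale /=.
by have [->|_] := eqVneq i j; rewrite ?mulr0 ?addr0 ?mulr1n ?mulr0n ?mulr1 // mulr_natl.
Qed.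

Lemma pullback_t_square n (w : dform R n) (s : 'rV[R]_n) B :
  pullback t_square w s B = (\prod_(j in B) (2 * s 0 j))%:C%C * w (t_square s) B.
Proof.
rewrite pullbackE jacobian_t_square tr_diag_mx map_diag_mx ext_map_diag rmorph_prod.
by congr (_ * _); apply: eq_bigr => j _; rewrite !mxE.
Qed.

Lemma differentiable_polar n (s : 'rV[R]_n) : 0 < \sum_k s 0 k ^+ 2 -> differentiable (@polar R n) s.
Proof.
move=> s0; have dr := differentiable_sqrt (differentiable_sqnorm s) s0.
apply: differentiable_coordinates => j; rewrite /polar.
case: (split_ordP j) => k -> {j}.
  apply: eq_differentiable dr => y.
  by rewrite row_mxEl mxE (ord1 k) eqxx mulr1n.
apply: (eq_differentiable (f := fun y : 'rV[R]_n => (Num.sqrt (\sum_k y 0 k ^+ 2))^-1 * y 0 k)) => [y|].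
  by rewrite row_mxEr mxE.
apply: differentiableM; last exact: differentiable_coord.
by apply: differentiableV => //; rewrite gt_eqF // sqrtr_gt0.
Qed.

Context {m : nat}.
Implicit Types u : 'rV[R]_m.

Definition sphere_chart u : 'rV[R]_(1 + m) :=
  row_mx ((Num.sqrt (1 - \sum_i u 0 i ^+ 2))%:M : 'rV[R]_1) u.

Lemma differentiable_sphere_chart u : octant_ball u -> differentiable sphere_chart u.
Proof.
move=> [_ u1]; apply: (@differentiable_coordinates _ _ (1 + m)) => j; rewrite /sphere_chart.
case: (split_ordP j) => k -> {j}; last first.
  by apply: eq_differentiable (differentiable_coord u 0 k) => y; rewrite row_mxEr.
apply: (eq_differentiable (f := fun y : 'rV[R]_m => Num.sqrt (1 - \sum_i y 0 i ^+ 2))) => [y|].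
  by rewrite row_mxEl mxE (ord1 k) eqxx mulr1n.
apply: differentiable_sqrt; last by rewrite subr_gt0.
by apply: differentiableB; [exact: differentiable_cst|exact: differentiable_sqnorm].
Qed.

Lemma sphere_chart_gt0 u e : octant_ball u -> 0 < sphere_chart u 0 e.
Proof.
rewrite /sphere_chart => -[u0 u1]; case: (@split_ordP 1 m e) => k ->.
  by rewrite row_mxEl mxE (ord1 k) eqxx mulr1n sqrtr_gt0 subr_gt0.
by rewrite row_mxEr.
Qed.

Lemma sphere_chart_norm u : octant_ball u -> \sum_e sphere_chart u 0 e ^+ 2 = 1.
Proof.
rewrite /sphere_chart => -[u0 u1]; rewrite (@big_split_ord _ _ _ 1 m) /= big_ord1 row_mxEl mxE eqxx mulr1n sqr_sqrtr; last first.
  by rewrite subr_ge0 ltW.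
by under [X in _ + X]eq_bigr do rewrite row_mxEr; rewrite subrK.
Qed.

Lemma open_octant_ball : open (@octant_ball R m).
Proof.
rewrite openE => u [u0 u1].
have h1 : \forall v \near u, forall i, 0 < (v : 'rV[R]_m) 0 i.
  apply: (@filter_forall _ _ (fun i (v : 'rV[R]_m) => is_true (0 < v 0 i)) (nbhs u)) => i.
  by apply: (@cvgr_gt _ _ (nbhs u) _ (fun v : 'rV[R]_m => v 0 i) (u 0 i)) (u0 i); exact: coord_continuous.
have h2 : \forall v \near u, \sum_(i < m) (v : 'rV[R]_m) 0 i ^+ 2 < 1.
  apply: (@cvgr_lt _ _ (nbhs u) _ (fun v : 'rV[R]_m => \sum_(i < m) v 0 i ^+ 2) (\sum_(i < m) u 0 i ^+ 2)) u1.
  exact: differentiable_continuous (differentiable_sqnorm u).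
by apply: filterS2 h1 h2 => v; split.
Qed.

Lemma polar_sphere_chart u (rho : R) : octant_ball u -> 0 < rho ->
  polar (rho *: sphere_chart u) = row_mx (rho%:M : 'rV[R]_1) (sphere_chart u).
Proof.
move=> u1 rho0; rewrite /polar; under eq_bigr do rewrite mxE exprMn.
rewrite -mulr_sumr sphere_chart_norm // mulr1 sqrtr_sqr gtr0_norm //.
by rewrite scalerA mulVf ?scale1r // gt_eqF.
Qed.

End Boundary.

(** * Boundary values of a smooth extension as limits from the interior *)

Section BoundaryLimit.
Context {R : realType} (m : nat) (a : dform R m.+1) (omega : dform R (1 + m.+1)).
Context (omega_ext : smooth_extension a omega).
Local Notation C := R[i].
Local Notation Re := complex.Re.
Local Notation Im := complex.Im.
Local Notation tocomplex := (map_mx (fun a : R => a%:C%C)).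
Implicit Types u : 'rV[R]_m.

Let bc : 'rV[R]_m -> 'rV[R]_(1 + m.+1) := @boundary_chart R m.

Let bcE u : bc u = row_mx (0 : 'rV[R]_1) (sphere_chart u : 'rV[R]_m.+1).
Proof. by []. Qed.

Let differentiable_bc u : octant_ball u -> differentiable bc u.
Proof.
move=> u1; apply: differentiable_coordinates => j; case: (split_ordP j) => k -> {j}.
  apply: eq_differentiable (differentiable_cst (0 : R) u) => v.
  by rewrite bcE row_mxEl mxE.
apply: (eq_differentiable (f := fun v => sphere_chart v 0 k)) => [v|]; first by rewrite bcE row_mxEr.
have dc := differentiable_coord (sphere_chart u : 'rV[R]_m.+1) 0 k.
exact: (@differentiable_comp _ _ _ _ (@sphere_chart R m) (fun N : 'rV[R]_m.+1 => N 0 k) u (differentiable_sphere_chart u1) dc).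
Qed.

(** At fixed rho the map u -> (rho, sphere point) differs from the boundary chart by a constant and
    so has the same Jacobian. It is also [polar] after rho times the sphere chart, which turns
    [omega] into [a]; the diagonal matrix is the Jacobian of the scaling by rho. *)
Lemma boundary_pullback u (rho : R) : octant_ball u -> 0 < rho ->
  ext_map (tocomplex (jacobian (@boundary_chart R m) u)^T) (omega (row_mx (rho%:M : 'rV[R]_1) (sphere_chart u))) =
  ext_map (tocomplex (jacobian (@sphere_chart R m) u)^T)
    (ext_map (diag_mx (const_mx rho%:C%C)) (a (rho *: sphere_chart u))).
Proof.
move=> u1 rho0; pose f v := rho *: (sphere_chart v : 'rV[R]_m.+1).
have ds := differentiable_sphere_chart u1.
have df : differentiable f u by exact: differentiableZ.
have f0 e : 0 < f u 0 e by rewrite /f mxE mulr_gt0 ?sphere_chart_gt0.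
have dp : differentiable (@polar R m.+1) (f u).
  by apply: differentiable_polar; rewrite big_ord_recl ltr_pwDl ?exprn_gt0 ?f0 // sumr_ge0 // => e _; exact: sqr_ge0.
have [_ aE] := omega_ext; rewrite -[a _]/(a (f u)) -aE //.
rewrite ext_map_comp.
have -> : diag_mx (const_mx rho%:C%C) *m tocomplex (jacobian (@sphere_chart R m) u)^T =
    tocomplex (jacobian f u)^T :> 'M[C]_(m.+1, m).
  rewrite (jacobianZ rho ds) diag_const_mx mul_scalar_mx; apply/matrixP => i j; rewrite !mxE.
  by rewrite rmorphM.
apply: etrans _ (pullback_comp omega df dp).
rewrite pullbackE (polar_sphere_chart u1 rho0 : (@polar R m.+1 \o f) u = _).
suff -> : jacobian (@polar R m.+1 \o f) u = jacobian (@boundary_chart R m) u by [].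
pose c : 'rV[R]_(1 + m.+1) := row_mx (rho%:M : 'rV[R]_1) 0.
apply: etrans _ (jacobianD_cst c (differentiable_bc u1)).
apply: near_jacobian.
- exact: differentiable_comp df dp.
- by apply: differentiableD; [exact: differentiable_bc|exact: differentiable_cst].
have := open_nbhs_nbhs (conj (@open_octant_ball R m) u1); apply: filterS => v v1 /=.
by rewrite polar_sphere_chart // bcE /c add_row_mx add0r addr0.
Qed.

Lemma ext_map_coef k n (M : 'M[C]_(k, n)) (w : ext R k) A :
  ext_map M w A = \sum_B w B * ext_map M (ext_basis B) A.
Proof.
rewrite {1}(ext_sum_basis w) ext_map_sum sum_ffunE; apply: eq_bigr => B _.
by rewrite ext_mapZ ext_scaleE.
Qed.

(** The sequence [v] pulls back the interior values with the boundary Jacobian. It tends to 0 by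
    hypothesis, and to the coefficient at rho = 0 by continuity of [omega] there. *)
Lemma boundary_pullback_eq0 u (rho : nat -> R) : octant_ball u ->
  (forall k, 0 < rho k) -> rho @ \oo --> (0 : R) ->
  (forall B : {set 'I_m.+1}, #|B| = m ->
     cvanish (fun k => (rho k ^+ m)%:C%C * a (rho k *: sphere_chart u) B)) ->
  pullback (@boundary_chart R m) omega u [set: 'I_m]%SET = 0.
Proof.
move=> u1 rho0 rhol av; rewrite pullbackE; set M := tocomplex _; set T := [set: _]%SET.
pose x k : 'rV[R]_(1 + m.+1) := row_mx ((rho k)%:M : 'rV[R]_1) (sphere_chart u).
pose v k := ext_map M (omega (x k)) T.
have v0 : cvanish v.
  pose M' := tocomplex (jacobian (@sphere_chart R m) u)^T.
  apply: (@eq_cvanish _ _ (fun k => \sum_(B : {set 'I_m.+1})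
     ext_map M' (ext_basis B) T * ((rho k ^+ #|B|)%:C%C * a (rho k *: sphere_chart u) B))).
    move=> k; rewrite /v /M boundary_pullback // ext_map_coef; apply: eq_bigr => B _.
    rewrite mulrC; congr (_ * _); rewrite ext_map_diag; congr (_ * _).
    by under eq_bigr do rewrite mxE; rewrite prodr_const rmorphXn.
  (* The top coefficient on an m-dimensional chart sees only the components of degree m. *)
  apply: cvanish_sum => B; have [Bm|Bm] := eqVneq #|B| m; first by rewrite Bm; exact/cvanishZ/av.
  apply: (@eq_cvanish _ _ (fun=> 0)) => [k|]; last exact: cvanish0.
  by rewrite ext_map_basis covectors_degree ?mul0r // cardsT card_ord -cardE eq_sym.
have vl : cvanish (fun k => v k - ext_map M (omega (bc u)) T).
  apply: (@eq_cvanish _ _ (fun k => \sum_(A : {set 'I_(1 + m.+1)})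
     ext_map M (ext_basis A) T * (omega (x k) A - omega (bc u) A))).
    move=> k; rewrite /v ext_map_coef [X in _ - X]ext_map_coef -sumrB; apply: eq_bigr => A _.
    by rewrite -mulrBl mulrC.
  apply: cvanish_sum => A; apply: cvanishZ.
  have [[U [_ UC smooth]] _] := omega_ext.
  have Ubc : U (bc u).
    apply: UC; split.
    - by rewrite bcE row_mxEl mxE.
    - by move=> e; rewrite bcE row_mxEr sphere_chart_gt0.
    - by under eq_bigr do rewrite bcE row_mxEr; exact: sphere_chart_norm.
  have xl : x @ \oo --> bc u.
    have -> : bc u = row_mx ((0 : R)%:M : 'rV[R]_1) (sphere_chart u) by rewrite bcE raddf0.
    by apply: cvg_row_mx; [exact: cvg_scalar_mx|exact: cvg_cst].
  have lim (g : 'rV[R]_(1 + m.+1) -> R) : {for bc u, continuous g} -> (fun k => g (x k) - g (bc u)) @ \oo --> (0 : R).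
    move=> cg; rewrite -(subrr (g (bc u))); apply: cvgB; last exact: cvg_cst.
    exact: (@cvg_comp _ _ _ x g _ _ _ xl).
  have [s1 s2] := smooth A.
  have [c1 _] := s1 [::] _ Ubc; have [c2 _] := s2 [::] _ Ubc.
  have ReB (z w : C) : Re (z - w) = Re z - Re w by case: z; case: w.
  have ImB (z w : C) : Im (z - w) = Im z - Im w by case: z; case: w.
  split; first by under eq_fun do rewrite ReB; exact: (lim (fun y => Re (omega y A))).
  by under eq_fun do rewrite ImB; exact: (lim (fun y => Im (omega y A))).
have [r i] : cvanish (fun=> ext_map M (omega (bc u)) T).
  apply: (@eq_cvanish _ _ (fun k => v k + -1 * (v k - ext_map M (omega (bc u)) T))) => [k|].
    by rewrite mulN1r opprB addrCA subrr addr0.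
  by apply: cvanishD => //; exact: cvanishZ.
rewrite -/bc; move: r i; case: (ext_map _ _ _) => p q /= r i.
have := cvg_unique (@norm_hausdorff _ _) r (cvg_cst p); have := cvg_unique (@norm_hausdorff _ _) i (cvg_cst q).
by move=> <- <-.
Qed.

End BoundaryLimit.

Lemma boundary_integral_eq0 (R : realType) q (a : dform R q) (omega : dform R (1 + q)) :
  smooth_extension a omega ->
  (forall (xi : 'rV[R]_q) (rho : nat -> R) (B : {set 'I_q}), (0 < q)%N -> #|B| = q.-1 ->
     (forall e, 0 < xi 0 e) -> (forall k, 0 < rho k) -> rho @ \oo --> (0 : R) ->
     cvanish (fun k => (rho k ^+ q.-1)%:C%C * a (rho k *: xi) B)) ->
  boundary_integral omega = 0.
Proof.
case: q a omega => [//|m] a omega aomega av.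
rewrite -(cintegral0 m) /boundary_integral; congr cintegral_rV; apply/funext => u.
case: ifPn => // /set_mem u1.
(* Any positive sequence tending to 0 would do. *)
apply: (boundary_pullback_eq0 aomega u1 (rho := fun k => k.+1%:R^-1)) => [k||B Bm].
- by rewrite invr_gt0.
- exact: cvg_harmonic.
by apply: av => // [e|]; [exact: sphere_chart_gt0|exact: cvg_harmonic].
Qed.

Theorem proposition3p23 (R : realType) (d d' : nat) (G : digraph)
    (n : decoration d G) (Phi : dform R (cdim d d' G))
    (hG : laman d d' G)
    (hPhi_smooth : smooth_form setT Phi)
    (hPhi_supp : compactly_supported Phi)
    (hd' : (1 <= d')%N)
    (hbetti : odd (betti1 G))
    (omega : dform R (1 + nE G))
    (homega : smooth_extension (schwinger_form n Phi) omega) :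
  boundary_integral omega = 0%R.
Proof.
apply: (boundary_integral_eq0 homega) => xi rho B nE0 cB xi0 rho0 rhol.
(* After [t_square] the direction in Schwinger space is the vector of the squares of [xi]. *)
have xi2 e : 0 < xi 0 e ^+ 2 by rewrite exprn_gt0.
have /(cvanishZ (\prod_(j in B) (2 * xi 0 j))%:C%C) :=
  fiber_integral_vanish n hPhi_smooth hPhi_supp hG hd' hbetti nE0 cB xi2 rho0 rhol.
apply: eq_cvanish => k; rewrite /schwinger_form pullback_t_square.
have -> : t_square (rho k *: xi) = \row_e (rho k ^+ 2 * xi 0 e ^+ 2).
  by apply/rowP => e; rewrite !mxE exprMn.
rewrite !mulrA; congr (_ * _); rewrite -!rmorphM; congr (_%:C)%C.
under eq_bigr do rewrite mxE mulrCA.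
(* The power rho^(|E| - 1) from the radial scaling and the same power from the Jacobian 2 rho xi_e
   of [t_square] make up rho^(2 (|E| - 1)). *)
by rewrite big_split prodr_const /= cB mulrA -exprD addnn -mul2n mulrC.
Qed.
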